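(* Let $k\ge 3$ be an odd integer, let $0<p\le\frac12$ be fixed, let $m=m_n$ be integers with $m=p\binom n2+O(1)$ as $n\to\infty$, and let $A=A_n$ be the adjacency matrix of a $\mathcal G(n,m)$ random graph. Let $c_*=\min\{1,\frac{k(k-2)}{2k-2}\}$ and let $t=t_n>0$ satisfy $n^{-c_*}\ll t^k\ll 1$. Then, as $n\to\infty$, $\Pr(\tau_k(A)\le p^k-t^k)$ is bounded above by $$\exp\left(-\frac{\ln\frac{p}{1-p}}{2(2p-1)}\,t^2n^2+o(t^2n^2)\right)$$ (with the convention that $\frac{\ln\frac{p}{1-p}}{2p-1}=2$ when $p=\frac12$) and bounded below by $$\exp\left(-\frac{1}{2p(1-p)}\,t^2n^2+o(t^2n^2)\right).$$ Moreover, conditioned on $\tau_k(A)\le p^k-t^k$, with high probability $\lambda_n(A)=-\Omega(tn)$; that is, for every $\epsilon>0$ there is $c>0$ such that $$\limsup_{n\to\infty}\Pr\left(\lambda_n(A)>-c\,tn\ \middle|\ \tau_k(A)\le p^k-t^k\right)\le\epsilon .$$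
   Context: $\mathcal G(n,m)$ is the uniform distribution on (simple, labelled) graphs with $n$ vertices and $m$ edges. For a graph $G$ with adjacency matrix $A$, $T_k(G)$ is the number of injective maps $\phi:\{1,\dots,k\}\to V(G)$ such that $\{\phi(1),\phi(2)\},\{\phi(2),\phi(3)\},\dots,\{\phi(k),\phi(1)\}$ are all edges of $G$, and the $k$-cycle density is $\tau_k(A)=\tau_k(G)=\frac{T_k(G)}{n(n-1)\cdots(n-k+1)}\in[0,1]$. Eigenvalues of a symmetric $n\times n$ matrix are ordered $\lambda_1\ge\dots\ge\lambda_n$. For positive sequences, $f\ll g$ (equivalently $f=o(g)$) means $f/g\to0$ as $n\to\infty$. Note that $c_*=3/4$ for $k=3$ and $c_*=1$ for $k\ge5$. *)

(* Defs.v *)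
From HB Require Import structures.
From mathcomp Require Import all_boot all_order all_algebra.
From mathcomp Require Import all_classical all_reals all_analysis.
From mathcomp Require complex.

Set Implicit Arguments.
Unset Strict Implicit.
Unset Printing Implicit Defensive.

Import Order.TTheory GRing.Theory Num.Theory.
Import numFieldNormedType.Exports.

Local Open Scope ring_scope.

(* A simple graph on 'I_n is given by its set of edges, each edge being a     *)
(* two-element set of vertices.                                               *)
Definition graph (n : nat) := {set {set 'I_n}}.

Definition all_edges (n : nat) : graph n := [set e : {set 'I_n} | #|e| == 2%N].

Definition Gnm_support (n m : nat) : {set graph n} :=
  [set G : graph n | (G \subset all_edges n) && (#|G| == m)].

(* Probability of the event P under G(n,m); it is 0 if there is no graph with *)
(* n vertices and m edges.                                                    *)
Definition Pr_Gnm (R : realType) (n m : nat) (P : pred (graph n)) : R :=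
  #|[set G in Gnm_support n m | P G]|%:R / #|Gnm_support n m|%:R.

(* Conditional probability of P given Q; it is 0 if Q has probability 0.      *)
Definition cPr_Gnm (R : realType) (n m : nat) (P Q : pred (graph n)) : R :=
  Pr_Gnm R m [pred G | P G && Q G] / Pr_Gnm R m Q.

Definition adjmx (R : realType) (n : nat) (G : graph n) : 'M[R]_n :=
  \matrix_(i, j) ([set i; j] \in G)%:R.

(* ordS is the cyclic successor on 'I_k.                                      *)
Definition T_ (k n : nat) (G : graph n) : nat :=
  #|[set phi : {ffun 'I_k -> 'I_n} |
      injectiveb phi && [forall i, [set phi i; phi (ordS i)] \in G]]|.

Definition tau (R : realType) (k n : nat) (G : graph n) : R :=
  (T_ k G)%:R / (n ^_ k)%:R.

(* The eigenvalues of A in nonincreasing order, repeated according to         *)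
(* algebraic multiplicity; the default [::] is never used for symmetric A,    *)
(* see spectrumP.                                                             *)
Definition spectrum (R : realType) (n : nat) (A : 'M[R]_n) : seq R :=
  xget [::] [set s : seq R | sorted >=%O s
                           /\ char_poly A = \prod_(x <- s) ('X - x%:P)]%classic.

(* Indexed from 1, so that eigval A 1 >= ... >= eigval A n.                   *)
Definition eigval (R : realType) (n : nat) (A : 'M[R]_n) (i : nat) : R :=
  (spectrum A)`_i.-1.

Module SpectrumExists.
Import complex.
Local Notation rC := (real_complex _).

Lemma ex_spectrum (R : realType) (n : nat) (A : 'M[R]_n) : A^T = A ->
  exists s : seq R, char_poly A = \prod_(x <- s) ('X - x%:P).
Proof.
move=> symA; pose C := R[i]%C; pose AC : 'M[C]_n := map_mx (real_complex R) A.
have rK (x : R) : Num.conj (real_complex R x) = real_complex R x.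
  by apply/eqP; rewrite eq_complex /= oppr0 !eqxx.
have hA : AC \is hermsymmx.
  apply/is_hermitianmxP; rewrite expr0 scale1r.
  by apply/matrixP=> i j; rewrite !mxE rK -[in RHS]symA mxE.
have /orthomx_spectralP eA := hermitian_normalmx hA.
have sr := hermitian_spectral_diag_real hA.
set P := spectralmx AC in eA; set d := spectral_diag AC in eA sr.
have Pu : P \in unitmx := spectral_unit AC.
have cpA : char_poly AC = \prod_(i < n) ('X - (d 0 i)%:P).
  have simP : char_poly AC = char_poly (diag_mx d).
    rewrite /char_poly {1}eA /char_poly_mx !map_mxM /= map_invmx.
    set PX := map_mx _ P; have PXu : PX \in unitmx by rewrite map_unitmx.
    have -> : 'X%:M - invmx PX *m map_mx polyC (diag_mx d) *m PX
            = invmx PX *m ('X%:M - map_mx polyC (diag_mx d)) *m PX.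
      rewrite mulmxBr mulmxBl; congr (_ - _).
      by rewrite scalar_mxC -mulmxA mulVmx ?mulmx1.
    by rewrite !det_mulmx mulrAC -det_mulmx mulVmx // det1 mul1r.
  rewrite simP char_poly_trig; last first.
    exact/diag_mx_is_trig.
  by apply: eq_bigr => i _; rewrite mxE eqxx mulr1n.
exists [seq Re (d 0 i) | i <- enum 'I_n].
apply: (@map_poly_inj _ _ (real_complex R)).
rewrite map_char_poly cpA rmorph_prod big_map big_enum /=.
apply: eq_bigr => i _; rewrite rmorphB /= map_polyX map_polyC /=.
congr (_ - _%:P); apply/esym/RRe_real.
by have /mxOverP := sr; apply.
Qed.

End SpectrumExists.

Lemma spectrumP (R : realType) (n : nat) (A : 'M[R]_n) : A^T = A ->
  [/\ sorted >=%O (spectrum A), size (spectrum A) = n &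
      char_poly A = \prod_(x <- spectrum A) ('X - x%:P)].
Proof.
move=> /SpectrumExists.ex_spectrum[s es].
have [sS eS] : sorted >=%O (spectrum A)
    /\ char_poly A = \prod_(x <- spectrum A) ('X - x%:P).
  rewrite /spectrum.
  apply: (@xgetPex _ [::] [set s : seq R | sorted >=%O s
                           /\ char_poly A = \prod_(x <- s) ('X - x%:P)]%classic).
  exists (sort >=%O s); split; first by apply: sort_sorted => x y; exact: le_total.
  by rewrite es; apply: perm_big; rewrite perm_sym perm_sort.
split => //.
have := congr1 (fun p : {poly R} => size p) eS.
by rewrite /= size_char_poly size_prod_XsubC => -[].
Qed.

Lemma adjmx_sym (R : realType) (n : nat) (G : graph n) :
  (adjmx R G)^T = adjmx R G.
Proof. by apply/matrixP=> i j; rewrite !mxE finset.setUC. Qed.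

Definition c_star (R : realType) (k : nat) : R :=
  Num.min 1 (k%:R * (k%:R - 2) / (2 * k%:R - 2)).

(* ln (p / (1 - p)) / (2p - 1), extended by continuity at p = 1/2.            *)
Definition kappa (R : realType) (p : R) : R :=
  if p == 2^-1 then 2 else ln (p / (1 - p)) / (2 * p - 1).

(* Main.v *)
Require Import Defs.
From HB Require Import structures.
From mathcomp Require Import all_boot all_order all_algebra.
From mathcomp Require Import all_classical all_reals all_analysis.
From mathcomp Require Import ring lra zify.

Set Implicit Arguments.
Unset Strict Implicit.
Unset Printing Implicit Defensive.

Import Order.TTheory GRing.Theory Num.Theory.
Import numFieldNormedType.Exports.

Local Open Scope ring_scope.

(* The estimate [n = o(t^2 n^2)] makes it harmless to replace G(n,m) by the   *)
(* binomial random graph, with probability [p] for each edge, at the price of *)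
(* a factor [exp (O(n))].                                                     *)
(*                                                                            *)
(* Upper bound. The trace of [A ^ k] is the sum of the [k]-th powers of the   *)
(* eigenvalues, and the top one is at least [2m/n]. Hence a cycle density of  *)
(* at most [p^k - t^k] forces the eigenvalues below [- K sqrt n] to satisfy   *)
(* [sum |x|^k >= (1 - o(1)) t^k n^k], the other ones contributing a           *)
(* negligible amount: trivially if [k >= 5], and for [k = 3] by concentration *)
(* of convex Lipschitz functions of the edges (Maurey's property (tau)),      *)
(* applied to truncated cubes of the eigenvalues. The [l^2] norm dominates    *)
(* the [l^k] norm, so the squares of these eigenvalues sum to at least        *)
(* [(1 - o(1)) t^2 n^2]; some [O(t^2 n / K^2)] of them already do, and their  *)
(* eigenvectors give a matrix of that rank and of Frobenius norm 1 whose      *)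
(* inner product with the centered adjacency matrix is [(1 - o(1)) t n].      *)
(* Centered edges are subgaussian with the optimal (Kearns--Saul) constant    *)
(* [kappa p], and low-rank matrices have a small net. If in addition all      *)
(* eigenvalues exceed [- c t n], then the sum of the squares is at least      *)
(* [(1 - o(1)) c^(2-k) t^2 n^2], an event which for small [c] is much less    *)
(* likely than the lower bound allows.                                        *)
(*                                                                            *)
(* Lower bound. Split the vertices by parity and take edge density [p - s]    *)
(* inside the classes and [p + s] across, with [s = (1 + o(1)) t]: this       *)
(* creates an eigenvalue [- s n], which lowers the expected cycle density by  *)
(* [s^k]. The number of such graphs is a product of two binomial              *)
(* coefficients, and Markov's inequality shows that a fraction [1/n] of them  *)
(* has a low cycle density.                                                   *)

(** * Real symmetric matrices *)

(** Why these rates. With [m] edges the top eigenvalue is at least about [p n] ([top_eigenvalue]),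
    so for odd [k] a deficit [t^k n^k] in the trace of [A^k] can only come from negative
    eigenvalues. Among all ways to distribute it, a single eigenvalue near [- t n] has the least sum
    of squares, [t^2 n^2], and the sum of squares is what fixes the probability: the inner product
    of the centered matrix with a fixed matrix of norm 1 is subgaussian with variance [1 / kappa p]
    ([ip_mgf]), which gives [kappa p / 2] in the upper bound. The lower bound pays instead the
    chi-squared cost [1 / (2 p (1 - p))] of shifting two edge densities ([binomial_ge]).

    Upper bound. [low_tau_neg_pow] turns a low density into a lower bound on [neg_pow],
    [neg_mass_ge] passes to squares, and [neg_mass_rate] bounds the probability through the net of
    [low_rank_deviation]. [low_event_Pr] joins these steps once for two uses: with no side condition
    ([low_tau_rate]), and under the condition that all eigenvalues exceed [- c t n]
    ([low_tau_eigval_rate]). Compared with [low_event_lower], the second use gives the statement on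
    the smallest eigenvalue ([low_tau_eigval]).

    Where [c_star] enters. The errors of relative size [1/n] and the factors [exp (O(n))] are
    absorbed because [t^k n] tends to infinity, hence also [t^2 n]. For [k = 3] the eigenvalues of
    order [sqrt n] are controlled by [cube_diff_rate], up to an exceptional event of probability
    [exp (- c t^6 n^3)]; this is negligible against [exp (- C t^2 n^2)] because [t^4 n] tends to
    infinity, that is, because [t^3] is much larger than [n^(-3/4)].

    Lower bound. [planted_low_count] (first moment and Markov) and [binomial_pair_ge] (the size of
    the planted family) combine in [planted_lower]. *)

Lemma eq_ler (R : numDomainType) (x y : R) : x = y -> x <= y.
Proof. by move=> ->. Qed.

Section Spectral.
Variable R : realType.
Implicit Types n : nat.

Lemma sym_eigenvalue n (A : 'M[R]_n.+1) : A^T = A ->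
  exists x (v : 'cV[R]_n.+1), v != 0 /\ A *m v = x *: v.
Proof.
move=> sA; have [s es] := SpectrumExists.ex_spectrum sA.
have : size s = n.+1.
  have := congr1 (fun q : {poly R} => size q) es.
  by rewrite size_char_poly size_prod_XsubC => -[].
case: s es => [|x s] es // _.
have : root (char_poly A) x by rewrite es big_cons rootM root_XsubC eqxx.
rewrite -eigenvalue_root_char => /eigenvalueP[v vA v0].
exists x, v^T; split; first by rewrite -(inj_eq trmx_inj) trmxK trmx0.
by rewrite -[in LHS]sA -trmx_mul vA linearZ.
Qed.

Lemma mulmx_tr_cV_gt0 n (v : 'cV[R]_n) : v != 0 -> 0 < (v^T *m v) 0 0.
Proof.
move=> v0; rewrite lt_neqAle eq_sym; apply/andP; split; last first.
  by rewrite mxE sumr_ge0// => i _; rewrite mxE -expr2 sqr_ge0.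
apply: contra v0 => /eqP; rewrite mxE => /eqP.
rewrite psumr_eq0; last by move=> i _; rewrite mxE -expr2 sqr_ge0.
move=> /allP h; apply/eqP/matrixP => i j; rewrite !ord1 [RHS]mxE.
have := h i (mem_index_enum _); rewrite mxE -expr2 sqrf_eq0 => /eqP.
by [].
Qed.

(* [Q] is a Householder reflection, or the identity if [v] is a multiple of the *)
(* first basis vector. *)
Lemma orthogonal_extension n (v : 'cV[R]_n.+1) : v != 0 ->
  exists Q : 'M[R]_n.+1, [/\ Q^T = Q, Q *m Q = 1%:M &
     exists c, v = c *: (Q *m delta_mx 0 0)].
Proof.
move=> v0; set e : 'cV[R]_n.+1 := delta_mx 0 0.
pose c := Num.sqrt ((v^T *m v) 0 0).
have c2 : c ^+ 2 = (v^T *m v) 0 0 by rewrite sqr_sqrtr// ltW// mulmx_tr_cV_gt0.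
have cn0 : c != 0.
  by rewrite -sqrf_eq0 c2 gt_eqF// mulmx_tr_cV_gt0.
have ete : e^T *m e = 1%:M.
  by rewrite /e trmx_delta mul_delta_mx; apply/matrixP=> i j; rewrite !ord1 !mxE.
have [->|wn0] := eqVneq v (c *: e).
  exists 1%:M; rewrite trmx1 mul1mx; split=> //; exists c; by rewrite mul1mx.
pose w := v - c *: e.
have w0 : w != 0 by rewrite subr_eq0.
pose q := (w^T *m w) 0 0.
have qgt0 : 0 < q by exact: mulmx_tr_cV_gt0.
have qE : w^T *m w = q%:M by rewrite [LHS]mx11_scalar.
pose Q := 1%:M - (2 / q) *: (w *m w^T).
have Qsym : Q^T = Q by rewrite /Q linearB /= trmx1 linearZ /= trmx_mul trmxK.
have QQ : Q *m Q = 1%:M.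
  have ww : (w *m w^T) *m (w *m w^T) = q *: (w *m w^T).
    by rewrite mulmxA -(mulmxA w) qE mul_mx_scalar -scalemxAl.
  rewrite /Q mulmxBl mul1mx mulmxBr mulmx1 -scalemxAr -scalemxAl ww !scalerA.
  rewrite -addrA -opprD -[RHS]subr0; congr (_ - _).
  rewrite -scalerBl -scalerDl (_ : _ + _ = 0) ?scale0r//.
  by field; rewrite gt_eqF.
exists Q; split => //; exists c.
pose b := (v^T *m e) 0 0.
have vte : v^T *m e = b%:M by rewrite [LHS]mx11_scalar.
have etv : e^T *m v = b%:M by rewrite -[e^T *m v]trmxK trmx_mul trmxK vte tr_scalar_mx.
have vtv : v^T *m v = (c ^+ 2)%:M by rewrite [LHS]mx11_scalar c2.
have wT : w^T = v^T - c *: e^T by apply/matrixP => i j; rewrite !mxE.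
have wtv : w^T *m v = (c ^+ 2 - c * b)%:M.
  rewrite wT mulmxBl -scalemxAl vtv etv.
  by apply/matrixP => i j; rewrite !ord1 !mxE eqxx !mulr1n.
have qv : q = 2 * (c ^+ 2 - c * b).
  rewrite /q {2}/w mulmxBr -scalemxAr wtv wT mulmxBl -scalemxAl vte ete.
  by rewrite !mxE eqxx !mulr1n; ring.
have {}wtv : w^T *m v = (q / 2)%:M.
  by rewrite wtv qv; congr (_%:M); field.
have Qv : Q *m v = c *: e.
  rewrite /Q mulmxBl mul1mx -scalemxAl -mulmxA wtv mul_mx_scalar scalerA.
  have -> : 2 / q * (q / 2) = 1 by field; rewrite gt_eqF.
  by rewrite scale1r /w opprB addrC subrK.
by rewrite scalemxAr -Qv mulmxA QQ mul1mx.
Qed.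

(** Deflation: a reflection [Q] sends the first basis vector to the direction of an eigenvector, so
    the first column of [Q A Q] is a multiple of that basis vector. By symmetry so is the first row,
    and the induction continues on the lower right block. *)
Lemma sym_diagonalization n (A : 'M[R]_n) : A^T = A ->
  exists (P : 'M[R]_n) (d : 'rV[R]_n), P *m P^T = 1%:M /\ A = P^T *m diag_mx d *m P.
Proof.
elim: n A => [|n IH] A sA.
  by exists 1%:M, 0; split; apply/matrixP => -[].
have [x [v [v0 Av]]] := sym_eigenvalue sA.
have [Q [Qs QQ [c vE]]] := orthogonal_extension v0.
set e : 'cV[R]_n.+1 := delta_mx 0 0 in vE.
have cn0 : c != 0 by apply: contra_neq v0 => c0; rewrite vE c0 scale0r.
have [B BQ] : exists B, B = Q *m A *m Q by eexists.
have Be : B *m e = x *: e.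
  have : A *m (Q *m e) = x *: (Q *m e).
    apply: (scalerI cn0); rewrite scalemxAr -vE Av vE !scalerA.
    by rewrite mulrC.
  by move=> h; rewrite BQ -!mulmxA h -scalemxAr mulmxA QQ mul1mx.
have Bs : B^T = B by rewrite BQ !trmx_mul Qs sA mulmxA.
pose B' : 'M[R]_(1 + n) := B.
have BE : B' = block_mx x%:M 0 0 (drsubmx B').
  rewrite -[LHS]submxK; congr block_mx.
  - apply/matrixP => i j; rewrite !ord1 /B' !mxE.
    move/matrixP/(_ 0 0) : Be; rewrite -colE !mxE !eqxx mulr1 mulr1n => <-.
    by congr (B _ _); apply/val_inj.
  - apply/matrixP => i j; rewrite !ord1 [RHS]mxE /B' /ursubmx !mxE.
    move/matrixP/(_ (rshift 1 j) 0) : Be; rewrite -colE !mxE mulr0 => <-.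
    by rewrite -[in LHS]Bs mxE; congr (B _ _); apply/val_inj.
  - apply/matrixP => i j; rewrite !ord1 [RHS]mxE /B' /dlsubmx !mxE.
    move/matrixP/(_ (rshift 1 i) 0) : Be; rewrite -colE !mxE mulr0 => <-.
    by congr (B _ _); apply/val_inj.
have [|P [d [PP dE]]] := IH (drsubmx B').
  by rewrite trmx_drsub /B' Bs.
pose P1 : 'M[R]_(1 + n) := block_mx 1%:M 0 0 P.
pose d1 : 'rV[R]_(1 + n) := row_mx (const_mx x) d.
pose Q1 : 'M[R]_(1 + n) := Q.
have Q1s : Q1^T = Q1 := Qs.
have Q1Q1 : Q1 *m Q1 = 1%:M := QQ.
have P1P1 : P1 *m P1^T = 1%:M.
  rewrite /P1 tr_block_mx mulmx_block !trmx0 !trmx1.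
  by rewrite !mulmx0 !mul0mx !mulmx1 PP !addr0 !add0r -scalar_mx_block.
have BE2 : B' = P1^T *m diag_mx d1 *m P1.
  rewrite BE dE /P1 /d1 diag_mx_row tr_block_mx !mulmx_block.
  rewrite !trmx0 !trmx1 !mulmx0 !mul0mx !mulmx1 !mul1mx !addr0 !add0r; congr block_mx.
    by apply/matrixP => i j; rewrite !ord1 !mxE.
  by rewrite mul0mx.

have B'Q : B' = Q1 *m (A *m Q1) by rewrite mulmxA /B' BQ.
exists (P1 *m Q1); exists d1; split.
  by rewrite trmx_mul Q1s mulmxA -(mulmxA P1) Q1Q1 mulmx1.
rewrite trmx_mul Q1s -!mulmxA (mulmxA (diag_mx _)) (mulmxA P1^T) (mulmxA P1^T) -BE2.
by rewrite B'Q -!mulmxA Q1Q1 mulmx1 mulmxA Q1Q1 mul1mx.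
Qed.

End Spectral.

(** * Sums of a function over the spectrum *)

Section TraceFunctions.
Variable R : realType.
Implicit Types (n k : nat) (f : R -> R).

(** The rows of [P] are orthonormal eigenvectors. The last clause ties the unordered family [d] to
    the sorted list [spectrum] used in the theorem. *)
Definition spectral_decomp n (A P : 'M[R]_n) (d : 'I_n -> R) :=
  [/\ P *m P^T = 1%:M, A = P^T *m diag_mx (\row_i d i) *m P &
      perm_eq (spectrum A) [seq d i | i <- enum 'I_n]].

Lemma spectral_decomp_exists n (A : 'M[R]_n) : A^T = A ->
  exists P d, spectral_decomp A P d.
Proof.
move=> sA; have [P [d [PP AE]]] := sym_diagonalization sA.
exists P, (fun i => d 0 i); have [_ _ cpA] := spectrumP sA.
have dE : \row_i d 0 i = d by apply/rowP => i; rewrite mxE.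
split; rewrite ?dE//.
have PX : map_mx polyC P *m map_mx polyC P^T = 1%:M.
  by rewrite -map_mxM PP map_mx1.
have PX' := mulmx1C PX.
have cpA' : char_poly A = \prod_(x <- [seq d 0 i | i <- enum 'I_n]) ('X - x%:P).
  have -> : char_poly A = char_poly (diag_mx d).
    rewrite /char_poly {1}AE /char_poly_mx !map_mxM /=.
    have -> : 'X%:M - map_mx polyC P^T *m map_mx polyC (diag_mx d) *m map_mx polyC P
            = map_mx polyC P^T *m ('X%:M - map_mx polyC (diag_mx d)) *m map_mx polyC P.
      rewrite mulmxBr mulmxBl; congr (_ - _).
      by rewrite scalar_mxC -mulmxA PX' mulmx1.
    by rewrite !det_mulmx mulrAC -det_mulmx PX' det1 mul1r.
  rewrite char_poly_trig; last exact/diag_mx_is_trig.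
  by rewrite big_map big_enum; apply: eq_bigr => i _; rewrite mxE eqxx mulr1n.
by apply: prod_XsubC_eq; rewrite -cpA -cpA'.
Qed.

Lemma conj_diagE n (C : 'M[R]_n) (d : 'I_n -> R) i :
  (C *m diag_mx (\row_j d j) *m C^T) i i = \sum_j d j * C i j ^+ 2.
Proof.
rewrite mxE; apply: eq_bigr => j _; rewrite mul_mx_diag !mxE; ring.
Qed.

Lemma orth_row n (C : 'M[R]_n) i : C *m C^T = 1%:M -> \sum_j C i j ^+ 2 = 1.
Proof.
move/matrixP/(_ i i); rewrite !mxE eqxx mulr1n => <-.
by apply: eq_bigr => j _; rewrite mxE expr2.
Qed.

Lemma orth_col n (C : 'M[R]_n) j : C *m C^T = 1%:M -> \sum_i C i j ^+ 2 = 1.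
Proof.
move/mulmx1C => h; rewrite -(@orth_row _ C^T j); last by rewrite trmxK.
by apply: eq_bigr => i _; rewrite mxE.
Qed.

Lemma decomp_diag n (A P : 'M[R]_n) d i : spectral_decomp A P d ->
  (P *m A *m P^T) i i = d i.
Proof.
move=> [PP -> _]; rewrite !mulmxA PP mul1mx -mulmxA PP mulmx1.
by rewrite !mxE eqxx mulr1n.
Qed.

Definition trf f n (A : 'M[R]_n) := \sum_(x <- spectrum A) f x.

Lemma trfE f n (A P : 'M[R]_n) d : spectral_decomp A P d -> trf f A = \sum_i f (d i).
Proof. by move=> [_ _ E]; rewrite /trf (perm_big _ E) big_map big_enum. Qed.

(** Convexity, in the form that makes Jensen's inequality immediate. *)
Definition has_supporting_lines f :=
  forall x, exists a b, f x = a * x + b /\ forall y, a * y + b <= f y.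

(** The entries of the orthogonal matrix [C = W P^T] have squares that form a doubly stochastic
    matrix. Each diagonal entry is thus an average of eigenvalues: Jensen applies row by row, and
    the column sums give back each eigenvalue once. *)
Lemma peierls f n (A W : 'M[R]_n) : has_supporting_lines f -> A^T = A ->
  W *m W^T = 1%:M -> \sum_i f ((W *m A *m W^T) i i) <= trf f A.
Proof.
move=> sf sA WW; have [P [d D]] := spectral_decomp_exists sA.
rewrite (trfE f D); case: D => [PP -> _].
set C := W *m P^T; have CC : C *m C^T = 1%:M.
  by rewrite /C trmx_mul trmxK mulmxA -(mulmxA W) (mulmx1C PP) mulmx1.
have -> : W *m (P^T *m diag_mx (\row_i d i) *m P) *m W^T
        = C *m diag_mx (\row_i d i) *m C^T by rewrite /C trmx_mul trmxK !mulmxA.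
apply: (@le_trans _ _ (\sum_i \sum_j f (d j) * C i j ^+ 2)).
  apply: ler_sum => i _; rewrite conj_diagE.
  have [a [b [-> h]]] := sf (\sum_j d j * C i j ^+ 2).
  rewrite -[b]mulr1 -{1}(orth_row i CC) !mulr_sumr -big_split /=.
  apply: ler_sum => j _; rewrite mulrA -mulrDl.
  by rewrite ler_wpM2r ?sqr_ge0.
rewrite exchange_big /=; apply: eq_ler.
by apply: eq_bigr => j _; rewrite -mulr_sumr orth_col ?mulr1.
Qed.

Lemma trf_eigenbasis f n (A P : 'M[R]_n) d : spectral_decomp A P d ->
  trf f A = \sum_i f ((P *m A *m P^T) i i).
Proof. by move=> D; rewrite (trfE f D); apply: eq_bigr => i _; rewrite (decomp_diag _ D). Qed.

Lemma trace_exp n k (A P : 'M[R]_n) d : spectral_decomp A P d ->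
  \tr (A ^+ k) = \sum_i d i ^+ k.
Proof.
move=> [PP -> _].
have -> : (P^T *m diag_mx (\row_i d i) *m P) ^+ k
   = P^T *m diag_mx (\row_i d i ^+ k) *m P.
  elim: k => [|k IH].
    have -> : diag_mx (\row_i d i ^+ 0) = 1%:M.
      by apply/matrixP => i j; rewrite !mxE.
    by rewrite mulmx1 (mulmx1C PP) expr0.
  rewrite exprS IH -[LHS]/(_ *m _) !mulmxA -(mulmxA _ P) PP mulmx1 -(mulmxA P^T) mulmx_diag.
  congr (P^T *m diag_mx _ *m P); by apply/rowP => i; rewrite !mxE exprS.
rewrite -mulmxA mxtrace_mulC -mulmxA PP mulmx1 mxtrace_diag.
by apply: eq_bigr => i _; rewrite mxE.
Qed.

Lemma eigval_last_le n (A : 'M[R]_n) x : A^T = A -> x \in spectrum A -> eigval A n <= x.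
Proof.
move=> sA xs; have [sS szS _] := spectrumP sA.
rewrite /eigval -(nth_index 0 xs); have ix : (index x (spectrum A) < n)%N.
  by rewrite -{2}szS index_mem.
apply: (sorted_leq_nth (leT := >=%O)) => //.
- by move=> a b c; exact: ge_trans.
- by move=> a /=; exact: lexx.
- by rewrite inE szS.
- by rewrite inE szS prednK// (leq_ltn_trans _ ix).
- by rewrite -ltnS prednK// (leq_ltn_trans _ ix).
Qed.

End TraceFunctions.

(** * Convexity, monotonicity and Lipschitz bounds for spectral sums; truncated cubes *)

Section ConvexTrace.
Variable R : realType.
Implicit Types (n k : nat) (f : R -> R) (T x z : R).

Lemma cauchy_schwarz_sum (I : finType) (a b : I -> R) :
  (\sum_i a i * b i) ^+ 2 <= (\sum_i a i ^+ 2) * (\sum_i b i ^+ 2).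
Proof.
have h : 0 <= \sum_i \sum_j (a i * b j - a j * b i) ^+ 2.
  by apply: sumr_ge0 => i _; apply: sumr_ge0 => j _; exact: sqr_ge0.
have E : \sum_i \sum_j (a i * b j - a j * b i) ^+ 2 =
   2 * ((\sum_i a i ^+ 2) * (\sum_i b i ^+ 2)) - 2 * (\sum_i a i * b i) ^+ 2.
  transitivity (\sum_i \sum_j (a i ^+ 2 * b j ^+ 2 + b i ^+ 2 * a j ^+ 2
        - 2 * ((a i * b i) * (a j * b j)))).
    by apply: eq_bigr => i _; apply: eq_bigr => j _; ring.
  under eq_bigr do rewrite sumrB big_split /= -!mulr_sumr.
  rewrite sumrB big_split /= -!mulr_suml -mulr_sumr -mulr_suml; ring.
by rewrite E in h; lra.
Qed.

Definition frob2 m n (B : 'M[R]_(m, n)) := \sum_i \sum_j B i j ^+ 2.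

Lemma frob2_ge0 m n (B : 'M[R]_(m, n)) : 0 <= frob2 B.
Proof. by apply: sumr_ge0 => i _; apply: sumr_ge0 => j _; exact: sqr_ge0. Qed.

Lemma frob2_tr m n (B : 'M[R]_(m, n)) : frob2 B = \tr (B *m B^T).
Proof.
apply: eq_bigr => i _; rewrite mxE; apply: eq_bigr => j _.
by rewrite mxE expr2.
Qed.

Lemma frob2_conj n (W D : 'M[R]_n) : W *m W^T = 1%:M -> frob2 (W *m D *m W^T) = frob2 D.
Proof.
move=> WW; rewrite !frob2_tr !trmx_mul trmxK.
have WW' := mulmx1C WW.
rewrite -!mulmxA (mulmxA W^T) WW' mul1mx mxtrace_mulC -!mulmxA WW' mulmx1.
by [].
Qed.

Lemma sum_norm_diag n (D : 'M[R]_n) :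
  \sum_i `|D i i| <= Num.sqrt (n%:R * frob2 D).
Proof.
have h : (\sum_i `|D i i|) ^+ 2 <= n%:R * frob2 D.
  have := cauchy_schwarz_sum (fun=> 1) (fun i => `|D i i|).
  under eq_bigr do rewrite mul1r.
  move=> /le_trans; apply; rewrite expr1n sumr_const card_ord.
  rewrite ler_wpM2l ?ler0n//; apply: ler_sum => i _.
  rewrite real_normK ?num_real// (bigD1 i)//= lerDl.
  by apply: sumr_ge0 => j _; exact: sqr_ge0.
rewrite -[leLHS]ger0_norm ?sumr_ge0// -sqrtr_sqr; exact: ler_wsqrtr.
Qed.

(** For [W] an eigenbasis of [X] the left-hand side of the hypothesis is [trf f X], and [peierls]
    bounds the right-hand side. Comparisons of spectra thus reduce to comparisons of diagonals in a
    common basis. *)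
Lemma trf_le f g n (X Y : 'M[R]_n) e : has_supporting_lines g ->
  X^T = X -> Y^T = Y ->
  (forall W : 'M[R]_n, W *m W^T = 1%:M -> \sum_i f ((W *m X *m W^T) i i)
     <= \sum_i g ((W *m Y *m W^T) i i) + e) ->
  trf f X <= trf g Y + e.
Proof.
move=> sg sX sY h; have [P [d D]] := spectral_decomp_exists sX.
have PP : P *m P^T = 1%:M by case: D.
rewrite (trf_eigenbasis f D); apply: le_trans (h P PP) _.
by rewrite lerD2r peierls.
Qed.

(** The two diagonals differ by that of [W (X - Y) W^T], whose Frobenius norm does not depend on
    [W]; Cauchy--Schwarz over the [n] entries produces the factor [sqrt n]. *)
Lemma trf_lipschitz f n (X Y : 'M[R]_n) L : has_supporting_lines f -> 0 <= L ->
  (forall x y, f x <= f y + L * `|x - y|) -> X^T = X -> Y^T = Y ->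
  trf f X <= trf f Y + L * Num.sqrt (n%:R * frob2 (X - Y)).
Proof.
move=> sf L0 fL sX sY; apply: trf_le => // W WW.
rewrite -(frob2_conj (X - Y) WW).
apply: (@le_trans _ _ (\sum_i (f ((W *m Y *m W^T) i i)
   + L * `|(W *m (X - Y) *m W^T) i i|))).
  apply: ler_sum => i _; apply: le_trans (fL _ ((W *m Y *m W^T) i i)) _.
  by rewrite mulmxBr mulmxBl !mxE.
rewrite big_split /= lerD2l -mulr_sumr ler_wpM2l//; exact: sum_norm_diag.
Qed.

Lemma trf_mono f n (X Y : 'M[R]_n) : has_supporting_lines f -> {homo f : x y / x <= y} ->
  X^T = X -> Y^T = Y ->
  (forall (W : 'M[R]_n) i, W *m W^T = 1%:M -> (W *m X *m W^T) i i <= (W *m Y *m W^T) i i) ->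
  trf f X <= trf f Y.
Proof.
move=> sf f_incr sX sY h; rewrite -[leRHS]addr0; apply: trf_le => // W WW.
by rewrite addr0; apply: ler_sum => i _; apply/f_incr/h.
Qed.

Lemma supporting_lines_convex f (s x y : R) : has_supporting_lines f ->
  0 <= s <= 1 -> f (s * x + (1 - s) * y) <= s * f x + (1 - s) * f y.
Proof.
move=> sf /andP[s0 s1]; have [a [b [-> h]]] := sf (s * x + (1 - s) * y).
have := ler_wpM2l s0 (h x); have s1' : 0 <= 1 - s by rewrite subr_ge0.
by have := ler_wpM2l s1' (h y); lra.
Qed.

Lemma trf_convex f n (X Y : 'M[R]_n) s : has_supporting_lines f -> 0 <= s <= 1 ->
  X^T = X -> Y^T = Y ->
  trf f (s *: X + (1 - s) *: Y) <= s * trf f X + (1 - s) * trf f Y.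
Proof.
move=> sf s01 sX sY; have sZ : (s *: X + (1 - s) *: Y)^T = s *: X + (1 - s) *: Y.
  by rewrite linearD /= !linearZ /= sX sY.
have [P [d D]] := spectral_decomp_exists sZ.
have PP : P *m P^T = 1%:M by case: D.
rewrite (trf_eigenbasis f D).
apply: (@le_trans _ _ (\sum_i (s * f ((P *m X *m P^T) i i)
    + (1 - s) * f ((P *m Y *m P^T) i i)))).
  apply: ler_sum => i _.
  rewrite mulmxDr mulmxDl -!scalemxAr -!scalemxAl.
  by rewrite [X in f X]mxE [X in f (X + _)]mxE [X in f (_ + X)]mxE supporting_lines_convex.
case/andP: s01 => s0 s1; rewrite big_split /= -!mulr_sumr.
by apply: lerD; rewrite ler_wpM2l ?subr_ge0// peierls.
Qed.

Lemma supporting_lines_opp f : has_supporting_lines f ->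
  has_supporting_lines (fun x => f (- x)).
Proof.
move=> sf x; have [a [b [E h]]] := sf (- x).
exists (- a), b; split; first by rewrite E; ring.
by move=> y; apply: le_trans (h (- y)); rewrite mulrN mulNr.
Qed.

(* [x^3] for [0 <= x <= T], extended by [0] on the left and by its tangent at [T] *)
(* on the right. *)
Definition tcube (T x : R) : R :=
  let y := Num.min T (Num.max 0 x) in 3 * y ^+ 2 * x - 2 * y ^+ 3.

Lemma tcube_neg T x : 0 <= T -> x <= 0 -> tcube T x = 0.
Proof. by move=> T0 x0; rewrite /tcube (max_idPl x0) (min_idPr T0); ring. Qed.

Lemma tcube_mid T x : 0 <= x -> x <= T -> tcube T x = x ^+ 3.
Proof. by move=> x0 xT; rewrite /tcube (max_idPr x0) (min_idPr xT); ring. Qed.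

Lemma tcube_large T x : 0 <= T -> T <= x -> tcube T x = 3 * T ^+ 2 * x - 2 * T ^+ 3.
Proof.
by move=> T0 Tx; rewrite /tcube (max_idPr (le_trans T0 Tx)) (min_idPl Tx).
Qed.

(** For [z >= 0] the cube minus its tangent at [a] is [(z - a)^2 (z + 2 a)]. Beyond [T] both sides
    are affine, and the slope [3 a^2] is at most [3 T^2]. *)
Lemma tcube_tangent T x a : 0 <= a <= T -> 3 * a ^+ 2 * x - 2 * a ^+ 3 <= tcube T x.
Proof.
move=> /andP[a0 aT]; have T0 := le_trans a0 aT.
have h z : 0 <= z -> 3 * a ^+ 2 * z - 2 * a ^+ 3 <= z ^+ 3.
  move=> z0; rewrite -subr_ge0.
  have -> : z ^+ 3 - (3 * a ^+ 2 * z - 2 * a ^+ 3) = (z - a) ^+ 2 * (z + 2 * a) by ring.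
  by rewrite mulr_ge0 ?sqr_ge0//; lra.
have [x0|x0] := leP x 0.
  rewrite tcube_neg//.
  have := mulr_ge0 (sqr_ge0 a) (_ : 0 <= - x); rewrite oppr_ge0 => /(_ x0).
  by have := exprn_ge0 3 a0; lra.
have [xT|xT] := leP x T; first by rewrite tcube_mid ?(ltW x0)// h// ltW.
rewrite (tcube_large T0 (ltW xT)).
have aT2 : 0 <= T ^+ 2 - a ^+ 2 by rewrite subr_ge0 lerXn2r// nnegrE.
have xT' : 0 <= x - T by lra.
have := mulr_ge0 aT2 xT'; have := h T T0; rewrite exprSr; lra.
Qed.

Lemma tcube_clip (T x : R) : 0 <= T -> 0 <= Num.min T (Num.max 0 x) <= T.
Proof.
by move=> T0; rewrite le_min T0 le_max lexx /= ge_min lexx.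
Qed.

Lemma tcube_supporting T : 0 <= T -> has_supporting_lines (tcube T).
Proof.
move=> T0 x; set y := Num.min T (Num.max 0 x).
exists (3 * y ^+ 2), (- (2 * y ^+ 3)); split=> // z.
exact/tcube_tangent/tcube_clip.
Qed.

Lemma tcube_ge0 T x : 0 <= T -> 0 <= tcube T x.
Proof.
move=> T0; have := @tcube_tangent T x 0; rewrite lexx T0 => /(_ isT).
by apply: le_trans; lra.
Qed.

Lemma tcube_slope T x : 0 <= T ->
  exists a, [/\ 0 <= a, a <= 3 * T ^+ 2 & forall z, tcube T x <= tcube T z + a * (x - z)].
Proof.
move=> T0; set y := Num.min T (Num.max 0 x).
have /andP[y0 yT] := tcube_clip x T0; rewrite -/y in y0 yT.
exists (3 * y ^+ 2); split.
- by rewrite mulr_ge0 ?sqr_ge0.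
- by rewrite ler_wpM2l// lerXn2r// nnegrE.
move=> z; have := @tcube_tangent T z y; rewrite y0 yT => /(_ isT).
by have -> : tcube T x = 3 * y ^+ 2 * x - 2 * y ^+ 3 by []; lra.
Qed.

Lemma tcube_lip T x z : 0 <= T -> tcube T x <= tcube T z + 3 * T ^+ 2 * `|x - z|.
Proof.
move=> T0; have [a [a0 aT h]] := tcube_slope x T0.
apply: le_trans (h z) _; rewrite lerD2l.
apply: le_trans (ler_wpM2l a0 (ler_norm _)) _; exact: ler_wpM2r.
Qed.

Lemma tcube_homo T : 0 <= T -> {homo tcube T : x y / x <= y}.
Proof.
move=> T0 x z xz; have [a [a0 aT h]] := tcube_slope x T0.
apply: le_trans (h z) _; rewrite -[leRHS]addr0 lerD2l.
by rewrite mulr_ge0_le0// subr_le0.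
Qed.

Lemma tcube_le_lin T x : 0 <= T -> 0 <= x -> tcube T x <= 3 * T ^+ 2 * x.
Proof.
move=> T0 x0; have := tcube_lip x 0 T0.
by rewrite (@tcube_neg T 0)// add0r subr0 ger0_norm.
Qed.

Lemma tcube_le_cube T x : 0 <= T -> 0 <= x -> tcube T x <= x ^+ 3.
Proof.
move=> T0 x0; have [xT|/ltW xT] := leP x T; first by rewrite tcube_mid.
rewrite tcube_large//.
have -> : x ^+ 3 = 3 * T ^+ 2 * x - 2 * T ^+ 3 + (x - T) ^+ 2 * (x + 2 * T) by ring.
by rewrite lerDl mulr_ge0 ?sqr_ge0//; lra.
Qed.

(** The odd difference agrees with [x^3] on [[-T, T]] and continues affinely outside, where the cube
    is larger in modulus. So each of the two comparisons with [x^3] can fail on one side only: here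
    above [T], in [cube_ge_tcube] below [- T]. *)
Lemma tcube_ge_cube T x : 0 <= T -> x <= T -> x ^+ 3 <= tcube T x - tcube T (- x).
Proof.
move=> T0 xT; have [x0|/ltW x0] := leP 0 x.
  by rewrite tcube_mid// (@tcube_neg _ (- x)) ?oppr_le0// subr0.
rewrite (@tcube_neg _ x)// sub0r lerNr.
have -> : - x ^+ 3 = (- x) ^+ 3 by ring.
by rewrite tcube_le_cube// oppr_ge0.
Qed.

Lemma cube_ge_tcube T x : 0 <= T ->
  tcube T x - tcube T (- x) - (if x < - T then `|x| ^+ 3 else 0) <= x ^+ 3.
Proof.
move=> T0; have [x0|x0] := leP 0 x.
  rewrite (@tcube_neg _ (- x)) ?oppr_le0// subr0 ltNge.
  have -> /= : - T <= x by lra.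
  by rewrite subr0 tcube_le_cube.
rewrite (@tcube_neg _ x T0 (ltW x0)) sub0r; have [xT|xT] := ltP x (- T).
  rewrite ltr0_norm//; have := tcube_ge0 (- x) T0.
  have -> : (- x) ^+ 3 = - x ^+ 3 by ring.
  lra.
rewrite subr0 tcube_mid; [|lra..].
have -> : (- x) ^+ 3 = - x ^+ 3 by ring.
by rewrite opprK.
Qed.

End ConvexTrace.

(** * Adjacency matrices and random edges *)

Section CyclicWalks.
Variable R : realType.
Implicit Types (n k m : nat).

Lemma big_ffun_ord_recr (T : finType) m (F : {ffun 'I_m.+1 -> T} -> R) :
  \sum_phi F phi = \sum_(phi : {ffun 'I_m -> T}) \sum_z
    F [ffun i => if unlift ord_max i is Some j then phi j else z].
Proof.
rewrite pair_big /=.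
pose ext (u : {ffun 'I_m -> T} * T) : {ffun 'I_m.+1 -> T} :=
  [ffun i => if unlift ord_max i is Some j then u.1 j else u.2].
rewrite (reindex ext)//=.
exists (fun phi : {ffun 'I_m.+1 -> T} => ([ffun j => phi (lift ord_max j)], phi ord_max)).
  move=> [phi z] _; rewrite /ext /=; congr (_, _).
    by apply/ffunP => j; rewrite !ffunE liftK.
  by rewrite ffunE unlift_none.
move=> phi _; apply/ffunP => i; rewrite /ext !ffunE /=.
by case: unliftP => [j ->|->]; rewrite ?ffunE.
Qed.

(** The matrix [B] closes the walk; with [B] arbitrary the induction can move the last step of
    [A ^+ m] into it. *)
Lemma trace_walk_aux n m (A B : 'M[R]_n) :
  \sum_(phi : {ffun 'I_m.+1 -> 'I_n})
    (\prod_(i < m) A (phi (inord i)) (phi (inord i.+1))) * B (phi ord_max) (phi ord0)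
  = \tr (A ^+ m *m B).
Proof.
elim: m B => [|m IH] B.
  rewrite expr0 mul1mx big_ffun_ord_recr.
  rewrite (big_pred1 [ffun i : 'I_0 => False_rect 'I_n (notF (ltn_ord i))]); last first.
    by move=> phi; apply/esym/eqP/ffunP => -[].
  apply: eq_bigr => z _; rewrite big_ord0 mul1r !ffunE.
  by rewrite (_ : ord_max = ord0) ?unlift_none//; apply/val_inj.
rewrite exprSr -[A ^+ m * A]/(A ^+ m *m A) -mulmxA -IH big_ffun_ord_recr.
apply: eq_bigr => phi _; rewrite mxE mulr_sumr; apply: eq_bigr => z _.
have nl (i : 'I_m.+1) : unlift ord_max (inord i : 'I_m.+2) = Some i.
  have -> : inord i = lift ord_max i :> 'I_m.+2.
    by apply/val_inj; rewrite /= inordK ?bump_default// ?ltnS 1?ltnW// /bump leqNgt ltn_ord.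
  by rewrite liftK.
rewrite big_ord_recr /= -!mulrA; congr (_ * _).
  apply: eq_bigr => i _; rewrite !ffunE.
  have -> : (inord i : 'I_m.+2) = inord (inord i : 'I_m.+1).
    by congr inord; rewrite inordK// ltnW// ltnS.
  have -> : (inord i.+1 : 'I_m.+2) = inord (inord i.+1 : 'I_m.+1).
    by congr inord; rewrite inordK ?ltnS.
  by rewrite !nl.
rewrite !ffunE unlift_none.
have -> : (inord m : 'I_m.+2) = inord (ord_max : 'I_m.+1) by [].
have -> : (inord m.+1 : 'I_m.+2) = ord_max.
  by apply/val_inj; rewrite /= inordK.
have -> : (ord0 : 'I_m.+2) = inord (ord0 : 'I_m.+1).
  by apply/val_inj; rewrite /= inordK.
by rewrite !nl unlift_none.
Qed.

Lemma trace_walk n k (A : 'M[R]_n) : (0 < k)%N ->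
  \tr (A ^+ k) = \sum_(phi : {ffun 'I_k -> 'I_n}) \prod_i A (phi i) (phi (ordS i)).
Proof.
case: k => // m _; rewrite exprSr -[A ^+ m * A]/(A ^+ m *m A) -trace_walk_aux.
apply: eq_bigr => phi _; rewrite big_ord_recr /=; congr (_ * _).
  apply: eq_bigr => i _; congr (A (phi _) (phi _)); apply/val_inj => /=.
    by rewrite inordK// ltnW// ltnS.
  by rewrite inordK ?ltnS// modn_small// ltnS.
by congr (A _ (phi _)); apply/val_inj; rewrite /= modnn.
Qed.

Lemma ffact_le_expn n k : (n ^_ k <= n ^ k)%N.
Proof. by elim: k => // k IH; rewrite ffactnSr expnSr leq_mul// leq_subr. Qed.

Lemma expn_le_ffact n k : (n ^ k <= n ^_ k + k ^ 2 * n ^ k.-1)%N.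
Proof.
elim: k => [|k IH]; first by rewrite expn0 ffactn0.
rewrite expnSr ffactnSr /=.
apply: leq_trans (leq_mul IH (leqnn n)) _.
rewrite mulnDl -mulnA.
have E : (k ^ 2 * (n ^ k.-1 * n) <= k ^ 2 * n ^ k)%N.
  by case: k {IH} => [|k]; rewrite ?exp0n//= -expnSr.
have F : (n ^_ k * n <= n ^_ k * (n - k) + n ^_ k * k)%N.
  by rewrite -mulnDr leq_mul2l addnC -leq_subLR leqnn orbT.
have G : (n ^_ k * k <= n ^ k * k)%N.
  by rewrite leq_mul2r ffact_le_expn orbT.
have -> : (k.+1 ^ 2 = k ^ 2 + k + k + 1)%N by lia.
rewrite !mulnDl; lia.
Qed.

(** The trace counts the closed walks; the non-injective ones are at most [n^k - n ^_ k], which is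
    of the lower order [n^(k-1)]. *)
Lemma trace_adjmx_le n k (G : graph n) : (0 < k)%N ->
  \tr (adjmx R G ^+ k) <= (T_ k G)%:R + (k ^ 2 * n ^ k.-1)%:R.
Proof.
move=> k0; rewrite trace_walk// -natrD.
pose W := [set phi : {ffun 'I_k -> 'I_n} | [forall i, [set phi i; phi (ordS i)] \in G]].
have -> : \sum_(phi : {ffun 'I_k -> 'I_n}) \prod_i adjmx R G (phi i) (phi (ordS i))
    = #|W|%:R.
  rewrite -sum1_card natr_sum [RHS]big_mkcond /=; apply: eq_bigr => phi _.
  rewrite finset.in_set; case: forallP => [h|/forallP].
    by rewrite big1// => i _; rewrite mxE h.
  rewrite negb_forall => /existsP[i /negbTE hi].
  by rewrite (bigD1 i)//= mxE hi mul0r.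
rewrite ler_nat.
pose I := [set phi : {ffun 'I_k -> 'I_n} | injectiveb phi].
apply: (@leq_trans (T_ k G + #|~: I|)).
  rewrite -(cardsID I W); apply: leq_add.
    by apply/subset_leq_card/fintype.subsetP => phi; rewrite !inE andbC.
  by apply/subset_leq_card/fintype.subsetP => phi; rewrite !inE => /andP[].
rewrite leq_add2l; have := expn_le_ffact n k.
have <- : #|I| = (n ^_ k)%N by rewrite /I card_inj_ffuns !card_ord.
have := cardsC I; rewrite card_ffun !card_ord; lia.
Qed.

End CyclicWalks.

Section EdgeSums.
Variable R : realType.
Variable n : nat.
Implicit Types (F : 'I_n -> 'I_n -> R) (x : {set 'I_n} -> R).

(** Every edge variable occupies two entries of a symmetric matrix. Grouping the two orientations
    turns a sum over entries into a linear form in independent variables. *)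
Definition esum F (e : {set 'I_n}) : R :=
  \sum_(u : 'I_n * 'I_n | (u.1 != u.2) && ([set u.1; u.2] == e)) F u.1 u.2.

Lemma edgeP (e : {set 'I_n}) : reflect (exists a b, a != b /\ e = [set a; b]) (e \in all_edges n).
Proof.
rewrite inE; exact: cards2P.
Qed.

Lemma esum2 F a b : a != b -> esum F [set a; b] = F a b + F b a.
Proof.
move=> ab; rewrite /esum (bigD1 (a, b)) /= ?ab ?eqxx//; congr (_ + _).
rewrite (bigD1 (b, a)) /=; last first.
  by rewrite eq_sym ab finset.setUC eqxx /= xpair_eqE negb_and eq_sym ab.
rewrite big1 ?addr0// => -[c d] /=; rewrite !xpair_eqE -!andbA => /and4P[cd /eqP E n1 n2].
have : c \in [set a; b] by rewrite -E !inE eqxx.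
have : d \in [set a; b] by rewrite -E !inE eqxx orbT.
by rewrite !inE => /orP[]/eqP Ed /orP[]/eqP Ec; move: cd n1 n2; rewrite Ec Ed ?eqxx.
Qed.

Lemma sum_off_diag_edges x F :
  \sum_i \sum_(j | i != j) x [set i; j] * F i j = \sum_(e in all_edges n) x e * esum F e.
Proof.
rewrite pair_big_dep /=.
rewrite (partition_big (fun u : 'I_n * 'I_n => [set u.1; u.2]) (mem (all_edges n))) /=; last first.
  by move=> [a b] /= ab; apply/edgeP; exists a, b.
apply: eq_bigr => e _; rewrite /esum mulr_sumr.
by apply: eq_bigr => -[a b] /= /andP[_ /eqP ->].
Qed.

Definition symx x : 'M[R]_n := \matrix_(i, j) (if i == j then 0 else x [set i; j]).

Lemma symx_sym x : (symx x)^T = symx x.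
Proof. by apply/matrixP => i j; rewrite !mxE eq_sym finset.setUC. Qed.

Lemma sum_symx x F :
  \sum_i \sum_j symx x i j * F i j = \sum_(e in all_edges n) x e * esum F e.
Proof.
rewrite -sum_off_diag_edges; apply: eq_bigr => i _.
rewrite [RHS]big_mkcond /=; apply: eq_bigr => j _; rewrite mxE.
by case: eqP => //=; rewrite mul0r.
Qed.

Lemma sum_esum_sqr (B : 'M[R]_n) : \sum_(e in all_edges n) esum B e ^+ 2 <= 2 * frob2 B.
Proof.
apply: (@le_trans _ _ (\sum_(e in all_edges n) 1 * esum (fun i j => 2 * B i j ^+ 2) e)).
  apply: ler_sum => e /edgeP[a [b [ab ->]]]; rewrite mul1r !esum2//.
  by have := sqr_ge0 (B a b - B b a); nra.
rewrite -(sum_off_diag_edges (fun=> 1)) /frob2 mulr_sumr.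
apply: ler_sum => i _; rewrite mulr_sumr big_mkcond /=.
apply: ler_sum => j _; rewrite mul1r; case: ifP => // _.
by rewrite mulr_ge0// sqr_ge0.
Qed.

Lemma adjmx_symx (G : graph n) : G \subset all_edges n ->
  adjmx R G = symx (fun e => (e \in G)%:R).
Proof.
move=> /fintype.subsetP sG; apply/matrixP => i j; rewrite !mxE.
case: eqP => [->|//]; case: (boolP (_ \in G)) => // /sG.
by rewrite inE finset.setUid cards1.
Qed.

Lemma frob2_symx x : frob2 (symx x) = 2 * \sum_(e in all_edges n) x e ^+ 2.
Proof.
rewrite mulr_sumr -[RHS](_ : \sum_(e in all_edges n) x e ^+ 2 * esum (fun _ _ => 1) e = _).
  by rewrite -(sum_symx (fun e => x e ^+ 2) (fun _ _ => 1)); apply: eq_bigr => i _;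
     apply: eq_bigr => j _; rewrite !mxE mulr1; case: eqP => // _; rewrite expr0n.
by apply: eq_bigr => e /edgeP[a [b [ab ->]]]; rewrite esum2//; ring.
Qed.

Lemma sum_adjmx (G : graph n) : G \subset all_edges n ->
  \sum_i \sum_j adjmx R G i j = 2 * #|G|%:R.
Proof.
move=> sG; rewrite adjmx_symx//.
transitivity (\sum_i \sum_j symx (fun e => (e \in G)%:R) i j * (fun _ _ => 1) i j).
  by apply: eq_bigr => i _; apply: eq_bigr => j _; rewrite mulr1.
rewrite sum_symx -sum1_card natr_sum mulr_sumr (big_setID G) /=.
rewrite (finset.setIidPr sG) [X in _ + X]big1 ?addr0; last first.
  by move=> e; rewrite inE => /andP[/negbTE -> _]; rewrite mul0r.
apply: eq_bigr => e eG; rewrite eG mul1r mulr1.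
have /edgeP[a [b [ab ->]]] : e \in all_edges n by apply: (fintype.subsetP sG).
by rewrite esum2.
Qed.

End EdgeSums.

(** * Random subsets with independent elements *)

Section Bernoulli.
Variables (R : realType) (I : finType).
Implicit Types (p : R) (E G : {set I}) (phi psi : {set I} -> R).

Lemma set_ind (P : {set I} -> Prop) : P finset.set0 ->
  (forall e E, e \notin E -> P E -> P (e |: E)%SET) -> forall E, P E.
Proof.
move=> P0 PS E; have [k] := ubnP #|E|; elim: k E => // k IH E Ek.
have [->//|/finset.set0Pn[e eE]] := eqVneq E finset.set0.
rewrite -(finset.setD1K eE); apply: PS; first by rewrite !inE eqxx.
by apply: IH; move: Ek; rewrite (cardsD1 e) eE.
Qed.

Lemma sum_subset_setU1 e E (F : {set I} -> R) : e \notin E ->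
  \sum_(G : {set I} | G \subset (e |: E)%SET) F G =
  \sum_(G : {set I} | G \subset E) (F (e |: G)%SET + F G).
Proof.
move=> eE; rewrite (bigID (fun G : {set I} => e \in G)) /= big_split /=; congr (_ + _).
  rewrite (reindex_onto (fun G => e |: G)%SET (fun G => G :\ e)%SET) /=; last first.
    by move=> G /andP[_ eG]; rewrite finset.setD1K.
  apply: eq_bigl => G; rewrite !inE eqxx andbT.
  apply/andP/idP => [[sG /eqP GE]|sG].
    have eG : e \notin G by rewrite -GE !inE eqxx.
    apply/fintype.subsetP => x xG; have /fintype.subsetP /(_ x) := sG.
    rewrite !inE xG orbT => /(_ isT) /orP[/eqP xe|//].
    by rewrite -xe xG in eG.
  split; first exact: finset.setUS.
  apply/eqP/finset.setU1K; apply: contra eE; exact: fintype.subsetP.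
apply: eq_bigl => G; apply/andP/idP => [[sG eG]|sG].
  apply/fintype.subsetP => x xG; have /fintype.subsetP /(_ x xG) := sG.
  by rewrite !inE => /orP[/eqP xe|//]; rewrite -xe xG in eG.
split; first by apply: fintype.subset_trans sG (finset.subsetUr _ _).
by apply: contra eE; exact: fintype.subsetP.
Qed.

(* Expectation of [phi] of a random subset of [E] containing each point *)
(* independently with probability [p]. *)
Definition bern p E phi : R :=
  \sum_(G : {set I} | G \subset E) p ^+ #|G| * (1 - p) ^+ (#|E| - #|G|) * phi G.

Lemma bern0 p phi : bern p finset.set0 phi = phi finset.set0.
Proof.
rewrite /bern (big_pred1 finset.set0) => [|G]; last by rewrite finset.subset0.
by rewrite cards0 subn0 !expr0 !mul1r.
Qed.

Lemma bernU1 p e E phi : e \notin E ->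
  bern p (e |: E)%SET phi =
  p * bern p E (fun G => phi (e |: G)%SET) + (1 - p) * bern p E phi.
Proof.
move=> eE; rewrite /bern sum_subset_setU1// !mulr_sumr -big_split /=.
apply: eq_bigr => G sG; have eG : e \notin G.
  by apply: contra eE; exact: fintype.subsetP.
rewrite !cardsU1 eE eG !add1n subSS exprS subSn ?subset_leq_card// exprS; ring.
Qed.

Lemma bern_ext p E phi psi : (forall G, G \subset E -> phi G = psi G) ->
  bern p E phi = bern p E psi.
Proof. by move=> h; apply: eq_bigr => G sG; rewrite h. Qed.

Lemma bernD p E phi psi : bern p E (fun G => phi G + psi G) = bern p E phi + bern p E psi.
Proof. by rewrite /bern -big_split; apply: eq_bigr => G _; rewrite mulrDr. Qed.

Lemma bernZ p E (c : R) phi : bern p E (fun G => c * phi G) = c * bern p E phi.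
Proof. by rewrite /bern mulr_sumr; apply: eq_bigr => G _; rewrite mulrCA. Qed.

Lemma bern_sum p E (J : Type) (r : seq J) (Q : pred J) (phi : J -> {set I} -> R) :
  bern p E (fun G => \sum_(j <- r | Q j) phi j G) = \sum_(j <- r | Q j) bern p E (phi j).
Proof.
rewrite /bern exchange_big /=; apply: eq_bigr => G _.
by rewrite mulr_sumr.
Qed.

Lemma bern_prod p E (g : I -> bool -> R) :
  bern p E (fun G => \prod_(e in E) g e (e \in G)) =
  \prod_(e in E) (p * g e true + (1 - p) * g e false).
Proof.
elim/set_ind: E => [|e E eE IH]; first by rewrite bern0 !big_set0.
rewrite bernU1// big_setU1//= [RHS]mulrDl; congr (_ + _).
  rewrite -mulrA; congr (_ * _); rewrite -IH -bernZ; apply: bern_ext => G sG.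
  rewrite big_setU1//= !inE eqxx /=; congr (_ * _); apply: eq_bigr => x xE.
  rewrite !inE; case: eqP => // xe; by rewrite xe (negbTE eE) in xE.
rewrite -mulrA; congr (_ * _); rewrite -IH -bernZ; apply: bern_ext => G sG.
rewrite big_setU1//=; congr (g e _ * _).
by apply/negbTE; apply: contra eE; exact: fintype.subsetP.
Qed.

Lemma bern_cst p E (c : R) : bern p E (fun=> c) = c.
Proof.
have := bern_prod p E (fun _ _ => 1); rewrite [RHS]big1 => [|e _]; last by ring.
move=> /(congr1 (fun x => c * x)); rewrite mulr1 -bernZ => E1.
by rewrite -[RHS]E1; apply: bern_ext => G _; rewrite big1 ?mulr1.
Qed.

Lemma ler_bern p E phi psi : 0 <= p <= 1 -> (forall G, G \subset E -> phi G <= psi G) ->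
  bern p E phi <= bern p E psi.
Proof.
move=> /andP[p0 p1] h; apply: ler_sum => G sG; rewrite ler_wpM2l ?h//.
by rewrite mulr_ge0// exprn_ge0// subr_ge0.
Qed.

Lemma bern_ge0 p E phi : 0 <= p <= 1 -> (forall G, G \subset E -> 0 <= phi G) ->
  0 <= bern p E phi.
Proof. by move=> p01 h; rewrite -(bern_cst p E 0); exact: ler_bern. Qed.

Lemma bern_centered p E e psi : e \in E ->
  (forall G, psi (e |: G)%SET = psi G) ->
  bern p E (fun G => ((e \in G)%:R - p) * psi G) = 0.
Proof.
move=> eE h; have eE' : e \notin (E :\ e)%SET by rewrite !inE eqxx.
rewrite -(finset.setD1K eE) bernU1// -!bernZ -bernD -[RHS](bern_cst p (E :\ e)%SET 0).
apply: bern_ext => G sG; have eG : e \notin G.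
  by apply: contra eE'; exact: fintype.subsetP.
by rewrite h !inE eqxx (negbTE eG) /=; ring.
Qed.

Definition bernP p E (P : pred {set I}) := bern p E (fun G => (P G)%:R).

Lemma ler_bernP p E (P Q : pred {set I}) : 0 <= p <= 1 ->
  (forall G, G \subset E -> P G -> Q G) -> bernP p E P <= bernP p E Q.
Proof.
move=> p01 h; apply: ler_bern => // G sG; rewrite ler_nat.
by case: (P G) (h G sG) => [->|_].
Qed.

Lemma bernPU p E (P Q : pred {set I}) : 0 <= p <= 1 ->
  bernP p E (predU P Q) <= bernP p E P + bernP p E Q.
Proof.
move=> p01; rewrite /bernP -bernD; apply: ler_bern => // G _ /=.
by rewrite -natrD ler_nat; case: (P G); case: (Q G).
Qed.

Lemma bernP_markov p E (P : pred {set I}) (phi : {set I} -> R) (a : R) : 0 <= p <= 1 ->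
  (forall G, G \subset E -> P G -> a <= phi G) ->
  expR a * bernP p E P <= bern p E (fun G => expR (phi G)).
Proof.
move=> p01 h; rewrite /bernP -bernZ; apply: ler_bern => // G sG.
case: (boolP (P G)) => [/(h G sG) ?|_]; first by rewrite mulr1 ler_expR.
by rewrite mulr0 expR_ge0.
Qed.

End Bernoulli.

(** * Binomial coefficients and the passage between the two random graph models *)

Section BinomialBounds.
Variable R : realType.

(** Scaled by [N^N], the weights of the binomial law with parameter [m / N]. The identity [step] for
    consecutive terms shows that they increase up to the mean [m] and decrease afterwards. *)
Lemma binomial_mode N m j : (m <= N)%N -> (j <= N)%N ->
  ('C(N, j) * m ^ j * (N - m) ^ (N - j) <= 'C(N, m) * m ^ m * (N - m) ^ (N - m))%N.
Proof.
move=> mN; pose a j := ('C(N, j) * m ^ j * (N - m) ^ (N - j))%N.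
rewrite -/(a j) -/(a m) => jN.
have step i : (i < N)%N -> (a i.+1 * i.+1 * (N - m) = a i * (N - i) * m)%N.
  move=> iN; rewrite /a expnS -[(N - i)%N](subnSK iN) (expnS (N - m)).
  have := mul_bin_left N i; rewrite -(subnSK iN) => E.
  set u := (_ ^ (N - i.+1))%N; set v := (m ^ i)%N.
  have -> : ('C(N, i.+1) * (m * v) * u * i.+1 * (N - m) = i.+1 * 'C(N, i.+1) * (m * v * u * (N - m)))%N by ring.
  by rewrite E; ring.
have up i : (i < m)%N -> (a i <= a i.+1)%N.
  move=> im; have iN := leq_trans im mN; have := step i iN.
  have [Nm|Nm] := posnP (N - m).
    by move=> _; rewrite /a Nm (exp0n (_ : 0 < N - i)%N) ?muln0// subn_gt0.
  move=> E; have F : (0 < i.+1 * (N - m))%N by rewrite muln_gt0.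
  rewrite -(leq_pmul2r F) [leqRHS]mulnA E -[leqRHS]mulnA leq_mul2l; apply/orP; right; nia.
have down i : (m <= i)%N -> (i < N)%N -> (a i.+1 <= a i)%N.
  move=> im iN; have := step i iN.
  have Nm : (0 < N - m)%N by rewrite subn_gt0 (leq_ltn_trans im).
  move=> E; have F : (0 < i.+1 * (N - m))%N by rewrite muln_gt0.
  rewrite -(leq_pmul2r F) [leqLHS]mulnA E -[leqLHS]mulnA leq_mul2l; apply/orP; right; nia.
have [jm|mj] := leqP j m.
  rewrite -(subKn jm); move: (m - j)%N (leq_subr j m) => d; elim: d => [|d IH] dm.
    by rewrite subn0.
  apply: leq_trans (IH (ltnW dm)); rewrite -(subnSK dm); apply: up.
  by rewrite ltn_subrL (leq_trans _ dm).
rewrite -(subnKC (ltnW mj)); move: (j - m)%N (subnKC (ltnW mj)) => d dE.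
have : (m + d <= N)%N by rewrite dE.
elim: d {dE} => [|d IH] dN; first by rewrite addn0.
rewrite addnS in dN *; apply: leq_trans (IH (ltnW dN)).
by apply: down => //; exact: leq_addr.
Qed.

(** The weights sum to [N^N = (m + (N - m))^N], and each of the [N + 1] terms is at most the one at
    the mode. *)
Lemma expn_le_binomial N m : (m <= N)%N ->
  (N ^ N <= N.+1 * ('C(N, m) * m ^ m * (N - m) ^ (N - m)))%N.
Proof.
move=> mN; rewrite -{1}(subnK mN) expnDn.
apply: (@leq_trans (\sum_(i < N.+1) 'C(N, m) * m ^ m * (N - m) ^ (N - m))).
  apply: leq_sum => i _; apply: leq_trans (binomial_mode mN (ltn_ord i)).
  by rewrite mulnA -mulnA [(_ ^ _ * _)%N]mulnC mulnA.
by rewrite sum_nat_const card_ord.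
Qed.

(* The relative entropy of [m / N] with respect to [p] is at most their *)
(* chi-squared distance, by [1 + x <= expR x]. *)
Lemma binomial_ge (p : R) N m : 0 < p -> p < 1 -> (0 < N)%N -> (m <= N)%N ->
  N.+1%:R^-1 * expR (- (N%:R * (m%:R / N%:R - p) ^+ 2 / (p * (1 - p)))) <=
  'C(N, m)%:R * p ^+ m * (1 - p) ^+ (N - m).
Proof.
move=> p0 p1 N0 mN; set q : R := m%:R / N%:R.
have NR : 0 < N%:R :> R by rewrite ltr0n.
have q1 : 1 - q = (N - m)%:R / N%:R by rewrite natrB// /q; field; rewrite gt_eqF.
have p1' : 0 < 1 - p by rewrite subr_gt0.
have qE : q * N%:R = m%:R by rewrite /q; field; rewrite gt_eqF.
have q1E : (1 - q) * N%:R = (N - m)%:R by rewrite q1; field; rewrite gt_eqF.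
have q0 : 0 <= q by rewrite divr_ge0.
have q10 : 0 <= 1 - q by rewrite q1 divr_ge0.
have pw (x y : R) k : 0 <= x -> 0 < y -> x ^+ k <= y ^+ k * expR (k%:R * (x / y - 1)).
  move=> x0 y0; have -> : expR (k%:R * (x / y - 1)) = expR (x / y - 1) ^+ k.
    by rewrite -expRM_natl mulr_natl.
  rewrite -exprMn; apply: lerXn2r; rewrite ?nnegrE ?mulr_ge0 ?expR_ge0 ?(ltW y0)//.
  have := expR_ge1Dx (x / y - 1); rewrite addrC subrK ler_pdivrMr// [_ * y]mulrC; exact.
have A := pw q p m q0 p0; have B := pw (1 - q) (1 - p) (N - m)%N q10 p1'.
have AB : q ^+ m * (1 - q) ^+ (N - m) <=
   p ^+ m * (1 - p) ^+ (N - m) * expR (N%:R * (q - p) ^+ 2 / (p * (1 - p))).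
  apply: (le_trans (ler_pM (exprn_ge0 _ q0) (exprn_ge0 _ q10) A B)).
  rewrite mulrACA -expRD.
  have -> : m%:R * (q / p - 1) + (N - m)%:R * ((1 - q) / (1 - p) - 1)
      = N%:R * (q - p) ^+ 2 / (p * (1 - p)); last exact: lexx.
  by rewrite -q1E -qE; field; rewrite ?gt_eqF.
have C : N.+1%:R^-1 <= 'C(N, m)%:R * (q ^+ m * (1 - q) ^+ (N - m)).
  have := expn_le_binomial mN; rewrite -(ler_nat R) !natrM !natrX => h.
  rewrite -[leLHS]mul1r ler_pdivrMr ?ltr0n//.
  have NN : 0 < N%:R ^+ N :> R by rewrite exprn_gt0.
  rewrite -(ler_pM2r NN) mul1r; apply: le_trans h _; apply: eq_ler.
  have -> : N%:R ^+ N = N%:R ^+ m * N%:R ^+ (N - m) :> R by rewrite -exprD subnKC.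
  by rewrite -qE -q1E !exprMn; ring.
rewrite expRN ler_pdivrMr ?expR_gt0//.
apply: le_trans C _; have := ler_wpM2l (ler0n R 'C(N, m)) AB.
by rewrite !mulrA.
Qed.

Lemma card_all_edges n : #|all_edges n| = 'C(n, 2).
Proof. by rewrite /all_edges cardsE; have := card_draws 'I_n 2; rewrite cardsE card_ord. Qed.

Lemma card_Gnm_support n m : #|Gnm_support n m| = 'C('C(n, 2), m).
Proof.
by rewrite -card_all_edges -cards_draws; apply: eq_card => G; rewrite !inE.
Qed.

Lemma card_Gnm_le_bernP (p : R) n m (P : pred (graph n)) : 0 <= p <= 1 ->
  #|[set G in Gnm_support n m | P G]|%:R * (p ^+ m * (1 - p) ^+ ('C(n, 2) - m)) <=
  bernP p (all_edges n) P.
Proof.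
move=> /andP[p0 p1]; rewrite -sum1_card natr_sum mulr_suml /bernP /bern.
rewrite [leRHS]big_mkcond [leLHS]big_mkcond /=; apply: ler_sum => G _.
rewrite !inE card_all_edges; have h k l : 0 <= p ^+ k * (1 - p) ^+ l.
  by rewrite mulr_ge0// exprn_ge0// subr_ge0.
case: (G \subset all_edges n) => //=; case: eqP => [<-|_] /=; last by rewrite mulr_ge0.
by case: (P G); rewrite ?mulr1 ?mul1r ?mulr0.
Qed.

(** All graphs with [m] edges have the same weight in the binomial model, so G(n,m) is that model
    conditioned on [m] edges; [binomial_ge] bounds the probability of the conditioning from
    below. *)
Lemma Pr_Gnm_le_bernP (p : R) n m (P : pred (graph n)) : 0 < p -> p < 1 ->
  (0 < 'C(n, 2))%N -> (m <= 'C(n, 2))%N ->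
  Pr_Gnm R m P <= 'C(n, 2).+1%:R *
    expR ('C(n, 2)%:R * (m%:R / 'C(n, 2)%:R - p) ^+ 2 / (p * (1 - p))) *
    bernP p (all_edges n) P.
Proof.
move=> p0 p1 N0 mN; rewrite /Pr_Gnm card_Gnm_support; set N := 'C(n, 2) in N0 mN *.
have := binomial_ge p0 p1 N0 mN; rewrite expRN; set X := expR _ => h.
have X0 : 0 < X by exact: expR_gt0.
have CR : 0 < 'C(N, m)%:R :> R by rewrite ltr0n bin_gt0.
have p01 : 0 <= p <= 1 by rewrite !ltW.
rewrite ler_pdivrMr//; have := card_Gnm_le_bernP m P p01; rewrite -/N.
set K := #|_|%:R; set B := bernP _ _ _; set w := p ^+ m * _.
have w0 : 0 < w by rewrite mulr_gt0// exprn_gt0// subr_gt0.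
move=> KB; rewrite -(ler_pM2r w0); apply: le_trans KB _.
have N1 : 0 < N.+1%:R :> R by rewrite ltr0n.
have B0 : 0 <= B by apply: bern_ge0 => // G _; rewrite ler0n.
have : 1 <= N.+1%:R * X * ('C(N, m)%:R * w).
  move: h; rewrite -invfM -mulrA -/w => h.
  by rewrite -ler_pdivrMl ?mulr_gt0// mulr1.
move=> /(ler_wpM2r B0); rewrite mul1r => /le_trans; apply.
apply: eq_ler; ring.
Qed.

End BinomialBounds.

(** * Subgaussian bounds and low-rank matrices *)

Section KearnsSaul.
Variable R : realType.
Implicit Types (a b x y l p : R).

Lemma is_derive_mono (f df : R -> R) a b : a <= b ->
  (forall x, is_derive x 1 f (df x)) -> (forall x, a <= x <= b -> 0 <= df x) ->
  f a <= f b.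
Proof.
move=> ab fd df0; have [|c] := @MVT_segment R f df a b ab (fun x _ => fd x).
  apply: derivable_within_continuous => x _; by have [] := fd x.
rewrite in_itv /= => cab E; rewrite -subr_ge0 E.
by rewrite mulr_ge0 ?subr_ge0// df0.
Qed.

(** [ch] and [sh] are twice the hyperbolic cosine and sine. *)
Definition ch x : R := expR x + expR (- x).
Definition sh x : R := expR x - expR (- x).

Lemma is_derive_expN x : is_derive x 1 (fun y => expR (- y)) (- expR (- x)).
Proof.
have := @is_derive1_comp R expR -%R x (expR (- x)) (- 1) _ _.
by rewrite mulrN1; apply.
Qed.

Lemma is_derive_ch x : is_derive x 1 ch (sh x).
Proof. exact: (is_deriveD (is_derive_expR x) (is_derive_expN x)). Qed.

Lemma is_derive_sh x : is_derive x 1 sh (ch x).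
Proof.
have := is_deriveB (is_derive_expR x) (is_derive_expN x).
by rewrite opprK.
Qed.

Lemma ch_gt0 x : 0 < ch x.
Proof. by rewrite addr_gt0// expR_gt0. Qed.

Lemma ch_norm x : ch `|x| = ch x.
Proof. by rewrite /ch; case: ger0P => // _; rewrite opprK addrC. Qed.

Lemma sh_ge0 x : 0 <= x -> 0 <= sh x.
Proof. by move=> x0; rewrite subr_ge0 ler_expR; lra. Qed.

Lemma sh0 : sh 0 = 0.
Proof. by rewrite /sh oppr0 subrr. Qed.

Lemma ch_mono x y : 0 <= x -> x <= y -> ch x <= ch y.
Proof.
move=> x0 xy; apply: (is_derive_mono xy is_derive_ch) => z /andP[xz _].
by rewrite sh_ge0// (le_trans x0).
Qed.

Lemma sh_le_xch x : 0 <= x -> sh x <= x * ch x.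
Proof.
move=> x0; rewrite -subr_ge0.
have := @is_derive_mono (fun y => y * ch y - sh y) (fun y => y * sh y) 0 x x0.
rewrite mul0r sh0 subr0; apply; last first.
  by move=> y /andP[y0 _]; rewrite mulr_ge0 ?sh_ge0.
move=> y; have := is_deriveB (is_deriveM (is_derive_id y 1) (is_derive_ch y)) (is_derive_sh y).
rewrite (_ : y *: sh y + ch y *: 1 - ch y = y * sh y)//.
by rewrite /GRing.scale /=; ring.
Qed.

Lemma sh_ratio x y : 0 <= x -> x <= y -> y * sh x <= x * sh y.
Proof.
move=> x0 xy; rewrite -subr_ge0.
have := @is_derive_mono (fun z => x * sh z - z * sh x) (fun z => x * ch z - sh x) x y xy.
rewrite subrr; apply; last first.
  move=> z /andP[xz _]; rewrite subr_ge0; apply: le_trans (sh_le_xch x0) _.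
  by rewrite ler_wpM2l// ch_mono.
move=> z; have := is_deriveB (is_deriveM (is_derive_cst x z 1) (is_derive_sh z))
   (is_deriveM (is_derive_id z 1) (is_derive_cst (sh x) z 1)).
rewrite (_ : x *: ch z + sh z *: 0 - _ = x * ch z - sh x)//.
by rewrite /GRing.scale /=; ring.
Qed.

Lemma sh_ch x y : sh x * ch y = sh (x + y) + sh (x - y).
Proof. by rewrite /sh /ch !opprD opprK !expRD; ring. Qed.

(** Monotonicity of [tanh z / z]: the product formula [sh_ch] reduces it to that of [sinh z / z] at
    the points [a - b] and [a + b]. *)
Lemma tanh_ratio a b : 0 <= b -> b <= a -> b * (sh a * ch b) <= a * (sh b * ch a).
Proof.
move=> b0 ba; rewrite !sh_ch (addrC b a).
have -> : sh (b - a) = - sh (a - b) by rewrite /sh !opprB; ring.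
have := @sh_ratio (a - b) (a + b); rewrite subr_ge0 => /(_ ba).
have h : a - b <= a + b by lra.
by move=> /(_ h); lra.
Qed.

(** Here [tau = tanh a / a] is twice the slope of [ln cosh] with respect to the square of its
    argument, with limit [1] at [a = 0]. The function [g], the quotient of the two sides up to a
    constant, increases up to [a] and decreases afterwards because [tanh x / x] is decreasing. *)
Lemma ch_subgaussian a b tau : 0 <= a -> a * tau * ch a = sh a -> (a = 0 -> tau = 1) ->
  ch b <= ch a * expR (tau * (b ^+ 2 - a ^+ 2) / 2).
Proof.
move=> a0 at0 tau1; rewrite -ch_norm -[b ^+ 2]real_normK ?num_real//.
move: `|b| (normr_ge0 b) => {}b b0.
pose g x := ch x * expR (- (tau * x ^+ 2 / 2)).
pose dg x := (sh x - tau * x * ch x) * expR (- (tau * x ^+ 2 / 2)).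
have gd x : is_derive x 1 g (dg x).
  have h1 : is_derive x 1 (fun y => - (tau * y ^+ 2 / 2)) (- (tau * x)).
    have := is_deriveM (is_derive_cst (- (tau / 2)) x 1) (is_deriveM (is_derive_id x 1) (is_derive_id x 1)).
    rewrite (_ : _ + _ = - (tau * x)); last by rewrite /GRing.scale /=; field.
    rewrite (_ : _ * _ = (fun y => - (tau * y ^+ 2 / 2)))//.
    by apply/funext => y; rewrite -[LHS]/(- (tau / 2) * (y * y)); field.
  have := is_deriveM (is_derive_ch x) (is_derive1_comp (is_derive_expR _) h1).
  rewrite (_ : _ + _ = dg x)//.
  by rewrite /dg /GRing.scale /=; ring.
suff : g b <= g a.
  rewrite /g => h; have := ler_wpM2r (expR_ge0 (tau * b ^+ 2 / 2)) h.
  rewrite -!mulrA -!expRD addNr expR0 mulr1 => /le_trans; apply.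
  by apply: eq_ler; congr (_ * expR _); field.
have sgn x : 0 <= x -> x <= a -> 0 <= sh x - tau * x * ch x.
  move=> x0 xa; have [a00|an0] := eqVneq a 0.
    have -> : x = 0 by apply/eqP; rewrite eq_le x0 -{1}a00 xa.
    by rewrite sh0; lra.
  have ap : 0 < a by rewrite lt_neqAle eq_sym an0.
  have := tanh_ratio x0 xa; rewrite -at0 => h.
  rewrite subr_ge0 -(ler_pM2l ap) -(ler_pM2r (ch_gt0 a)); lra.
have sgn' x : a <= x -> sh x - tau * x * ch x <= 0.
  move=> ax; have x0 := le_trans a0 ax; have [a00|an0] := eqVneq a 0.
    by rewrite (tau1 a00) mul1r subr_le0 sh_le_xch.
  have ap : 0 < a by rewrite lt_neqAle eq_sym an0.
  have := tanh_ratio a0 ax; rewrite -at0 => h.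
  rewrite subr_le0 -(ler_pM2l ap) -(ler_pM2r (ch_gt0 a)); lra.
have [ba|/ltW ab] := leP b a.
  apply: (is_derive_mono ba gd) => x /andP[bx xa].
  by rewrite mulr_ge0 ?expR_ge0// sgn// (le_trans b0).
rewrite -lerN2.
apply: (@is_derive_mono (fun x => - g x) (fun x => - dg x) a b ab) => x /andP[ax _].
by rewrite oppr_ge0 mulr_le0_ge0 ?expR_ge0// sgn'.
Qed.

Lemma kappa_gt0 p : 0 < p -> p <= 2^-1 -> 0 < kappa p.
Proof.
move=> p0 p2; rewrite /kappa; case: eqP => [_|/eqP pn]; first by [].
have p2' : p < 2^-1 by rewrite lt_neqAle pn.
have q : 0 < 1 - p by lra.
rewrite nmulr_lgt0 ?invr_lt0; last by lra.
by apply: ln_lt0; rewrite divr_gt0//= ltr_pdivrMr//; lra.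
Qed.

(* Kearns--Saul: after the shift [l = 2 b + ln ((1 - p) / p)] this is the tangent *)
(* line inequality for [ln cosh b] as a concave function of [b ^+ 2]. *)
Lemma kearns_saul p l : 0 < p -> p <= 2^-1 ->
  p * expR (l * (1 - p)) + (1 - p) * expR (- (l * p)) <= expR (l ^+ 2 / (4 * kappa p)).
Proof.
move=> p0 p2; have q0 : 0 < 1 - p by lra.
pose a := ln ((1 - p) / p) / 2; pose b := l / 2 - a.
have pq : 0 < (1 - p) / p by rewrite divr_gt0.
have ea : expR (2 * a) = (1 - p) / p by rewrite /a mulrC divfK// lnK ?posrE.
have ea1 : 1 - p = p * expR (2 * a) by rewrite ea; field; rewrite gt_eqF.
have a0 : 0 <= a by rewrite divr_ge0// ln_ge0// ler_pdivlMr//; lra.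
have sa : sh a = (1 - 2 * p) * ch a.
  have -> : sh a = expR (- a) * (expR (2 * a) - 1).
    by rewrite /sh mulrBr mulr1 -expRD; congr (expR _ - _); ring.
  have -> : ch a = expR (- a) * (expR (2 * a) + 1).
    by rewrite /ch mulrDr mulr1 -expRD; congr (expR _ + _); ring.
  by rewrite ea; field; rewrite gt_eqF.
have cha : (1 - p) * ch a = expR a.
  have -> : ch a = expR a * (1 + (expR (2 * a))^-1).
    by rewrite /ch mulrDr mulr1 -expRN -expRD; congr (_ + expR _); ring.
  by rewrite ea; field; rewrite !gt_eqF.
(* Since [2 a] is [ln ((1 - p) / p)], [tanh a = 1 - 2 p] and [tau] is [tanh a / a]; at [p = 1/2] the
   convention in [kappa] gives the limit [1]. *)
pose tau := 2 / kappa p.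
have kp := kappa_gt0 p0 p2.
have atau : a * tau = 1 - 2 * p.
  rewrite /tau /a /kappa; have [->|pn] := eqVneq p 2^-1.
    rewrite (_ : (1 - 2^-1) / 2^-1 = 1) ?ln1; last by field.
    by rewrite mul0r mul0r; field.
  have -> : ln (p / (1 - p)) = - ln ((1 - p) / p) :> R.
    by rewrite -lnV ?posrE// invf_div.
  have lp : 0 < ln ((1 - p) / p).
    have p2' : p < 2^-1 by rewrite lt_neqAle pn.
    by rewrite ln_gt0// ltr_pdivlMr//; lra.
  have p2n : 2 * p - 1 != 0 by apply: contra_neq pn => h; lra.
  by field; rewrite p2n gt_eqF.
have tau1 : a = 0 -> tau = 1.
  move=> h; have pE : p = 2^-1 by move: atau; rewrite h mul0r => E; lra.
  by rewrite /tau /kappa pE eqxx divff.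
have := @ch_subgaussian a b tau a0 _ tau1; rewrite atau => /(_ (esym sa)) h.
have -> : p * expR (l * (1 - p)) + (1 - p) * expR (- (l * p)) =
   expR (b - l * p) * ((1 - p) * ch b).
  have -> : p * expR (l * (1 - p)) = p * (expR (b - l * p) * expR (2 * a) * expR b).
    by rewrite -!expRD; congr (_ * expR _); rewrite /b; field.
  have -> : expR (- (l * p)) = expR (b - l * p) * expR (- b).
    by rewrite -expRD; congr expR; ring.
  by rewrite /ch [in RHS]mulrDr [in LHS]ea1 [in X in _ = _ * X]ea1; ring.
apply: (@le_trans _ _ (expR (b - l * p) * ((1 - p) * (ch a * expR (tau * (b ^+ 2 - a ^+ 2) / 2))))).
  by rewrite ler_wpM2l ?expR_ge0// ler_wpM2l// ltW.
rewrite [(1 - p) * _]mulrA cha -!expRD ler_expR; apply: eq_ler.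
have -> : l ^+ 2 / (4 * kappa p) = tau * l ^+ 2 / 8 by rewrite /tau; field; rewrite gt_eqF.
have -> : l * p = l / 2 - l / 2 * (a * tau) by rewrite atau; field.
by rewrite /b; field.
Qed.

End KearnsSaul.

Section SubgaussianEdges.
Variable R : realType.
Implicit Types (n : nat) (p : R).

Lemma expR_sum (I : Type) (r : seq I) (Q : pred I) (F : I -> R) :
  expR (\sum_(i <- r | Q i) F i) = \prod_(i <- r | Q i) expR (F i).
Proof. exact: (big_morph expR (@expRD R) (@expR0 R)). Qed.

Definition ip n (A B : 'M[R]_n) : R := \sum_i \sum_j A i j * B i j.

Definition cmx p n (G : graph n) : 'M[R]_n := symx (fun e => (e \in G)%:R - p).

Lemma ip_mgf p n (B : 'M[R]_n) th : 0 < p -> p <= 2^-1 ->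
  bern p (all_edges n) (fun G => expR (th * ip (cmx p G) B)) <=
  expR (th ^+ 2 * frob2 B / (2 * kappa p)).
Proof.
move=> p0 p2; have kp := kappa_gt0 p0 p2.
have -> : bern p (all_edges n) (fun G => expR (th * ip (cmx p G) B)) =
  bern p (all_edges n) (fun G => \prod_(e in all_edges n)
    (fun e b => expR (th * ((b%:R - p) * esum B e))) e (e \in G)).
  by apply: bern_ext => G _; rewrite -expR_sum -mulr_sumr /ip sum_symx.
rewrite (bern_prod p _ (fun e b => expR (th * ((b%:R - p) * esum B e)))).
apply: (@le_trans _ _ (\prod_(e in all_edges n)
    expR ((th * esum B e) ^+ 2 / (4 * kappa p)))).
  apply: ler_prod => e _; apply/andP; split.
    by rewrite addr_ge0// mulr_ge0 ?expR_ge0//; lra.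
  have := kearns_saul (th * esum B e) p0 p2; rewrite /= sub0r.
  by rewrite mulNr mulrN [(1 - p) * esum B e]mulrC [p * esum B e]mulrC !mulrA.
rewrite -expR_sum ler_expR.
have -> : \sum_(i in all_edges n) (th * esum B i) ^+ 2 / (4 * kappa p)
   = th ^+ 2 / (4 * kappa p) * \sum_(i in all_edges n) esum B i ^+ 2.
  by rewrite mulr_sumr; apply: eq_bigr => e _; rewrite exprMn; ring.
have c0 : 0 <= th ^+ 2 / (4 * kappa p) by rewrite divr_ge0 ?sqr_ge0// mulr_ge0// ltW.
apply: le_trans (ler_wpM2l c0 (sum_esum_sqr B)) _.
by apply: eq_ler; field; rewrite gt_eqF.
Qed.

End SubgaussianEdges.

(** * Rounding to a grid, and a net for matrices of low rank *)

Section Rounding.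
Variables (R : realType) (C J : finType) (mu : J -> R) (c : J -> C -> R) (beta h : R).
Hypotheses (beta0 : 0 <= beta) (h0 : 0 < h).
Implicit Types (x y : C -> R).

Let lin u x := \sum_i c u i * x i.
Let quad x := \sum_u (mu u * lin u x - beta * lin u x ^+ 2).
Let cost i := \sum_u c u i ^+ 2.

Local Lemma lin_shift u x i d :
  lin u (fun j => x j + (if j == i then d else 0)) = lin u x + c u i * d.
Proof.
rewrite /lin (bigD1 i)//= [in RHS](bigD1 i)//= eqxx mulrDr -!addrA; congr (_ + _).
rewrite addrC; congr (_ + _); apply: eq_bigr => j /negbTE ->.
by rewrite addr0.
Qed.

Local Lemma quad_shift x i :
  exists A, forall d, quad (fun j => x j + (if j == i then d else 0)) =
     quad x + A * d - beta * d ^+ 2 * cost i.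
Proof.
exists (\sum_u (mu u * c u i - 2 * beta * lin u x * c u i)) => d.
rewrite /quad /cost mulr_suml mulr_sumr -big_split -sumrB /=.
by apply: eq_bigr => u _; rewrite lin_shift; ring.
Qed.

Local Lemma round_one x i : exists (z : int) d, [/\ x i + d = h * z%:~R,
  `|z%:~R| <= `|x i| / h + 1 :> R &
  quad x - beta * h ^+ 2 * cost i <= quad (fun j => x j + (if j == i then d else 0))].
Proof.
have [A quadE] := quad_shift x i.
have := floor_itv (x i / h); set q := Num.floor _ => /andP[q1 q2].
have ah : `|x i| / h = `|x i / h| by rewrite normrM normfV (gtr0_norm h0).
have cost0 : 0 <= cost i by apply: sumr_ge0 => u _; exact: sqr_ge0.
rewrite intrD in q2.
have fin d : 0 <= A * d -> d ^+ 2 <= h ^+ 2 ->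
    quad x - beta * h ^+ 2 * cost i <= quad x + A * d - beta * d ^+ 2 * cost i.
  move=> Ad dh; have := ler_wpM2l beta0 (ler_wpM2r cost0 dh); lra.
have xih : x i = h * (x i / h) by rewrite mulrC divfK// gt_eqF.
have sq d : `|d| <= h -> d ^+ 2 <= h ^+ 2.
  by move=> dh; rewrite -[d ^+ 2]real_normK ?num_real// lerXn2r// nnegrE ltW.
have [A0|A0] := leP 0 A.
  exists (q + 1), (h * (q + 1)%:~R - x i); split.
  - by rewrite addrC subrK.
  - rewrite ah intrD; have := ler_norm (x i / h); have := ler_norm (- (x i / h)).
    by rewrite normrN => ? ?; rewrite ler_norml; apply/andP; split; lra.
  - rewrite quadE; have d0 : 0 <= h * (q + 1)%:~R - x i.
      by rewrite {1}xih -mulrBr mulr_ge0 ?(ltW h0)// intrD; lra.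
    apply: fin; first by rewrite mulr_ge0.
    apply: sq; rewrite ger0_norm// {1}xih -mulrBr -[leRHS]mulr1.
    by rewrite ler_wpM2l ?(ltW h0)// intrD; lra.
exists q, (h * q%:~R - x i); split.
- by rewrite addrC subrK.
- rewrite ah; have := ler_norm (x i / h); have := ler_norm (- (x i / h)).
  by rewrite normrN => ? ?; rewrite ler_norml; apply/andP; split; lra.
- rewrite quadE; have d0 : h * q%:~R - x i <= 0.
    by rewrite {1}xih -mulrBr mulr_ge0_le0 ?(ltW h0)//; lra.
  apply: fin; first by rewrite mulr_le0// ltW.
  apply: sq; rewrite ler0_norm// opprB {1}xih -mulrBr -[leRHS]mulr1.
  by rewrite ler_wpM2l ?(ltW h0)//; lra.
Qed.

(* Moving one coordinate to a neighbouring grid point, in the direction in which the *)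
(* linear part increases, costs at most the quadratic term. *)
Lemma round_quadratic x : exists z : C -> int,
  (forall i, `|(z i)%:~R| <= `|x i| / h + 1 :> R) /\
  quad x - beta * h ^+ 2 * \sum_i cost i <= quad (fun i => h * (z i)%:~R).
Proof.
suff H (l : seq C) : uniq l -> exists y,
    [/\ forall i, i \in l -> exists z : int, y i = h * z%:~R /\ `|z%:~R| <= `|x i| / h + 1 :> R,
        forall i, i \notin l -> y i = x i &
        quad x - beta * h ^+ 2 * \sum_(i <- l) cost i <= quad y].
  have [y [yz _ yq]] := H (enum C) (enum_uniq C).
  have /fin_all_exists[z zP] i : exists z : int, y i = h * z%:~R /\ `|z%:~R| <= `|x i| / h + 1 :> R.
    by apply: yz; rewrite mem_enum.
  exists z; split; first by move=> i; have [] := zP i.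
  rewrite big_enum /= in yq; congr (_ <= quad _) : yq.
  by apply/funext => i; have [->] := zP i.
elim: l => [_|i l IH /= /andP[il ul]].
  by exists x; rewrite big_nil mulr0 subr0; split.
have [y [yz yx yq]] := IH ul.
have [z [d [zE zb zq]]] := round_one y i.
exists (fun j => y j + (if j == i then d else 0)); split.
- move=> j; rewrite inE; have [->|ji] := eqVneq j i => /= jl.
    by exists z; rewrite zE; split=> //; rewrite -(yx i il).
  by have [w [wE wb]] := yz j jl; exists w; rewrite addr0.
- move=> j; rewrite inE negb_or => /andP[/negbTE -> jl]; by rewrite addr0 yx.
- rewrite big_cons mulrDr; apply: le_trans zq; lra.
Qed.

End Rounding.

Section GridCount.
Variables (R : realType) (C : finType) (L : nat).
(** Sign and absolute value of the coordinates. Zero has two codes, which is harmless in an upper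
    bound for the number of points. *)
Definition grid := {ffun C -> 'I_L.+1 * bool}.

Definition gval (w : grid) (i : C) : R := (-1) ^+ (w i).2 * (w i).1%:R.

Definition small_grid : {set grid} := [set w : grid | (\sum_i (w i).1 <= L)%N].

(* Give the grid point [w] the weight [2^-(sum_i |w i|)]. *)
Lemma card_small_grid : #|small_grid|%:R <= 2 ^+ L * 4 ^+ #|C| :> R.
Proof.
have E : \sum_(w : grid) \prod_i (2^-1 ^+ (w i).1 : R) <= 4 ^+ #|C|.
  rewrite -(bigA_distr_bigA (fun i (j : 'I_L.+1 * bool) => 2^-1 ^+ j.1)) /=.
  rewrite -prodr_const; apply: ler_prod => i _; apply/andP; split.
    by apply: sumr_ge0 => j _; rewrite exprn_ge0// invr_ge0.
  rewrite -(pair_big xpredT xpredT (fun (j : 'I_L.+1) (b : bool) => 2^-1 ^+ j : R)) /=.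
  under eq_bigr => j _ do rewrite big_bool /= -mulr2n.
  rewrite sumrMnl.
  suff : \sum_(j < L.+1) (2^-1 : R) ^+ j <= 2 by lra.
  have -> : \sum_(j < L.+1) (2^-1 : R) ^+ j = 2 - 2^-1 ^+ L.
    elim: L => [|l IH]; first by rewrite big_ord1 !expr0; lra.
    by rewrite big_ord_recr /= IH exprS; field.
  by rewrite lerBlDr lerDl exprn_ge0// invr_ge0.
apply: le_trans (ler_wpM2l (exprn_ge0 L (ler0n R 2)) E).
rewrite mulr_sumr -sum1_card natr_sum big_mkcond /=; apply: ler_sum => w _.
rewrite inE prodrXr; case: ifPn => [wL|_]; last first.
  by rewrite mulr_ge0// exprn_ge0// invr_ge0.
move: (\sum_i (w i).1)%N wL => S wL; rewrite -(subnK wL) exprD -mulrA -exprMn divff// expr1n mulr1.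
by rewrite -natrX ler1n expn_gt0.
Qed.

Lemma gval_surj (z : C -> int) : (\sum_i `|z i|%N <= L)%N ->
  exists2 w, w \in small_grid & forall i, gval w i = (z i)%:~R.
Proof.
move=> zL; have zi i : (`|z i|%N < L.+1)%N.
  by rewrite ltnS (leq_trans _ zL)// (bigD1 i)//= leq_addr.
exists [ffun i => (Ordinal (zi i), (z i < 0)%R)].
  by rewrite inE; under eq_bigr do rewrite ffunE.
move=> i; rewrite /gval ffunE /=; case: (z i) => k /=; first by rewrite mul1r.
by rewrite expr1 mulN1r NegzE mulrNz.
Qed.

End GridCount.

Section LowRank.
Variable R : realType.
Implicit Types (n r q : nat) (p beta h : R).

Lemma ip_tr n (A B : 'M[R]_n) : ip A^T B^T = ip A B.
Proof.
rewrite /ip exchange_big /=; apply: eq_bigr => i _; apply: eq_bigr => j _.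
by rewrite !mxE.
Qed.

Lemma frob2_trmx m n (A : 'M[R]_(m, n)) : frob2 A^T = frob2 A.
Proof.
rewrite /frob2 exchange_big /=; apply: eq_bigr => i _; apply: eq_bigr => j _.
by rewrite !mxE.
Qed.

(* For [th = 2 * kappa p * beta] the penalty cancels the bound of [ip_mgf], so that a   *)
(* union bound over a net needs no control of the norms of its points.                 *)
Definition penalized beta n (M B : 'M[R]_n) : R := ip M B - beta * frob2 B.

Definition gridmx h n r (z : 'I_n * 'I_r -> int) : 'M[R]_(n, r) :=
  \matrix_(i, j) (h * (z (i, j))%:~R).

(** For fixed [V] the entries of [V U^T] are linear forms in the entries of [U], so
    [round_quadratic] applies. Summed over all coordinates, the squared coefficients give [n] copies
    of [frob2 V]. *)
Lemma round_right beta h n r (M : 'M[R]_n) (U V : 'M[R]_(n, r)) : 0 <= beta -> 0 < h ->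
  exists z : 'I_n * 'I_r -> int,
  (forall i, `|(z i)%:~R| <= `|U i.1 i.2| / h + 1 :> R) /\
  penalized beta M (V *m U^T) - beta * h ^+ 2 * (n%:R * frob2 V) <=
  penalized beta M (V *m (gridmx h z)^T).
Proof.
move=> b0 h0; pose c (u : 'I_n * 'I_n) (i : 'I_n * 'I_r) : R := (u.2 == i.1)%:R * V u.1 i.2.
have [z [zb zq]] := round_quadratic (fun u : 'I_n * 'I_n => M u.1 u.2) c b0 h0
  (fun i => U i.1 i.2).
exists z; split=> //.
have lin (X : 'M[R]_(n, r)) u : \sum_i c u i * X i.1 i.2 = (V *m X^T) u.1 u.2.
  rewrite -(pair_big xpredT xpredT (fun i j => c u (i, j) * X i j)) /=.
  rewrite (bigD1 u.2)//= [X in _ + X]big1 ?addr0; last first.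
    move=> i /negbTE iu; rewrite big1// => j _; by rewrite /c eq_sym iu !mul0r.
  by rewrite mxE; apply: eq_bigr => j _; rewrite /c eqxx mul1r mxE.
have pen (X : 'M[R]_(n, r)) : penalized beta M (V *m X^T) =
    \sum_u (M u.1 u.2 * (\sum_i c u i * X i.1 i.2) - beta * (\sum_i c u i * X i.1 i.2) ^+ 2).
  under eq_bigr do rewrite lin.
  by rewrite /penalized /ip /frob2 !pair_big /= mulr_sumr sumrB.
have cost : \sum_(i : 'I_n * 'I_r) \sum_(u : 'I_n * 'I_n) c u i ^+ 2 = n%:R * frob2 V.
  rewrite -(pair_big xpredT xpredT (fun a j => \sum_(u : 'I_n * 'I_n) c u (a, j) ^+ 2)) /=.
  under eq_bigr => a _.
    under eq_bigr => j _.
      rewrite -(pair_big xpredT xpredT (fun a' b => c (a', b) (a, j) ^+ 2)) /=.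
      under eq_bigr => a' _.
        rewrite (bigD1 a)//= [X in _ + X]big1 ?addr0; last first.
          by move=> b /negbTE ba; rewrite /c /= ba mul0r expr0n.
        rewrite /c /= eqxx mul1r; over.
      over.
    rewrite exchange_big /=; over.
  by rewrite sumr_const card_ord mulr_natl.
have U' : gridmx h z = \matrix_(i, j) (h * (z (i, j))%:~R) by [].
rewrite cost -pen in zq; apply: le_trans zq _; rewrite pen.
apply: eq_ler; apply: eq_bigr => u _.
have -> : \sum_i c u i * gridmx h z i.1 i.2 = \sum_i c u i * (h * (z i)%:~R).
  by apply: eq_bigr => -[a j] _; rewrite mxE.
by [].
Qed.

Lemma round_left beta h n r (M : 'M[R]_n) (U V : 'M[R]_(n, r)) : 0 <= beta -> 0 < h ->
  exists z : 'I_n * 'I_r -> int,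
  (forall i, `|(z i)%:~R| <= `|V i.1 i.2| / h + 1 :> R) /\
  penalized beta M (V *m U^T) - beta * h ^+ 2 * (n%:R * frob2 U) <=
  penalized beta M (gridmx h z *m U^T).
Proof.
move=> b0 h0; have [z [zb zq]] := round_right M^T V U b0 h0.
exists z; split=> //; move: zq.
have pt (A B : 'M[R]_n) : penalized beta A^T B^T = penalized beta A B.
  by rewrite /penalized ip_tr frob2_trmx.
by rewrite -pt trmxK -(pt _ (U *m (gridmx h z)^T)) trmxK !trmx_mul !trmxK.
Qed.

Lemma sum_abs_frob2 n r (U : 'M[R]_(n, r)) :
  \sum_(i : 'I_n * 'I_r) `|U i.1 i.2| <= Num.sqrt ((n * r)%:R * frob2 U).
Proof.
have h : (\sum_(i : 'I_n * 'I_r) `|U i.1 i.2|) ^+ 2 <= (n * r)%:R * frob2 U.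
  have := cauchy_schwarz_sum (fun=> 1) (fun i : 'I_n * 'I_r => `|U i.1 i.2|).
  under eq_bigr do rewrite mul1r.
  move=> /le_trans; apply; rewrite expr1n sumr_const card_prod !card_ord.
  rewrite ler_wpM2l ?ler0n// /frob2 pair_big /=; apply: ler_sum => i _.
  by rewrite real_normK ?num_real.
rewrite -[leLHS]ger0_norm ?sumr_ge0// -sqrtr_sqr; exact: ler_wsqrtr.
Qed.

Lemma grid_l1 h n r q (U : 'M[R]_(n, r)) (z : 'I_n * 'I_r -> int) : 0 < h ->
  (forall i, `|(z i)%:~R| <= `|U i.1 i.2| / h + 1 :> R) ->
  Num.sqrt ((n * r)%:R * frob2 U) / h <= (n * r * q)%:R ->
  (\sum_i `|z i|%N <= n * r * q.+1)%N.
Proof.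
move=> h0 zb hq; rewrite -(ler_nat R) natr_sum.
apply: (@le_trans _ _ (\sum_(i : 'I_n * 'I_r) (`|U i.1 i.2| / h + 1))).
  by apply: ler_sum => i _; apply: le_trans (zb i); rewrite natr_absz intr_norm.
rewrite big_split /= -mulr_suml sumr_const card_prod !card_ord mulnS addnC natrD lerD//.
apply: le_trans hq; rewrite ler_wpM2r ?invr_ge0 ?(ltW h0)//; exact: sum_abs_frob2.
Qed.

Lemma frob2_gridmx h n r (U : 'M[R]_(n, r)) (z : 'I_n * 'I_r -> int) : 0 < h ->
  (forall i, `|(z i)%:~R| <= `|U i.1 i.2| / h + 1 :> R) ->
  frob2 (gridmx h z) <= 2 * frob2 U + 2 * h ^+ 2 * (n * r)%:R.
Proof.
move=> h0 zb; rewrite /frob2 !pair_big /= mulr_sumr.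
have -> : 2 * h ^+ 2 * (n * r)%:R = \sum_(i : 'I_n * 'I_r) (2 * h ^+ 2).
  by rewrite sumr_const card_prod !card_ord mulr_natr.
rewrite -big_split /=; apply: ler_sum => -[a j] _ /=; rewrite mxE.
have H := ler_wpM2l (ltW h0) (zb (a, j)).
have {H} : `|h * (z (a, j))%:~R| <= `|U a j| + h.
  by rewrite normrM (gtr0_norm h0); apply: le_trans H _; rewrite /= mulrDr mulr1 mulrCA divff ?mulr1// gt_eqF.
rewrite -(real_normK (num_real (h * _))) -(real_normK (num_real (U a j))).
move: `|h * _| `|U a j| (normr_ge0 (h * (z (a, j))%:~R)) (normr_ge0 (U a j)) => x y x0 y0 xy.
have : x ^+ 2 <= (y + h) ^+ 2 by rewrite lerXn2r// nnegrE addr_ge0// ltW.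
by have := sqr_ge0 (y - h); rewrite !sqrrD; nra.
Qed.

Section Net.
Variables (n r q : nat).
Hypotheses (n0 : (0 < n)%N) (r0 : (0 < r)%N) (q0 : (0 < q)%N).
Let L := (n * r * q.+1)%N.
Let G := grid ('I_n * 'I_r)%type L.
(** The meshes match the squared norms, [r] for [U] and [1] for [V]: [hU^2 n = hV^2 n r = q^-2], so
    that rounding either factor costs [O(beta / q^2)], while both factors have [l^1] norm at most
    [L] in units of the mesh. *)
Let hU : R := (q%:R * Num.sqrt n%:R)^-1.
Let hV : R := (q%:R * Num.sqrt (n * r)%:R)^-1.

Definition net_point (w : G * G) : 'M[R]_n :=
  (\matrix_(i, j) (hV * gval R w.2 (i, j))) *m (\matrix_(i, j) (hU * gval R w.1 (i, j)))^T.

(** [U] is rounded first, at cost [beta / q^2]. The rounded [U] has squared norm at most [4 r], so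
    rounding [V] costs [4 beta / q^2]. The remaining [beta] is the penalty of the original
    product. *)
Lemma net_approx beta (M : 'M[R]_n) (U V : 'M[R]_(n, r)) : 0 <= beta ->
  frob2 U <= r%:R -> frob2 V <= 1 -> frob2 (V *m U^T) <= 1 ->
  exists2 w : G * G, (w.1 \in small_grid _ L) && (w.2 \in small_grid _ L) &
    ip M (V *m U^T) - beta * (1 + 5 / q%:R ^+ 2) <= penalized beta M (net_point w).
Proof.
move=> b0 U2 V2 B2.
have nR : 0 < n%:R :> R by rewrite ltr0n.
have rR : 0 < r%:R :> R by rewrite ltr0n.
have qR : 0 < q%:R :> R by rewrite ltr0n.
have nrR : 0 < (n * r)%:R :> R by rewrite ltr0n muln_gt0 n0.
have sn : 0 < Num.sqrt n%:R :> R by rewrite sqrtr_gt0.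
have snr : 0 < Num.sqrt (n * r)%:R :> R by rewrite sqrtr_gt0.
have hU0 : 0 < hU by rewrite invr_gt0 mulr_gt0.
have hV0 : 0 < hV by rewrite invr_gt0 mulr_gt0.
have nR' := ltW nR; have rR' := ltW rR; have qR' := ltW qR; have nrR' := ltW nrR.
have hU2 : hU ^+ 2 * n%:R = (q%:R ^+ 2)^-1.
  rewrite /hU -{2}[n%:R](sqr_sqrtr (ltW nR)); field.
  by rewrite !gt_eqF.
have hV2 : hV ^+ 2 * n%:R * r%:R = (q%:R ^+ 2)^-1.
  rewrite -mulrA -natrM /hV -{2}[(n * r)%:R](sqr_sqrtr (ltW nrR)); field.
  by rewrite !gt_eqF.
have q1 : (q%:R ^+ 2)^-1 <= 1 :> R.
  by rewrite invf_le1 ?exprn_gt0// -natrX ler1n expn_gt0 q0.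
have [zU [zUb zUq]] := round_right M U V b0 hU0.
have [zV [zVb zVq]] := round_left M (gridmx hU zU) V b0 hV0.
have U'2 : frob2 (gridmx hU zU) <= 4 * r%:R.
  apply: le_trans (frob2_gridmx hU0 zUb) _.
  have -> : 2 * hU ^+ 2 * (n * r)%:R = 2 * (q%:R ^+ 2)^-1 * r%:R.
    by rewrite natrM -hU2; ring.
  have := ler_wpM2r (ltW rR) q1; lra.
have lU : (\sum_i `|zU i|%N <= L)%N.
  apply: (grid_l1 hU0 zUb); rewrite /hU invrK.
  apply: (@le_trans _ _ (Num.sqrt ((n * r)%:R * r%:R) * (q%:R * Num.sqrt n%:R))).
    by rewrite ler_wpM2r ?mulr_ge0 ?sqrtr_ge0// ler_wsqrtr// ler_wpM2l// ltW.
  rewrite mulrCA -sqrtrM ?mulr_ge0//.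
  have -> : (n * r)%:R * r%:R * n%:R = ((n * r)%:R) ^+ 2 :> R by rewrite natrM; ring.
  by rewrite sqrtr_sqr ger0_norm// [leRHS]natrM mulrC.
have lV : (\sum_i `|zV i|%N <= L)%N.
  apply: (grid_l1 hV0 zVb); rewrite /hV invrK.
  apply: (@le_trans _ _ (Num.sqrt (n * r)%:R * (q%:R * Num.sqrt (n * r)%:R))).
    rewrite ler_wpM2r ?mulr_ge0 ?sqrtr_ge0// ler_wsqrtr//.
    by rewrite -[leRHS]mulr1 ler_wpM2l// ltW.
  by rewrite mulrCA -expr2 sqr_sqrtr// [leRHS]natrM mulrC.
have [wU wUs wUE] := gval_surj R lU; have [wV wVs wVE] := gval_surj R lV.
exists (wU, wV); rewrite /= ?wUs ?wVs//.
have -> : net_point (wU, wV) = gridmx hV zV *m (gridmx hU zU)^T.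
  by congr (_ *m _^T); apply/matrixP => i j; rewrite !mxE ?wUE ?wVE.
apply: le_trans zVq; set P1 := penalized beta M (V *m (gridmx hU zU)^T) in zUq *.
rewrite /penalized in zUq.
have e1 : beta * hU ^+ 2 * (n%:R * frob2 V) <= beta * (q%:R ^+ 2)^-1.
  by have := ler_wpM2l (mulr_ge0 b0 (mulr_ge0 (sqr_ge0 hU) nR')) V2; rewrite -hU2; lra.
have e2 : beta * hV ^+ 2 * (n%:R * frob2 (gridmx hU zU)) <= beta * (4 * (q%:R ^+ 2)^-1).
  by have := ler_wpM2l (mulr_ge0 b0 (mulr_ge0 (sqr_ge0 hV) nR')) U'2; rewrite -hV2; lra.
have e3 := ler_wpM2l b0 B2.
lra.
Qed.

(** The normalization is that of a truncated spectral decomposition: at most [r] unit vectors as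
    columns of [U], and the same vectors in [V] with weights whose squares sum to 1. *)
Definition low_rank_event p sigma : pred (graph n) := fun A =>
  `[< exists U V : 'M[R]_(n, r), [/\ frob2 U <= r%:R, frob2 V <= 1, frob2 (V *m U^T) <= 1 &
        sigma <= ip (cmx p A) (V *m U^T)] >].

(** Union bound over the net: the first term of the exponent is its entropy, the second the common
    tail bound for its points. *)
Lemma low_rank_deviation p sigma : 0 < p -> p <= 2^-1 -> 0 <= sigma ->
  bernP p (all_edges n) (low_rank_event p sigma) <=
  expR ((2 * (n * r * (q + 3)))%:R - kappa p * sigma ^+ 2 / (2 * (1 + 5 / q%:R ^+ 2))).
Proof.
move=> p0 p2 s0; have kp := kappa_gt0 p0 p2; have p01 : 0 <= p <= 1 by lra.
pose d : R := 1 + 5 / q%:R ^+ 2.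
have d0 : 0 < d by rewrite /d ltr_pwDl// divr_ge0// sqr_ge0.
(* The maximizer of [th * sigma - th^2 d / (2 kappa p)], with value [kappa p sigma^2 / (2 d)]. *)
pose th := kappa p * sigma / d; pose beta := th / (2 * kappa p).
have th0 : 0 <= th by rewrite /th divr_ge0 ?mulr_ge0// ltW.
have b0 : 0 <= beta by rewrite divr_ge0// mulr_ge0// ltW.
pose x := sigma - beta * d.
pose S := [set w : G * G | (w.1 \in small_grid _ L) && (w.2 \in small_grid _ L)].
have one w : bernP p (all_edges n) (fun A => x <= penalized beta (cmx p A) (net_point w))
    <= expR (- (th * x)).
  have := @bernP_markov R _ p (all_edges n)
     (fun A => x <= penalized beta (cmx p A) (net_point w))
     (fun A => th * penalized beta (cmx p A) (net_point w)) (th * x) p01.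
  move=> /(_ _)/wrap[|h]; first by move=> A _ hx; rewrite ler_wpM2l.
  have {h} : expR (th * x) * bernP p (all_edges n)
      (fun A => x <= penalized beta (cmx p A) (net_point w)) <= 1.
    apply: le_trans h _; rewrite /penalized.
    have -> : bern p (all_edges n) (fun A => expR (th * (ip (cmx p A) (net_point w) - beta * frob2 (net_point w))))
      = expR (- (th ^+ 2 * frob2 (net_point w) / (2 * kappa p))) *
        bern p (all_edges n) (fun A => expR (th * ip (cmx p A) (net_point w))).
      rewrite -bernZ; apply: bern_ext => A _; rewrite -expRD; congr expR.
      by rewrite /beta; field; rewrite gt_eqF.
    apply: le_trans (ler_wpM2l (expR_ge0 _) (ip_mgf _ _ p0 p2)) _.
    by rewrite -expRD addNr expR0.
  by rewrite expRN -ler_pdivlMl ?expR_gt0// mulr1.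
apply: (@le_trans _ _ (\sum_(w in S) expR (- (th * x)))).
  apply: (@le_trans _ _ (\sum_(w in S) bernP p (all_edges n)
      (fun A => x <= penalized beta (cmx p A) (net_point w)))); last exact: ler_sum.
  rewrite /bernP -bern_sum; apply: ler_bern => // A _.
  have nn : 0 <= \sum_(w in S) (x <= penalized beta (cmx p A) (net_point w))%R%:R :> R.
    by apply: sumr_ge0 => w _; rewrite ler0n.
  case: (boolP (low_rank_event p sigma A)) => // /asboolP[U [V [U2 V2 B2 sB]]].
  have [w wS wx] := net_approx (cmx p A) b0 U2 V2 B2.
  have wS' : w \in S by rewrite finset.in_set.
  rewrite (bigD1 w wS') /=.
  have -> : x <= penalized beta (cmx p A) (net_point w).
    by apply: le_trans wx; rewrite lerB.
  by rewrite lerDl; apply: sumr_ge0 => w' _; rewrite ler0n.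
rewrite sumr_const -[leLHS]mulr_natl.
have cS : #|S|%:R <= expR (2 * (n * r * (q + 3)))%:R :> R.
  have -> : #|S| = (#|small_grid ('I_n * 'I_r)%type L| * #|small_grid ('I_n * 'I_r)%type L|)%N.
    by rewrite -cardsX; apply: eq_card => -[a b]; rewrite !inE.
  have e2 : 2 <= expR 1 :> R by have := expR_ge1Dx (1 : R); lra.
  have h : #|small_grid ('I_n * 'I_r)%type L|%:R <= expR (n * r * (q + 3))%:R :> R.
    apply: le_trans (card_small_grid R _ L) _.
    have -> : 4 = 2 ^+ 2 :> R by ring.
    rewrite -exprM -exprD card_prod !card_ord.
    have -> : (L + 2 * (n * r) = n * r * (q + 3))%N by rewrite /L; lia.
    rewrite -[X in _ <= expR X]mulr1 expRM_natl; by apply: lerXn2r => //; rewrite nnegrE ?expR_ge0.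
  rewrite mul2n -addnn natrD expRD natrM; apply: ler_pM => //; exact: ler0n.
apply: le_trans (ler_wpM2r (expR_ge0 _) cS) _.
rewrite -expRD ler_expR lerD2l lerN2; apply: eq_ler.
rewrite -/d /x /beta /th; field.
by rewrite !gt_eqF.
Qed.

End Net.
End LowRank.

(** * Concentration of convex functions *)

Section TwoPointInequality.
Variable R : realType.
Implicit Types (a c P Q U V : R).

(** The two bounds on [c] are the values of [a (1 - z) + z^2 / 8] at its minimizer [z = 4 a],
    admissible if [a <= 1/4], and at [z = 1]. *)
Lemma expR_add_le2 a c : 0 <= a ->
  c <= a - 2 * a ^+ 2 \/ (2^-1 / 2 <= a /\ c <= 8^-1) -> expR c + expR (- a) <= 2.
Proof.
move=> a0 h.
have up (w : R) : w <= 2^-1 -> expR w <= (1 - w)^-1.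
  move=> w1; have W : 0 < 1 - w by lra.
  rewrite -[leRHS]mul1r ler_pdivlMr//.
  have := ler_wpM2l (expR_ge0 w) (expR_ge1Dx (- w)).
  by rewrite -expRD subrr expR0.
have dn : expR (- a) <= (1 + a)^-1.
  by rewrite expRN lef_pV2 ?posrE ?expR_gt0 ?expR_ge1Dx//; lra.
have [aq|aq] := leP a (2^-1 / 2).
  have ca : c <= a - 2 * a ^+ 2.
    case: h => // -[a1 c1]; have -> : a = 2^-1 / 2 by lra.
    by apply: le_trans c1 _; lra.
  have up' : expR c <= (1 - (a - 2 * a ^+ 2))^-1.
    apply: le_trans (up _ _); first by rewrite ler_expR.
    by have := sqr_ge0 a; lra.
  have : (1 - (a - 2 * a ^+ 2))^-1 + (1 + a)^-1 <= 2.
    have P1 : 0 < 1 - (a - 2 * a ^+ 2) by have := sqr_ge0 a; lra.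
    have P2 : 0 < 1 + a by lra.
    have P := mulr_gt0 P1 P2.
    rewrite -(ler_pM2r P).
    have -> : ((1 - (a - 2 * a ^+ 2))^-1 + (1 + a)^-1) * ((1 - (a - 2 * a ^+ 2)) * (1 + a))
      = 2 + 2 * a ^+ 2 by field; rewrite !gt_eqF.
    have := exprn_ge0 3 a0; have := sqr_ge0 a; nra.
  lra.
have c8 : c <= 8^-1.
  case: h => [h|[]//]; apply: le_trans h _.
  have -> : 8^-1 = a - 2 * a ^+ 2 + 2 * (a - 2^-1 / 2) ^+ 2 by field.
  by rewrite lerDl mulr_ge0 ?sqr_ge0.
have c9 : expR c <= 8 / 7.
  apply: (@le_trans _ _ (expR 8^-1)); first by rewrite ler_expR.
  have -> : 8 / 7 = (1 - 8^-1)^-1 :> R by field.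
  by apply: up; lra.
have : (1 + a)^-1 <= 4 / 5.
  have -> : 4 / 5 = (5 / 4)^-1 :> R by field.
  by rewrite lef_pV2 ?posrE; lra.
lra.
Qed.

Lemma two_point_aux P Q a c : 0 <= P -> 0 <= Q -> P + Q = 1 -> 0 <= a ->
   c <= a - 2 * a ^+ 2 \/ (2^-1 / 2 <= a /\ c <= 8^-1) ->
   (P * expR c + Q) * (P * expR (- a) + Q) <= 1.
Proof.
move=> P0 Q0 PQ a0 h; have sm := expR_add_le2 a0 h.
have ca : expR c * expR (- a) <= 1.
  rewrite -expRD -[leRHS]expR0 ler_expR.
  by case: h => [h|[]]; [have := sqr_ge0 a|]; lra.
have -> : (P * expR c + Q) * (P * expR (- a) + Q) =
  P ^+ 2 * (expR c * expR (- a)) + P * Q * (expR c + expR (- a)) + Q ^+ 2 by ring.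
have := ler_wpM2l (sqr_ge0 P) ca; have := ler_wpM2l (mulr_ge0 P0 Q0) sm.
have : (P + Q) ^+ 2 = 1 by rewrite PQ expr1n.
by rewrite sqrrD; lra.
Qed.

(** Property (tau) for one coordinate: [U] and [V] are the values of a convex function at the two
    ends of the unit interval, and the chord between them bounds its infimal convolution with
    [z^2 / 8]. At the lower end the convolution is bounded by [V] itself. *)
Lemma two_point_inequality P Q U V (iU iV : R) : 0 <= P -> 0 <= Q -> P + Q = 1 -> V <= U ->
  iV <= V -> (forall z, 0 <= z <= 1 -> iU <= (1 - z) * U + z * V + z ^+ 2 / 8) ->
  (P * expR iU + Q * expR iV) * (P * expR (- U) + Q * expR (- V)) <= 1.
Proof.
move=> P0 Q0 PQ VU hV hU; pose a := U - V.
have a0 : 0 <= a by rewrite subr_ge0.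
have hc : iU - V <= a - 2 * a ^+ 2 \/ (2^-1 / 2 <= a /\ iU - V <= 8^-1).
  have [aq|aq] := leP a (2^-1 / 2).
    left; have := hU (4 * a); rewrite /a => /(_ ltac:(rewrite -/a; lra)); lra.
  by right; split; [exact: ltW|have := hU 1 ltac:(lra); lra].
apply: le_trans (two_point_aux P0 Q0 PQ a0 hc).
have -> : P * expR (- U) + Q * expR (- V) = expR (- V) * (P * expR (- a) + Q).
  have -> : expR (- U) = expR (- V) * expR (- a) by rewrite -expRD /a; congr expR; ring.
  ring.
rewrite mulrA ler_wpM2r ?addr_ge0 ?mulr_ge0 ?expR_ge0//.
have -> : expR (iU - V) = expR iU * expR (- V) by rewrite expRD.
have -> : (P * expR iU + Q * expR iV) * expR (- V) =
    P * (expR iU * expR (- V)) + Q * expR (iV - V) by rewrite expRD; ring.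
rewrite lerD2l -[leRHS]mulr1 ler_wpM2l// -[leRHS]expR0 ler_expR; lra.
Qed.

End TwoPointInequality.

(** * Property (tau) on the cube and its consequence for convex Lipschitz functions *)

Section PropertyTau.
Variables (R : realType) (I : finType).
Implicit Types (f g : (I -> R) -> R) (x y : I -> R) (p : R).

Definition comb (s : R) x y : I -> R := fun i => s * x i + (1 - s) * y i.

Definition convex_fun f := forall s x y, 0 <= s <= 1 ->
  f (comb s x y) <= s * f x + (1 - s) * f y.

Definition upd x (e : I) (v : R) : I -> R := fun i => if i == e then v else x i.

(* The infimum is over all real [z], not only over the two values of the coordinate [e]: *)
(* this is what makes [inf_conv] convex and the tensorization of property (tau) work. *)
Definition inf_conv f e (b : R) x : R :=
  inf [set v | exists z, v = f (upd x e z) + (b - z) ^+ 2 / 8]%classic.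

Lemma comb_upd s x y e u v : comb s (upd x e u) (upd y e v) = upd (comb s x y) e (s * u + (1 - s) * v).
Proof. by apply/funext => i; rewrite /comb /upd; case: eqP. Qed.

Section InfConv.
Variables (f : (I -> R) -> R) (e : I) (b : R).
Hypotheses (f0 : forall x, 0 <= f x).

Let S x := [set v | exists z, v = f (upd x e z) + (b - z) ^+ 2 / 8]%classic.

Lemma inf_conv_lbound x : has_inf (S x).
Proof.
split; first by exists (f (upd x e 0) + (b - 0) ^+ 2 / 8), 0.
exists 0 => _ [z ->]; by rewrite addr_ge0// divr_ge0// sqr_ge0.
Qed.

Lemma inf_conv_le x z : inf_conv f e b x <= f (upd x e z) + (b - z) ^+ 2 / 8.
Proof. by apply: ge_inf; [case: (inf_conv_lbound x) | exists z]. Qed.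

Lemma le_inf_conv x c : (forall z, c <= f (upd x e z) + (b - z) ^+ 2 / 8) ->
  c <= inf_conv f e b x.
Proof.
move=> h; apply: lb_le_inf; first by case: (inf_conv_lbound x).
by move=> _ [z ->].
Qed.

Lemma inf_conv_ge0 x : 0 <= inf_conv f e b x.
Proof. by apply: le_inf_conv => z; rewrite addr_ge0// divr_ge0// sqr_ge0. Qed.

Lemma inf_conv_approx x d : 0 < d ->
  exists z, f (upd x e z) + (b - z) ^+ 2 / 8 < inf_conv f e b x + d.
Proof.
by move=> d0; have [_ [z ->] h] := inf_adherent d0 (inf_conv_lbound x); exists z.
Qed.

Lemma inf_conv_convex : convex_fun f -> convex_fun (inf_conv f e b).
Proof.
move=> cf s x y s01; apply/ler_addgt0Pr => d d0.
have [z hz] := inf_conv_approx x d0; have [w hw] := inf_conv_approx y d0.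
apply: le_trans (inf_conv_le _ (s * z + (1 - s) * w)) _.
rewrite -comb_upd; have := cf s (upd x e z) (upd y e w) s01.
case/andP: s01 => s0 s1; have s1' : 0 <= 1 - s by rewrite subr_ge0.
have := ler_wpM2l s0 (ltW hz); have := ler_wpM2l s1' (ltW hw).
have := mulr_ge0 (mulr_ge0 s0 s1') (sqr_ge0 (z - w)); nra.
Qed.

End InfConv.

Lemma expR_convex (s u v : R) : 0 <= s <= 1 ->
  expR (s * u + (1 - s) * v) <= s * expR u + (1 - s) * expR v.
Proof.
move=> /andP[s0 s1]; set w := s * u + (1 - s) * v.
have h (y : R) : expR w * (1 + (y - w)) <= expR y.
  have -> : expR y = expR w * expR (y - w) by rewrite -expRD; congr expR; ring.
  by rewrite ler_wpM2l ?expR_ge0// expR_ge1Dx.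
have := ler_wpM2l s0 (h u); have s1' : 0 <= 1 - s by rewrite subr_ge0.
have := ler_wpM2l s1' (h v); rewrite /w; move: (expR _) => E; lra.
Qed.

Definition mix p (u v : R) : R := p * u + (1 - p) * v.

Lemma mix_gt0 p (u v : R) : 0 <= p <= 1 -> 0 < mix p (expR u) (expR v).
Proof.
move=> /andP[p0 p1]; have [->|pn] := eqVneq p 0.
  by rewrite /mix mul0r subr0 mul1r add0r expR_gt0.
by rewrite /mix ltr_pwDl ?mulr_gt0 ?expR_gt0 ?lt_neqAle 1?eq_sym ?pn// mulr_ge0 ?expR_ge0// subr_ge0.
Qed.

(** Hoelder's inequality: after division by [expR X] and [expR Y] it reduces to the convexity of the
    exponential. *)
Lemma ln_mix_convex p (a a' b b' s : R) : 0 <= p <= 1 -> 0 <= s <= 1 ->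
  ln (mix p (expR (s * a + (1 - s) * a')) (expR (s * b + (1 - s) * b'))) <=
  s * ln (mix p (expR a) (expR b)) + (1 - s) * ln (mix p (expR a') (expR b')).
Proof.
move=> p01 s01; have mix_gt0 u v := mix_gt0 u v p01.
set X := ln (mix p (expR a) _); set Y := ln (mix p (expR a') _).
rewrite -ler_expR lnK ?posrE//.
have EX : expR X = mix p (expR a) (expR b) by rewrite lnK ?posrE.
have EY : expR Y = mix p (expR a') (expR b') by rewrite lnK ?posrE.
have sh u u' : expR (s * u + (1 - s) * u') <=
    expR (s * X + (1 - s) * Y) * (s * (expR u / expR X) + (1 - s) * (expR u' / expR Y)).
  have -> : expR (s * u + (1 - s) * u') =
     expR (s * X + (1 - s) * Y) * expR (s * (u - X) + (1 - s) * (u' - Y)).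
    by rewrite -expRD; congr expR; ring.
  by rewrite ler_wpM2l ?expR_ge0// -!expRB expR_convex.
clearbody X Y; case/andP: p01 => p0 p1; have p1' : 0 <= 1 - p by rewrite subr_ge0.
have := lerD (ler_wpM2l p0 (sh a a')) (ler_wpM2l p1' (sh b b')).
rewrite -/(mix _ _ _) => /le_trans; apply.
have X0 : expR X != 0 by rewrite gt_eqF ?expR_gt0.
have Y0 : expR Y != 0 by rewrite gt_eqF ?expR_gt0.
move: (expR (s * X + _)) => Z; apply: eq_ler.
transitivity (Z * (s * (mix p (expR a) (expR b) / expR X) +
   (1 - s) * (mix p (expR a') (expR b') / expR Y))).
  rewrite /mix; move: (expR X) (expR Y) (expR a) (expR b) (expR a') (expR b') X0 Y0.
  by move=> x y u v u' v' x0 y0; field; rewrite x0 y0.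
by rewrite -EX -EY !divff// !mulr1 addrC subrK mulr1.
Qed.

Definition log_mix p f e x : R :=
  ln (mix p (expR (inf_conv f e 1 x)) (expR (inf_conv f e 0 x))).

Section LogMix.
Variables (p : R) (f : (I -> R) -> R) (e : I).
Hypotheses (p01 : 0 <= p <= 1) (f0 : forall x, 0 <= f x) (cf : convex_fun f).

Let p0 : 0 <= p. Proof. by case/andP: p01. Qed.
Let p1 : 0 <= 1 - p. Proof. by case/andP: p01; rewrite subr_ge0. Qed.

Lemma log_mix_ge1 x : 1 <= mix p (expR (inf_conv f e 1 x)) (expR (inf_conv f e 0 x)).
Proof.
have h b : 1 <= expR (inf_conv f e b x).
  by rewrite -[leLHS]expR0 ler_expR inf_conv_ge0.
by have := ler_wpM2l p0 (h 1); have := ler_wpM2l p1 (h 0); rewrite /mix; lra.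
Qed.

Lemma log_mix_ge0 x : 0 <= log_mix p f e x.
Proof. by rewrite ln_ge0// log_mix_ge1. Qed.

Lemma expR_log_mix x :
  expR (log_mix p f e x) = mix p (expR (inf_conv f e 1 x)) (expR (inf_conv f e 0 x)).
Proof. by rewrite lnK// posrE (lt_le_trans ltr01)// log_mix_ge1. Qed.

Lemma log_mix_convex : convex_fun (log_mix p f e).
Proof.
move=> s x y s01; apply: le_trans (ln_mix_convex _ _ _ _ p01 s01).
rewrite ler_ln ?posrE ?mix_gt0//.
case/andP: (s01) => s0 s1; have s1' : 0 <= 1 - s by rewrite subr_ge0.
by apply: lerD; apply: ler_wpM2l => //; rewrite ler_expR; exact: inf_conv_convex.
Qed.

(** Convexity along coordinate [e] places [f] below its chord, which is what [two_point_inequality]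
    asks for. *)
Lemma two_point x :
  expR (log_mix p f e x) * mix p (expR (- f (upd x e 1))) (expR (- f (upd x e 0))) <= 1.
Proof.
rewrite expR_log_mix.
have chord z : 0 <= z <= 1 -> f (upd x e z) <= z * f (upd x e 1) + (1 - z) * f (upd x e 0).
  move=> z01; have := cf (upd x e 1) (upd x e 0) z01.
  by rewrite comb_upd mulr1 mulr0 addr0; congr (f (upd _ _ _) <= _); apply/funext => i; rewrite /comb; ring.
set u := f (upd x e 1) in chord *; set v := f (upd x e 0) in chord *.
have q1 := inf_conv_le e 1 f0 x; have q0 := inf_conv_le e 0 f0 x.
have [vu|/ltW uv] := leP v u.
  apply: two_point_inequality; rewrite ?p0 ?p1//; first by ring.
    by have := q0 0; rewrite subr0 expr0n mul0r addr0.
  move=> z z01; apply: le_trans (q1 (1 - z)) _.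
  have := chord (1 - z) ltac:(lra); nra.
(* The value at [0] is now the larger one, so the two ends exchange their roles. *)
rewrite /mix [X in X * _]addrC [X in _ * X]addrC.
apply: two_point_inequality; rewrite ?p0 ?p1//; first by ring.
  by have := q1 1; rewrite subrr expr0n mul0r addr0.
move=> z z01; apply: le_trans (q0 z) _.
have := chord z ltac:(lra); nra.
Qed.

End LogMix.

(** Coordinates outside [E] stay frozen at [x], so that the induction on [E] can treat them as
    parameters. *)
Definition setx x (E G : {set I}) : I -> R := fun i => if i \in E then (i \in G)%:R else x i.

Lemma bern_setx p (E : {set I}) e x0 (phi : (I -> R) -> R) : e \notin E ->
  bern p (e |: E)%SET (fun G => phi (setx x0 (e |: E)%SET G)) =
  bern p E (fun G => mix p (phi (upd (setx x0 E G) e 1)) (phi (upd (setx x0 E G) e 0))).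
Proof.
move=> eE; rewrite bernU1// -!bernZ -bernD; apply: bern_ext => G sG.
have eG : e \notin G by apply: contra eE; exact: fintype.subsetP.
rewrite /mix; congr (_ * phi _ + _ * phi _); apply/funext => i; rewrite /setx /upd !inE;
  by case: eqP => //= ->; rewrite (negbTE eG).
Qed.

(* Induction on the coordinates: integrating out the coordinate [e] replaces [f] by *)
(* [log_mix p f e], which is again convex and nonnegative. *)
Lemma property_tau p (E : {set I}) f g x0 : 0 <= p <= 1 -> (forall x, 0 <= f x) -> convex_fun f ->
  (forall x y, (forall i, i \notin E -> x i = y i) ->
     g x <= f y + (\sum_(i in E) (x i - y i) ^+ 2) / 8) ->
  bern p E (fun G => expR (g (setx x0 E G))) * bern p E (fun G => expR (- f (setx x0 E G))) <= 1.
Proof.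
move=> p01; elim/set_ind: E f g => [|e E eE IH] f g f0 cf fg.
  rewrite !bern0 -expRD -[leRHS]expR0 ler_expR subr_le0.
  by apply: le_trans (fg _ (setx x0 finset.set0 finset.set0) _) _ => //; rewrite big_set0 mul0r addr0.
rewrite (bern_setx _ _ (fun x => expR (g x)))// (bern_setx _ _ (fun x => expR (- f x)))//.
pose g' x := ln (mix p (expR (g (upd x e 1))) (expR (g (upd x e 0)))).
have g'E x : mix p (expR (g (upd x e 1))) (expR (g (upd x e 0))) = expR (g' x).
  by rewrite lnK// posrE mix_gt0.
under [X in X * _]bern_ext do rewrite g'E.
have {}IH := IH (log_mix p f e) g' (log_mix_ge0 e p01 f0) (log_mix_convex e p01 f0 cf).
have : bern p E (fun G => expR (g' (setx x0 E G))) *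
   bern p E (fun G => expR (- log_mix p f e (setx x0 E G))) <= 1.
  apply: IH => x y xy; set D := _ / 8.
  rewrite -ler_expR -g'E expRD (expR_log_mix e p01 f0).
  have gb b : expR (g (upd x e b)) <= expR (inf_conv f e b y) * expR D.
    rewrite -expRD ler_expR -lerBlDr; apply: (le_inf_conv f0) => z.
    rewrite lerBlDr; apply: le_trans (fg _ (upd y e z) _) _.
      move=> i; rewrite !inE negb_or /upd => /andP[/negbTE -> /xy].
      by [].
    rewrite big_setU1//= mulrDl addrA lerD ?lexx//.
      by rewrite /upd eqxx.
    rewrite /D ler_wpM2r ?invr_ge0//; apply: eq_ler.
    apply: eq_bigr => i iE; rewrite /upd; case: eqP => // ie.
    by rewrite -ie iE in eE.
  case/andP: p01 => p0 p1; have p1' : 0 <= 1 - p by rewrite subr_ge0.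
  by rewrite /mix [leRHS]mulrDl -!mulrA; apply: lerD; apply: ler_wpM2l.
apply: le_trans; apply: ler_wpM2l.
  by apply: bern_ge0 => // G _; exact: expR_ge0.
apply: ler_bern => // G _; have := two_point e p01 f0 cf (setx x0 E G).
move: (mix _ _ _) => X h; by rewrite expRN -[leRHS]mulr1 ler_pdivlMl ?expR_gt0.
Qed.

(** [property_tau] for [eta f] and [eta f - 2 (eta L)^2]: its hypothesis is
    [eta L s <= 2 (eta L)^2 + s^2 / 8], an instance of the inequality of means. *)
Lemma convex_concentration p (E : {set I}) f (L eta : R) x0 : 0 <= p <= 1 ->
  (forall x, 0 <= f x) -> convex_fun f -> 0 <= eta ->
  (forall x y, (forall i, i \notin E -> x i = y i) ->
     f x <= f y + L * Num.sqrt (\sum_(i in E) (x i - y i) ^+ 2)) ->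
  bern p E (fun G => expR (eta * f (setx x0 E G))) *
  bern p E (fun G => expR (- (eta * f (setx x0 E G)))) <= expR (2 * (eta * L) ^+ 2).
Proof.
move=> p01 f0 cf eta0 fL.
have := @property_tau p E (fun x => eta * f x) (fun x => eta * f x - 2 * (eta * L) ^+ 2) x0 p01.
move=> /(_ _ _ _)/wrap[].
- by move=> x; rewrite mulr_ge0.
- by move=> s x y s01; have := ler_wpM2l eta0 (cf s x y s01); lra.
- move=> x y xy; set S := \sum_(i in E) _.
  have S0 : 0 <= S by apply: sumr_ge0 => i _; exact: sqr_ge0.
  have := ler_wpM2l eta0 (fL x y xy); rewrite -/S -{2}(sqr_sqrtr S0).
  have := sqr_ge0 (eta * L - Num.sqrt S / 4); rewrite sqrrB; lra.
move=> h; have E1 : bern p E (fun G => expR (eta * f (setx x0 E G) - 2 * (eta * L) ^+ 2)) =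
   expR (- (2 * (eta * L) ^+ 2)) * bern p E (fun G => expR (eta * f (setx x0 E G))).
  by rewrite -bernZ; apply: bern_ext => G _; rewrite -expRD addrC.
by move: h; rewrite E1 -mulrA expRN ler_pdivrMl ?expR_gt0// mulr1.
Qed.

End PropertyTau.

(** * Large deviations of the eigenvalues *)

Section CubicStatistic.
Variable R : realType.
Implicit Types (n : nat) (p T s eta : R).

(** The sum of the cubes of the eigenvalues is neither convex nor Lipschitz with a usable constant.
    Its truncated positive and negative parts are both, and their difference replaces it. *)
Definition cube_pos T n (G : graph n) : R := trf (tcube T) (adjmx R G).
Definition cube_neg T n (G : graph n) : R := trf (fun x => tcube T (- x)) (adjmx R G).

Lemma symx_comb n s (x y : {set 'I_n} -> R) :
  symx (comb s x y) = s *: symx x + (1 - s) *: symx y.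
Proof. by apply/matrixP => i j; rewrite !mxE; case: eqP => // _; rewrite !mulr0 addr0. Qed.

Lemma symx_sub n (x y : {set 'I_n} -> R) : symx x - symx y = symx (fun e => x e - y e).
Proof. by apply/matrixP => i j; rewrite !mxE; case: eqP => // _; rewrite subr0. Qed.

Lemma symx_setx n (G : graph n) : G \subset all_edges n ->
  symx (setx (fun=> 0) (all_edges n) G) = adjmx R G.
Proof.
move=> sG; rewrite adjmx_symx//; apply/matrixP => i j; rewrite !mxE.
case: eqP => // /eqP ij; rewrite /setx; case: ifPn => //.
by move/negP; case; apply/edgeP; exists i, j.
Qed.

(** The Lipschitz constant in the edge variables is [3 T^2 sqrt (2 n)]: [sqrt n] from
    [trf_lipschitz], [sqrt 2] because an edge fills two entries. *)
Lemma trf_concentration n p T eta f : 0 <= p <= 1 -> 0 <= T -> 0 <= eta ->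
  has_supporting_lines f -> (forall x, 0 <= f x) ->
  (forall x y, f x <= f y + 3 * T ^+ 2 * `|x - y|) ->
  bern p (all_edges n) (fun G => expR (eta * trf f (adjmx R G))) *
  bern p (all_edges n) (fun G => expR (- (eta * trf f (adjmx R G)))) <=
  expR (36 * eta ^+ 2 * T ^+ 4 * n%:R).
Proof.
move=> p01 T0 eta0 sf f0 fL.
pose F (x : {set 'I_n} -> R) := trf f (symx x).
have := @convex_concentration R _ p (all_edges n) F (3 * T ^+ 2 * Num.sqrt (2 * n%:R)) eta
  (fun=> 0) p01.
move=> /(_ _ _ eta0 _)/wrap[].
- by move=> x; apply: sumr_ge0.
- move=> s x y s01; rewrite /F symx_comb; apply: trf_convex => //; exact: symx_sym.
- move=> x y _; apply: le_trans (trf_lipschitz _ _ fL (symx_sym x) (symx_sym y)) _ => //.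
    by rewrite mulr_ge0// sqr_ge0.
  rewrite lerD2l -!mulrA; do 2! (rewrite ler_wpM2l ?sqr_ge0//).
  by rewrite -sqrtrM ?mulr_ge0// symx_sub frob2_symx mulrCA !mulrA.
have -> : 2 * (eta * (3 * T ^+ 2 * Num.sqrt (2 * n%:R))) ^+ 2 = 36 * eta ^+ 2 * T ^+ 4 * n%:R.
  by rewrite !exprMn sqr_sqrtr ?mulr_ge0//; ring.
have FE (G : graph n) : G \subset all_edges n -> F (setx (fun=> 0) (all_edges n) G) = trf f (adjmx R G).
  by move=> sG; rewrite /F symx_setx.
clearbody F => h.
have e1 := @bern_ext R _ p (all_edges n) (fun G => expR (eta * F (setx (fun=> 0) (all_edges n) G)))
  (fun G => expR (eta * trf f (adjmx R G))) (fun G sG => congr1 (fun y => expR (eta * y)) (FE G sG)).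
have e2 := @bern_ext R _ p (all_edges n) (fun G => expR (- (eta * F (setx (fun=> 0) (all_edges n) G))))
  (fun G => expR (- (eta * trf f (adjmx R G)))) (fun G sG => congr1 (fun y => expR (- (eta * y))) (FE G sG)).
by rewrite -e1 -e2.
Qed.

Lemma expR_add_le (a b : R) : expR (a + b) <= (expR (2 * a) + expR (2 * b)) / 2.
Proof.
have e2 x : expR (2 * x) = expR x ^+ 2 :> R by rewrite expRM_natl.
by rewrite expRD !e2; have := sqr_ge0 (expR a - expR b); rewrite sqrrB; lra.
Qed.

Lemma bern_mul2 n p (phi psi : graph n -> R) :
  bern p (all_edges n) phi * bern p (all_edges n) psi =
  bern p (all_edges n) (fun G => bern p (all_edges n) (fun G' => phi G * psi G')).
Proof.
rewrite mulrC -bernZ; apply: bern_ext => G _; by rewrite mulrC -bernZ.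
Qed.

(** Two independent graphs replace the comparison with a mean. If the statistic is low for one and
    not for the other, the total change of the two convex parts is at least [s]; [expR_add_le]
    separates the parts at the price of doubling [eta], and [trf_concentration] bounds each. *)
Lemma cube_diff_two_copies n p T s eta : 0 <= p <= 1 -> 0 <= T -> 0 <= eta ->
  bernP p (all_edges n) (fun G => cube_pos T G - cube_neg T G <= - (2 * s)) *
  bernP p (all_edges n) (fun G => - s <= cube_pos T G - cube_neg T G) <=
  expR (144 * eta ^+ 2 * T ^+ 4 * n%:R - eta * s).
Proof.
move=> p01 T0 eta0.
have eta20 : 0 <= 2 * eta by rewrite mulr_ge0.
have Lm x y : tcube T (- x) <= tcube T (- y) + 3 * T ^+ 2 * `|x - y|.
  by apply: le_trans (tcube_lip (- x) (- y) T0) _; rewrite (_ : - x - - y = - (x - y)) ?normrN//; ring.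
have cp := trf_concentration n p01 T0 eta20 (tcube_supporting T0)
  (fun x => tcube_ge0 x T0) (fun x y => tcube_lip x y T0).
have cn := trf_concentration n p01 T0 eta20 (supporting_lines_opp (tcube_supporting T0))
  (fun x => tcube_ge0 (- x) T0) Lm.
have -> : 144 * eta ^+ 2 * T ^+ 4 * n%:R = 36 * (2 * eta) ^+ 2 * T ^+ 4 * n%:R by ring.
set B := expR (36 * _ * _ * _) in cp cn *.
rewrite mulrC in cp; rewrite !bern_mul2 in cp cn.
rewrite expRB ler_pdivlMr ?expR_gt0// /B -/B.
set u := bern _ _ _ in cp; set v := bern _ _ _ in cn.
apply: (@le_trans _ _ (2^-1 * (u + v))); last by lra.
have -> : 2^-1 * (u + v) = bern p (all_edges n) (fun G => 2^-1 * (
    bern p (all_edges n) (fun G' : graph n => expR (- (2 * eta * trf (tcube T) (adjmx R G))) *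
          expR (2 * eta * trf (tcube T) (adjmx R G'))) +
    bern p (all_edges n) (fun G' : graph n => expR (2 * eta * trf (fun x : R => tcube T (- x)) (adjmx R G)) *
          expR (- (2 * eta * trf (fun x : R => tcube T (- x)) (adjmx R G')))))).
  by rewrite bernZ bernD.
rewrite /bernP bern_mul2 mulrC -bernZ.
apply: ler_bern => // G _; rewrite -bernD -!bernZ; apply: ler_bern => // G' _.
rewrite -!expRD.
case: (boolP (_ <= - (2 * s))) => [h1|_]; last first.
  by rewrite mul0r mulr0 mulr_ge0 ?invr_ge0// addr_ge0 ?expR_ge0.
case: (boolP (- s <= _)) => [h2|_]; last first.
  by rewrite !mulr0 mulr_ge0 ?invr_ge0// addr_ge0 ?expR_ge0.
rewrite !mulr1.
have := expR_add_le (eta * (cube_pos T G' - cube_pos T G)) (eta * (cube_neg T G - cube_neg T G')).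
have : expR (eta * s) <= expR (eta * (cube_pos T G' - cube_pos T G) + eta * (cube_neg T G - cube_neg T G')).
  by rewrite ler_expR -mulrDr ler_wpM2l//; lra.
have -> : 2 * (eta * (cube_pos T G' - cube_pos T G)) =
   - (2 * eta * trf (tcube T) (adjmx R G)) + 2 * eta * trf (tcube T) (adjmx R G').
  by rewrite /cube_pos; ring.
have -> : 2 * (eta * (cube_neg T G - cube_neg T G')) =
   2 * eta * trf (fun x => tcube T (- x)) (adjmx R G) + - (2 * eta * trf (fun x => tcube T (- x)) (adjmx R G')).
  by rewrite /cube_neg; ring.
lra.
Qed.

Definition all_ones n : 'M[R]_n := const_mx 1.

Lemma adjmx_cmx n p (G : graph n) : G \subset all_edges n ->
  adjmx R G = cmx p G - p%:M + p *: all_ones n.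
Proof.
move=> sG; rewrite adjmx_symx//; apply/matrixP => i j; rewrite !mxE mulr1.
by case: eqP => _ /=; rewrite ?mulr1n ?mulr0n; ring.
Qed.

Lemma quad_all_ones n (W : 'M[R]_n) i : (W *m all_ones n *m W^T) i i = (\sum_j W i j) ^+ 2.
Proof.
rewrite mxE expr2 mulr_sumr; apply: eq_bigr => j _; rewrite [X in _ * X]mxE; congr (_ * _).
by rewrite mxE; apply: eq_bigr => l _; rewrite mxE mulr1.
Qed.

Lemma trf_decr f n (X Y : 'M[R]_n) : has_supporting_lines f ->
  {homo f : x y / x <= y >-> y <= x} -> X^T = X -> Y^T = Y ->
  (forall (W : 'M[R]_n) i, W *m W^T = 1%:M -> (W *m X *m W^T) i i <= (W *m Y *m W^T) i i) ->
  trf f Y <= trf f X.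
Proof.
move=> sf fd sX sY h; rewrite -[leRHS]addr0; apply: trf_le => // W WW.
by rewrite addr0; apply: ler_sum => i _; apply/fd/h.
Qed.

Lemma cmx_sym n p (G : graph n) : (cmx p G)^T = cmx p G.
Proof. exact: symx_sym. Qed.

Lemma cmx_shift_sym n p (G : graph n) : (cmx p G - p%:M)^T = cmx p G - p%:M.
Proof. by rewrite linearB /= cmx_sym tr_scalar_mx. Qed.

Lemma quad_shift_le n p (G : graph n) (W : 'M[R]_n) i : 0 <= p -> G \subset all_edges n ->
  (W *m (cmx p G - p%:M) *m W^T) i i <= (W *m adjmx R G *m W^T) i i.
Proof.
move=> p0 sG; rewrite (adjmx_cmx p sG) (mulmxDr W (_ - _)) mulmxDl.
rewrite -scalemxAr -scalemxAl [leRHS]mxE lerDl [leRHS]mxE quad_all_ones.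
by rewrite mulr_ge0// sqr_ge0.
Qed.

(** The adjacency matrix exceeds [cmx p G - p%:M] by [p] times the positive semidefinite all-ones
    matrix, and [tcube] is monotone. *)
Lemma cube_diff_mono n p T (G : graph n) : 0 <= p -> 0 <= T -> G \subset all_edges n ->
  trf (tcube T) (cmx p G - p%:M) - trf (fun x => tcube T (- x)) (cmx p G - p%:M) <=
  cube_pos T G - cube_neg T G.
Proof.
move=> p0 T0 sG; apply: lerB.
  apply: (trf_mono (tcube_supporting T0) (tcube_homo T0)).
  - exact: cmx_shift_sym.
  - exact: adjmx_sym.
  - by move=> W i _; exact: quad_shift_le.
apply: (trf_decr (supporting_lines_opp (tcube_supporting T0))).
- by move=> x y xy; apply: tcube_homo => //; rewrite lerN2.
- exact: cmx_shift_sym.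
- exact: adjmx_sym.
- by move=> W i _; exact: quad_shift_le.
Qed.

Lemma cube_diff_ge_trace n p T (G : graph n) (P : 'M[R]_n) d : 0 <= T ->
  spectral_decomp (cmx p G - p%:M) P d -> (forall i, d i <= T) ->
  \tr ((cmx p G - p%:M) ^+ 3) <=
  trf (tcube T) (cmx p G - p%:M) - trf (fun x => tcube T (- x)) (cmx p G - p%:M).
Proof.
move=> T0 D dT; rewrite (trace_exp 3 D) !(trfE _ D) -sumrB.
by apply: ler_sum => i _; exact: tcube_ge_cube.
Qed.

Lemma trace_cube n (C : 'M[R]_n) :
  \tr (C ^+ 3) = \sum_i \sum_j \sum_l C i j * (C j l * C l i).
Proof.
rewrite !exprS expr0 mulr1 -[C * (C * C)]/(C *m (C *m C)).
apply: eq_bigr => i _; rewrite mxE; apply: eq_bigr => j _.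
by rewrite mxE mulr_sumr.
Qed.

(** The zero diagonal leaves only closed walks through three distinct vertices; their edge [{i, j}]
    occurs once and is centered and independent of the other two. *)
Lemma bern_trace_cube n p :
  bern p (all_edges n) (fun G => \tr (cmx p G ^+ 3)) = 0.
Proof.
have -> : bern p (all_edges n) (fun G => \tr (cmx p G ^+ 3)) =
  bern p (all_edges n) (fun G => \sum_i \sum_j \sum_l cmx p G i j * (cmx p G j l * cmx p G l i)).
  by apply: bern_ext => G _; rewrite trace_cube.
rewrite bern_sum big1// => i _; rewrite bern_sum big1// => j _; rewrite bern_sum big1// => l _.
have [ij|ij] := eqVneq i j.
  by rewrite -[RHS](bern_cst p (all_edges n) 0); apply: bern_ext => G _; rewrite mxE ij eqxx mul0r.
have [jl|jl] := eqVneq j l.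
  by rewrite -[RHS](bern_cst p (all_edges n) 0); apply: bern_ext => G _; rewrite [X in _ * (X * _)]mxE jl eqxx mul0r mulr0.
have [li|li] := eqVneq l i.
  by rewrite -[RHS](bern_cst p (all_edges n) 0); apply: bern_ext => G _; rewrite [X in _ * (_ * X)]mxE li eqxx !mulr0.
have e : [set i; j] \in all_edges n by apply/edgeP; exists i, j.
rewrite -[RHS](@bern_centered R _ p (all_edges n) _ (fun G => cmx p G j l * cmx p G l i) e); last first.
  move=> G; rewrite !mxE (negbTE jl) (negbTE li).
  have ne (a b : 'I_n) : l \in [set a; b] -> ([set a; b] \in ([set i; j] |: G)%SET) = ([set a; b] \in G).
    move=> lab; rewrite !inE; case: eqP => // E; move: lab; rewrite E !inE.
    by rewrite (negbTE li) eq_sym (negbTE jl).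
  by rewrite !ne// !inE eqxx ?orbT.
by apply: bern_ext => G _; rewrite [X in X * _]mxE (negbTE ij).
Qed.

Lemma cmx_norm_le1 n p (G : graph n) i j : 0 <= p <= 1 -> `|cmx p G i j| <= 1.
Proof.
move=> /andP[p0 p1]; rewrite mxE; case: eqP => _; first by rewrite normr0.
by rewrite ler_norml; case: (_ \in G) => /=; lra.
Qed.

Lemma trace_cube_cmx_le n p (G : graph n) : 0 <= p <= 1 -> \tr (cmx p G ^+ 3) <= n%:R ^+ 3.
Proof.
move=> p01; rewrite trace_cube.
have h a b : `|cmx p G a b| <= 1 by exact: cmx_norm_le1.
apply: (@le_trans _ _ (\sum_(i < n) \sum_(j < n) \sum_(l < n) 1)).
  do 3 (apply: ler_sum => ? _); apply: le_trans (ler_norm _) _; rewrite !normrM.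
  by rewrite mulr_ile1 ?mulr_ge0 ?mulr_ile1.
by rewrite !sumr_const !card_ord -!natrX -!mulrnA ler_nat; lia.
Qed.

Lemma trace_cube_shift n p (G : graph n) : 0 <= p <= 1 ->
  \tr (cmx p G ^+ 3) - 4 * n%:R ^+ 2 <= \tr ((cmx p G - p%:M) ^+ 3).
Proof.
move=> /[dup] p01 /andP[p0 p1]; set C := cmx p G.
have trC : \tr C = 0 by rewrite /mxtrace big1// => i _; rewrite mxE eqxx.
have trC2 : \tr (C *m C) = frob2 C by rewrite frob2_tr cmx_sym.
have E : (C - p%:M) ^+ 3 = C ^+ 3 - (3 * p) *: (C *m C) + (3 * p ^+ 2) *: C - (p ^+ 3)%:M.
  have S2 : (C - p%:M) *m (C - p%:M) = C *m C - (2 * p) *: C + (p ^+ 2)%:M.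
    rewrite mulmxBl !mulmxBr mul_scalar_mx mul_mx_scalar mul_scalar_mx scale_scalar_mx.
    by move: (C *m C) => Q; apply/matrixP => i j; rewrite !mxE; case: eqP => _; rewrite ?mulr1n ?mulr0n; ring.
  have C3 : C ^+ 3 = C *m (C *m C) by rewrite !exprS expr0 mulr1.
  have -> : (C - p%:M) ^+ 3 = (C - p%:M) *m ((C - p%:M) *m (C - p%:M)) by rewrite !exprS expr0 mulr1.
  rewrite S2 C3 mulmxDr mulmxBr !mulmxBl -!scalemxAr !mul_scalar_mx !mul_mx_scalar scale_scalar_mx.
  by move: (C *m (C *m C)) (C *m C) => Q3 Q; apply/matrixP => i j; rewrite !mxE;
     case: eqP => _; rewrite ?mulr1n ?mulr0n; ring.
have trN (X : 'M[R]_n) : \tr (- X) = - \tr X by exact: raddfN.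
rewrite E !mxtraceD !trN !mxtraceZ trC trC2 mxtrace_scalar mulr0 addr0.
have f2 : frob2 C <= n%:R ^+ 2.
  apply: (@le_trans _ _ (\sum_(i < n) \sum_(j < n) 1)).
    do 2 (apply: ler_sum => ? _); rewrite -[X in X <= _]real_normK ?num_real//.
    by rewrite exprn_ile1// cmx_norm_le1.
  by rewrite !sumr_const !card_ord -natrX -!mulrnA ler_nat; lia.
have f0 := frob2_ge0 C.
have pn : p ^+ 3 *+ n <= n%:R ^+ 2.
  apply: (@le_trans _ _ n%:R).
    by rewrite -mulr_natl -[leRHS]mulr1 ler_wpM2l// exprn_ile1.
  by rewrite -natrX ler_nat; nia.
have := ler_wpM2r f0 p1; rewrite mul1r; lra.
Qed.

(** The unit eigenvector is a witness of rank one, and removing the shift by [p] only increases the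
    inner product. *)
Lemma top_eigenvalue_event n p T (G : graph n) (P : 'M[R]_n) d i : 0 <= p ->
  spectral_decomp (cmx p G - p%:M) P d -> T < d i -> low_rank_event 1 p T G.
Proof.
move=> p0 D Td; apply/asboolP; exists (row i P)^T, (row i P)^T.
have [PP _ _] := D.
have rr : row i P *m (row i P)^T = 1%:M.
  have /matrixP/(_ i i) := PP; rewrite !mxE eqxx => h.
  apply/matrixP => a b; rewrite !ord1 !mxE eqxx -h.
  by apply: eq_bigr => j _; rewrite !mxE.
have fr : frob2 (row i P)^T = 1 by rewrite frob2_trmx frob2_tr rr mxtrace1.
split; rewrite ?fr//.
  rewrite trmxK frob2_tr trmx_mul trmxK -mulmxA (mulmxA (row i P)) rr mul1mx.
  by rewrite mxtrace_mulC rr mxtrace1.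
have := decomp_diag i D; rewrite mulmxBr mulmxBl [LHS]mxE [X in _ + X]mxE.
rewrite mul_mx_scalar -scalemxAl PP [X in _ - X]mxE [X in _ - _ * X]mxE eqxx mulr1 => E.
have -> : ip (cmx p G) ((row i P)^T *m (row i P)^T^T) = (P *m cmx p G *m P^T) i i.
  rewrite /ip mxE exchange_big /=; apply: eq_bigr => a _; rewrite mxE mulr_suml.
  apply: eq_bigr => b _; rewrite !mxE big_ord1 !mxE.
  by rewrite mulrCA mulrA.
by apply: ltW; lra.
Qed.

(* The trace of [cmx p G ^+ 3] is centered and at most [n^3], so it exceeds [- s] with *)
(* probability at least [s / (n^3 + s)]. *)
Lemma cube_diff_good_event n p T s : (0 < n)%N -> 0 < p -> p <= 2^-1 -> 0 <= T -> 0 < s ->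
  s / (n%:R ^+ 3 + s) - expR (8 * n%:R - kappa p * T ^+ 2 / 12) <=
  bernP p (all_edges n) (fun G => - (s + 4 * n%:R ^+ 2) <= cube_pos T G - cube_neg T G).
Proof.
move=> n0 p0 p2 T0 s0; have p01 : 0 <= p <= 1 by lra.
have n3 : 0 <= n%:R ^+ 3 :> R by rewrite exprn_ge0.
have h1 : s / (n%:R ^+ 3 + s) <= bernP p (all_edges n) (fun G => - s <= \tr (cmx p G ^+ 3)).
  rewrite ler_pdivrMr ?ltr_wpDl//.
  have : bern p (all_edges n) (fun G => \tr (cmx p G ^+ 3)) <=
     bern p (all_edges n) (fun G => (n%:R ^+ 3 + s) * (- s <= \tr (cmx p G ^+ 3))%R%:R + - s).
    apply: ler_bern => // G _; case: (boolP (- s <= _)) => [_|].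
      by rewrite mulr1 addrK trace_cube_cmx_le.
    by rewrite -ltNge mulr0 add0r => /ltW.
  by rewrite bern_trace_cube bernD bernZ bern_cst subr_ge0 mulrC.
(* The coarsest net, [r = q = 1], suffices to exclude an eigenvalue above [T]; here
   [12 = 2 (1 + 5)]. *)
have h2 := @low_rank_deviation R n 1 1 n0 isT isT p T p0 p2 T0.
have h2' : bernP p (all_edges n) (low_rank_event 1 p T) <= expR (8 * n%:R - kappa p * T ^+ 2 / 12).
  apply: le_trans h2 _; rewrite ler_expR.
  have -> : (2 * (n * 1 * (1 + 3)))%:R = 8 * n%:R :> R by rewrite -natrM; congr (_%:R); lia.
  by have -> : 2 * (1 + 5 / 1 ^+ 2) = 12 :> R by field.
rewrite lerBlDr; apply: le_trans h1 _; apply: le_trans (lerD (lexx _) h2').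
apply: le_trans (bernPU _ _ _ p01); apply: ler_bernP => // G sG Xs /=.
rewrite orbC -implyNb; apply/implyP => nl.
have [P [d D]] := spectral_decomp_exists (cmx_shift_sym p G).
have dT i : d i <= T.
  rewrite leNgt; apply: contra nl => Td; exact: (top_eigenvalue_event (ltW p0) D Td).
have := cube_diff_mono (ltW p0) T0 sG; have := cube_diff_ge_trace T0 D dT.
have := trace_cube_shift G p01; lra.
Qed.

End CubicStatistic.

(** * Large negative eigenvalues as a low-rank event *)

Section NegativeMass.
Variable R : realType.
Implicit Types (n r : nat) (p T S : R).

Definition neg_mass T n (G : graph n) : R :=
  \sum_(x <- spectrum (adjmx R G) | x < - T) x ^+ 2.

Lemma neg_massE T n (G : graph n) P d : spectral_decomp (adjmx R G) P d ->
  neg_mass T G = \sum_(i | d i < - T) d i ^+ 2.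
Proof. by move=> [_ _ E]; rewrite /neg_mass (perm_big _ E) big_map big_enum_cond. Qed.

(** Elements are discarded while the sum stays at least [S]. In a minimal set, all elements but one
    weigh less than [S] together and at least [a] each. *)
Lemma minimal_heavy_set (I : finType) (A : {set I}) (w : I -> R) S a : 0 < a -> 0 <= S ->
  (forall i, i \in A -> a <= w i) -> S <= \sum_(i in A) w i ->
  exists B : {set I}, [/\ B \subset A, S <= \sum_(i in B) w i & #|B|%:R <= 1 + S / a].
Proof.
move=> a0 S0 aw; have [k] := ubnP #|A|; elim: k A aw => // k IH A aw Ak SA.
have [[i iA iS]|no] := pselect (exists2 i, i \in A & S <= \sum_(j in (A :\ i)%SET) w j).
  have [||B [BA SB cB]] := IH (A :\ i)%SET _ _ iS.
  - by move=> j; rewrite !inE => /andP[_]; exact: aw.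
  - by move: Ak; rewrite (cardsD1 i) iA.
  by exists B; split=> //; apply: fintype.subset_trans BA (finset.subsetDl _ _).
exists A; split=> //; have [A0|[i iA]] := finset.set_0Vmem A.
  by rewrite A0 cards0 addr_ge0// divr_ge0// ltW.
have : \sum_(j in (A :\ i)%SET) w j < S.
  by rewrite ltNge; apply/negP => h; apply: no; exists i.
rewrite (cardsD1 i) iA natrD lerD2l ler_pdivlMr// => /ltW; apply: le_trans.
rewrite mulr_natl -sumr_const; apply: ler_sum => j; rewrite !inE => /andP[_]; exact: aw.
Qed.

(** The test matrix is the part of [A] on the chosen eigenvectors, divided by its norm [sg >= S];
    its inner product with [A] is [sg]. Centering adds [p I - p J], with [J] the all-ones matrix:
    the weights being negative, [- p J] helps, and [p I] costs at most [sqrt r] by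
    Cauchy--Schwarz. *)
Lemma neg_mass_low_rank n r p T S (G : graph n) : 0 < n%:R :> R -> 0 <= p -> p <= 1 -> 0 < T -> 0 < S ->
  1 + S ^+ 2 / T ^+ 2 <= r%:R -> G \subset all_edges n -> S ^+ 2 <= neg_mass T G ->
  low_rank_event r p (S - Num.sqrt r%:R) G.
Proof.
move=> n0 p0 p1 T0 S0 rS sG; have [P [d D]] := spectral_decomp_exists (adjmx_sym R G).
rewrite (neg_massE T D) => SM.
have [||||B [BA SB cB]] := @minimal_heavy_set _ [set i | d i < - T]%SET (fun i => d i ^+ 2) (S ^+ 2) (T ^+ 2).
- by rewrite exprn_gt0.
- exact: sqr_ge0.
- move=> i; rewrite inE => dT; rewrite -[d i ^+ 2]sqrrN lerXn2r// ?nnegrE; lra.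
- by rewrite (eq_bigl (fun i => d i < - T))// => i; rewrite inE.
have dT i : i \in B -> d i < - T by move=> /(fintype.subsetP BA); rewrite inE.
have Br : (#|B| <= r)%N by rewrite -(ler_nat R) (le_trans cB).
have [PP AE _] := D.
pose sg := Num.sqrt (\sum_(i in B) d i ^+ 2).
have sg2 : sg ^+ 2 = \sum_(i in B) d i ^+ 2.
  by rewrite sqr_sqrtr// sumr_ge0// => i _; exact: sqr_ge0.
have Ssg : S <= sg by rewrite -[S]gtr0_norm// -sqrtr_sqr ler_wsqrtr.
have sg0 : 0 < sg := lt_le_trans S0 Ssg.
have [i0 _] : exists i0 : 'I_n, true.
  by move: n0; rewrite ltr0n => n0; exists (Ordinal n0).
pose s := enum B.
have sz : size s = #|B| by rewrite -cardE.
(* Columns beyond the chosen eigenvectors are zero, so the width [r] does not depend on the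
   graph. *)
pose U : 'M[R]_(n, r) := \matrix_(a, j) (if (j < size s)%N then P (nth i0 s j) a else 0).
pose V : 'M[R]_(n, r) := \matrix_(a, j) (if (j < size s)%N then d (nth i0 s j) / sg * P (nth i0 s j) a else 0).
have sumB (F : 'I_n -> R) : \sum_(j < r) (if (j < size s)%N then F (nth i0 s j) else 0) = \sum_(i in B) F i.
  rewrite -[RHS]big_enum -/s (big_nth i0) big_mkord.
  have szr : (size s <= r)%N by rewrite sz.
  by rewrite [RHS](big_ord_widen r (fun j => F (nth i0 s j)) szr) [RHS]big_mkcond.
have rowP i : \sum_a P i a ^+ 2 = 1 by exact: orth_row.
have frU : frob2 U = \sum_(i in B) 1.
  rewrite /frob2 exchange_big /= -(sumB (fun=> 1)); apply: eq_bigr => j _.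
  case: ifPn => js; last by rewrite big1// => a _; rewrite mxE (negbTE js) expr0n.
  by rewrite -(rowP (nth i0 s j)); apply: eq_bigr => a _; rewrite mxE js.
have frV : frob2 V = 1.
  rewrite /frob2 exchange_big /=.
  transitivity (\sum_(i in B) (d i / sg) ^+ 2); last first.
    under eq_bigr do rewrite exprMn exprVn; rewrite -mulr_suml -sg2 divff//.
    by rewrite expf_neq0// gt_eqF.
  rewrite -sumB; apply: eq_bigr => j _.
  case: ifPn => js; last by rewrite big1// => a _; rewrite mxE (negbTE js) expr0n.
  rewrite -[RHS]mulr1 -(rowP (nth i0 s j)) mulr_sumr.
  by apply: eq_bigr => a _; rewrite mxE js exprMn.
have VU : V *m U^T = P^T *m diag_mx (\row_i (if i \in B then d i / sg else 0)) *m P.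
  apply/matrixP => a b; rewrite !mxE.
  transitivity (\sum_(i in B) d i / sg * P i a * P i b).
    rewrite -sumB; apply: eq_bigr => j _; rewrite !mxE; case: ifP => // _.
    by rewrite mul0r.
  rewrite big_mkcond /=; apply: eq_bigr => i _; rewrite mul_mx_diag !mxE.
  by case: ifP => _; rewrite ?mulr0 ?mul0r//; ring.
have PP' := mulmx1C PP.
have frVU : frob2 (V *m U^T) = 1.
  rewrite VU frob2_tr !trmx_mul trmxK tr_diag_mx -!mulmxA (mulmxA P) PP mul1mx.
  rewrite mxtrace_mulC -!mulmxA PP mulmx1 mulmx_diag mxtrace_diag.
  transitivity (\sum_(i in B) (d i / sg) ^+ 2).
    rewrite [RHS]big_mkcond /=; apply: eq_bigr => i _; rewrite !mxE.
    by case: ifP => _; rewrite ?mul0r// expr2.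
  under eq_bigr do rewrite exprMn exprVn; rewrite -mulr_suml -sg2 divff//.
  by rewrite expf_neq0// gt_eqF.
apply/asboolP; exists U, V; rewrite frU frV frVU; split=> //.
  by rewrite sumr_const ler_nat.
have ipE (M : 'M[R]_n) : ip M (V *m U^T) = \sum_(i in B) d i / sg * (P *m M *m P^T) i i.
  have -> : ip M (V *m U^T) = \sum_a \sum_b \sum_(i in B) d i / sg * (P i a * M a b * P i b).
    apply: eq_bigr => a _; apply: eq_bigr => b _; rewrite VU mxE mulr_sumr [RHS]big_mkcond /=.
    apply: eq_bigr => i _; rewrite mul_mx_diag !mxE; case: ifP => _; last by rewrite mulr0 mul0r mulr0.
    by ring.
  under eq_bigr do rewrite exchange_big /=.
  rewrite exchange_big /=; apply: eq_bigr => i _.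
  under eq_bigr do rewrite -mulr_sumr; rewrite -mulr_sumr; congr (_ * _).
  rewrite mxE exchange_big /=; apply: eq_bigr => b _; rewrite mxE mulr_suml.
  by apply: eq_bigr => a _; rewrite mxE.
have CE : cmx p G = adjmx R G + p%:M - p *: const_mx 1.
  rewrite adjmx_symx//; apply/matrixP => a b; rewrite !mxE mulr1.
  by case: eqP => _ /=; rewrite ?mulr1n ?mulr0n; ring.
have qC i : (P *m cmx p G *m P^T) i i = d i + p - p * (\sum_a P i a) ^+ 2.
  rewrite CE mulmxBr mulmxDr mulmxBl mulmxDl mxE [X in X + _]mxE (decomp_diag i D).
  rewrite mul_mx_scalar -[p *: P *m _]scalemxAl PP [(p *: 1%:M) _ _]mxE [1%:M _ _]mxE eqxx mulr1.
  have nN (M : 'M[R]_n) : (- M) i i = - (M i i) by rewrite mxE.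
  have sc (M : 'M[R]_n) : (p *: M) i i = p * M i i by rewrite mxE.
  rewrite -scalemxAr -scalemxAl nN sc; congr (_ - _ * _).
  rewrite mxE expr2 mulr_sumr; apply: eq_bigr => b _; rewrite [P^T _ _]mxE; congr (_ * _).
  by rewrite mxE; apply: eq_bigr => a _; rewrite mxE mulr1.
rewrite ipE.
apply: (@le_trans _ _ (\sum_(i in B) (d i ^+ 2 / sg + d i / sg))); last first.
  apply: ler_sum => i iB; rewrite qC.
  have di0 : d i / sg <= 0.
    by rewrite mulr_le0_ge0 ?invr_ge0 ?(ltW sg0)//; have := dT i iB; lra.
  have pos : 0 <= p * (\sum_a P i a) ^+ 2 by rewrite mulr_ge0// sqr_ge0.
  have := mulr_le0_ge0 di0 pos; have := ler_wnM2r di0 p1.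
  rewrite mul1r; have -> : d i ^+ 2 / sg = d i / sg * d i by ring.
  by move: (d i / sg) (p * _) => x y; lra.
rewrite big_split /= -mulr_suml -sg2 expr2 mulfK ?gt_eqF//.
have : - (\sum_(i in B) d i / sg) <= Num.sqrt r%:R.
  apply: (@le_trans _ _ `|\sum_(i in B) 1 * (d i / sg)|).
    by under [X in _ <= `|X|]eq_bigr do rewrite mul1r; rewrite -normrN ler_norm.
  rewrite -sqrtr_sqr ler_wsqrtr//.
  have := cauchy_schwarz_sum (fun i => if i \in B then 1 else 0) (fun i => if i \in B then d i / sg else 0).
  have -> : \sum_i (if i \in B then 1 else 0) * (if i \in B then d i / sg else 0) = \sum_(i in B) 1 * (d i / sg).
    by rewrite [RHS]big_mkcond; apply: eq_bigr => i _; case: ifP => _; rewrite ?mul0r.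
  move=> /le_trans; apply.
  have -> : \sum_i (if i \in B then 1 else 0 : R) ^+ 2 = #|B|%:R.
    by rewrite -sum1_card natr_sum [RHS]big_mkcond; apply: eq_bigr => i _; case: ifP => _; rewrite ?expr1n ?expr0n.
  have -> : \sum_i (if i \in B then d i / sg else 0) ^+ 2 = 1.
    transitivity (\sum_(i in B) (d i / sg) ^+ 2).
      by rewrite [RHS]big_mkcond; apply: eq_bigr => i _; case: ifP => _; rewrite ?expr0n.
    under eq_bigr do rewrite exprMn exprVn; rewrite -mulr_suml -sg2 divff//.
    by rewrite expf_neq0// gt_eqF.
  by rewrite mulr1 ler_nat.
lra.
Qed.

Lemma neg_mass_deviation n r q p T S : (0 < n)%N -> (0 < r)%N -> (0 < q)%N ->
  0 < p -> p <= 2^-1 -> 0 < T -> 0 < S -> 1 + S ^+ 2 / T ^+ 2 <= r%:R -> Num.sqrt r%:R <= S ->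
  bernP p (all_edges n) (fun G => S ^+ 2 <= neg_mass T G) <=
  expR ((2 * (n * r * (q + 3)))%:R -
    kappa p * (S - Num.sqrt r%:R) ^+ 2 / (2 * (1 + 5 / q%:R ^+ 2))).
Proof.
move=> n0 r0 q0 p0 p2 T0 S0 rS rS'.
apply: le_trans (low_rank_deviation n0 r0 q0 p0 p2 (_ : 0 <= S - Num.sqrt r%:R)); last by rewrite subr_ge0.
apply: ler_bernP; first by lra.
by move=> G sG; apply: (@neg_mass_low_rank _ _ _ T); rewrite ?ltr0n//; lra.
Qed.

End NegativeMass.

(** * From a low cycle density to large negative eigenvalues *)

Section LowTau.
Variable R : realType.
Implicit Types (n m k : nat) (p T : R).

Definition neg_pow k T n (G : graph n) : R :=
  \sum_(x <- spectrum (adjmx R G) | x < - T) `|x| ^+ k.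

Lemma neg_powE k T n (G : graph n) P d : spectral_decomp (adjmx R G) P d ->
  neg_pow k T G = \sum_(i | d i < - T) `|d i| ^+ k.
Proof. by move=> [_ _ E]; rewrite /neg_pow (perm_big _ E) big_map big_enum_cond. Qed.

(** Each eigenvalue in the sum is at most [sqrt Q] in modulus, so its [k]-th power is at most its
    square times [sqrt Q ^+ (k - 2)]. *)
Lemma neg_mass_ge k T Y n (G : graph n) : (2 <= k)%N -> 0 <= Y ->
  Y ^+ k <= neg_pow k T G -> Y ^+ 2 <= neg_mass T G.
Proof.
move=> k2 Y0; have [P [d D]] := spectral_decomp_exists (adjmx_sym R G).
rewrite (neg_powE _ _ D) (neg_massE _ D); set Q := \sum_(i | _) d i ^+ 2 => YQ.
have Q0 : 0 <= Q by apply: sumr_ge0 => i _; exact: sqr_ge0.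
have sQ : Num.sqrt Q ^+ 2 = Q by rewrite sqr_sqrtr.
have s0 := sqrtr_ge0 Q.
suff : Y <= Num.sqrt Q by move=> h; rewrite -sQ lerXn2r.
have k0 : (0 < k)%N by exact: leq_trans k2.
rewrite -(ler_pXn2r k0)// ?nnegrE//; apply: le_trans YQ _.
rewrite -(subnK k2) [leRHS]exprD sQ mulr_sumr; apply: ler_sum => i di.
rewrite exprD real_normK ?num_real// ler_wpM2r ?sqr_ge0//.
apply: lerXn2r; rewrite ?nnegrE// -sqrtr_sqr ler_wsqrtr// /Q (bigD1 i)//= lerDl.
by apply: sumr_ge0 => j _; exact: sqr_ge0.
Qed.

Lemma neg_pow_le k T B n (G : graph n) : (2 <= k)%N -> 0 <= B ->
  (forall x, x \in spectrum (adjmx R G) -> - B <= x) ->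
  0 <= T -> neg_pow k T G <= B ^+ (k - 2) * neg_mass T G.
Proof.
move=> k2 B0 h T0; rewrite /neg_pow /neg_mass mulr_sumr big_seq_cond [leRHS]big_seq_cond.
apply: ler_sum => x /andP[xs xT]; rewrite -{1}(subnK k2) exprD real_normK ?num_real//.
rewrite ler_wpM2r ?sqr_ge0// lerXn2r// ?nnegrE//.
have := h x xs; rewrite ltr0_norm; lra.
Qed.

(** Rayleigh quotient of the all-ones vector: the eigenvalues averaged with the weights [c i], of
    sum [n], give [2 m / n]. *)
Lemma top_eigenvalue n m (G : graph n) P d : (0 < n)%N -> G \in Gnm_support n m ->
  spectral_decomp (adjmx R G) P d -> exists i, 2 * m%:R / n%:R <= d i.
Proof.
move=> n0; rewrite inE => /andP[sG /eqP cG] [PP AE _].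
have PP' := mulmx1C PP; pose c i := (\sum_a P i a) ^+ 2.
have nR : 0 < n%:R :> R by rewrite ltr0n.
have cE i : c i = \sum_a \sum_b P i a * P i b.
  by rewrite /c expr2 mulr_suml; apply: eq_bigr => a _; rewrite mulr_sumr.
have sumc : \sum_i c i = n%:R.
  under eq_bigr do rewrite cE.
  rewrite exchange_big /=; under eq_bigr do rewrite exchange_big /=.
  transitivity (\sum_a \sum_b (1%:M : 'M[R]_n) a b).
    rewrite -PP'; apply: eq_bigr => a _; apply: eq_bigr => b _.
    by rewrite mxE; apply: eq_bigr => i _; rewrite mxE.
  transitivity (\sum_(a < n) (1 : R)); last by rewrite sumr_const card_ord.
  apply: eq_bigr => a _; rewrite (bigD1 a)//= big1 ?addr0; last first.
    by move=> b /negbTE ba; rewrite mxE eq_sym ba.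
  by rewrite mxE eqxx.
have sumdc : \sum_i d i * c i = 2 * m%:R.
  rewrite -cG -sum_adjmx// {1}AE.
  under eq_bigr do rewrite cE mulr_sumr.
  rewrite exchange_big /=; apply: eq_bigr => a _.
  under eq_bigr do rewrite mulr_sumr.
  rewrite exchange_big /=; apply: eq_bigr => b _.
  rewrite mxE; apply: eq_bigr => i _; rewrite mul_mx_diag !mxE; ring.
have [//|no] := pselect (exists i, 2 * m%:R / n%:R <= d i).
have lt i : d i < 2 * m%:R / n%:R by rewrite ltNge; apply/negP => h; apply: no; exists i.
have : \sum_i (2 * m%:R / n%:R - d i) * c i = 0.
  under eq_bigr do rewrite mulrBl; rewrite sumrB -mulr_sumr sumc sumdc.
  by rewrite divfK ?subrr// gt_eqF.
move=> /eqP; rewrite psumr_eq0; last first.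
  by move=> i _; rewrite mulr_ge0 ?sqr_ge0// subr_ge0 ltW.
move=> /allP h; have : \sum_i c i = 0.
  apply: big1 => i _; have := h i (mem_index_enum _).
  by rewrite mulf_eq0 gt_eqF ?subr_gt0//= => /eqP.
by rewrite sumc => /eqP; rewrite gt_eqF.
Qed.

Lemma eigenvalue_le n (G : graph n) P d i :
  spectral_decomp (adjmx R G) P d -> d i <= n%:R.
Proof.
move=> D; have : d i ^+ 2 <= n%:R ^+ 2.
  apply: (@le_trans _ _ (\sum_j d j ^+ 2)).
    by rewrite (bigD1 i)//= lerDl; apply: sumr_ge0 => j _; exact: sqr_ge0.
  rewrite -(trace_exp 2 D) expr2 -[_ * _]/(_ *m _) -{2}(adjmx_sym R G) -frob2_tr.
  apply: (@le_trans _ _ (\sum_(a < n) \sum_(b < n) 1)).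
    do 2 (apply: ler_sum => ? _); rewrite mxE.
    by case: (_ \in _); rewrite ?expr1n ?expr0n.
  by rewrite !sumr_const !card_ord -natrX -!mulrnA ler_nat; lia.
move=> h; rewrite leNgt; apply/negP => nd.
have n0 : 0 <= n%:R :> R by [].
have : n%:R ^+ 2 < d i ^+ 2 by rewrite ltrXn2r// nnegrE; lra.
by rewrite ltNge h.
Qed.

Lemma low_tau_power_sum n m k (p tk x0 : R) (G : graph n) P d :
  (0 < k)%N -> (k <= n)%N -> G \in Gnm_support n m ->
  spectral_decomp (adjmx R G) P d -> 0 <= x0 -> x0 <= 2 * m%:R / n%:R ->
  tau R k G <= p ^+ k - tk ->
  exists i0, \sum_(i | i != i0) d i ^+ k <=
    (p ^+ k - tk) * n%:R ^+ k + k%:R ^+ 2 * n%:R ^+ k.-1 - x0 ^+ k.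
Proof.
move=> k0 kn Gs D x00 x0m ht; have n0 : (0 < n)%N := leq_trans k0 kn.
have [i0 hi0] := top_eigenvalue n0 Gs D; exists i0.
have f0 : 0 < (n ^_ k)%:R :> R by rewrite ltr0n ffact_gt0.
rewrite /tau ler_pdivrMr// in ht.
have pk : 0 <= p ^+ k - tk.
  by rewrite -(pmulr_lge0 _ f0) (le_trans _ ht).
have fn : (n ^_ k)%:R <= n%:R ^+ k :> R.
  rewrite -natrX ler_nat; elim: (k) => [|j IHj]; first by rewrite ffactn0 expn0.
  by rewrite ffactnSr expnSr leq_mul// leq_subr.
have := trace_exp k D; rewrite (bigD1 i0)//= => E.
have h := trace_adjmx_le R G k0.
have x0k : x0 ^+ k <= d i0 ^+ k by rewrite lerXn2r// ?nnegrE//; lra.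
have := ler_wpM2l pk fn; rewrite natrM !natrX in h; lra.
Qed.

(** Nonnegative eigenvalues only help, as [k] is odd, and each one in [[-T, 0)] costs at most
    [T^k]. *)
Lemma neg_pow_lower_trivial n k T (G : graph n) P d i0 : odd k -> 0 <= T ->
  spectral_decomp (adjmx R G) P d ->
  - \sum_(i | i != i0) d i ^+ k - n%:R * T ^+ k <= neg_pow k T G.
Proof.
move=> ok T0 D; rewrite (neg_powE _ _ D).
have -> : n%:R * T ^+ k = \sum_(i < n) T ^+ k by rewrite sumr_const card_ord mulr_natl.
rewrite -sumrN [X in X - _ <= _]big_mkcond [leRHS]big_mkcond -sumrB /=.
have Tk : 0 <= T ^+ k by rewrite exprn_ge0.
apply: ler_sum => i _; have [d0|d0] := leP 0 (d i).
  have dk : 0 <= d i ^+ k by rewrite exprn_ge0.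
  rewrite ltNge (_ : - T <= d i) /=; last by lra.
  by case: ifP => _; lra.
have Nk : - d i ^+ k = `|d i| ^+ k.
  by rewrite ltr0_norm// exprNn -signr_odd ok expr1 mulN1r.
rewrite Nk; case: ifP => _; case: ifPn => dT.
- by lra.
- rewrite subr_le0 lerXn2r// ?nnegrE// ltr0_norm//; rewrite -leNgt in dT; lra.
- by have := exprn_ge0 k (normr_ge0 (d i)); lra.
- by lra.
Qed.

(** For [T] of order [sqrt n] the trivial loss [n T^3] would be of order [n^(5/2)], too much near
    the lower end of the range of [t]. The cubic statistic replaces it; the top eigenvalue then
    costs only [3 T^2 n], because [tcube] is linear beyond [T]. *)
Lemma neg_pow_lower_cubic n T (G : graph n) P d i0 : 0 <= T ->
  spectral_decomp (adjmx R G) P d ->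
  - \sum_(i | i != i0) d i ^+ 3 + (cube_pos T G - cube_neg T G) - 3 * T ^+ 2 * n%:R
     <= neg_pow 3 T G.
Proof.
move=> T0 D; rewrite (neg_powE _ _ D) /cube_pos /cube_neg !(trfE _ D) -sumrB.
rewrite (bigD1 i0 (P := xpredT))//=.
have t0 : tcube T (d i0) - tcube T (- d i0) <= 3 * T ^+ 2 * n%:R.
  have h := tcube_ge0 (- d i0) T0; have [d0|/ltW d0] := leP 0 (d i0).
    have := tcube_le_lin T0 d0; have := eigenvalue_le i0 D => dn.
    have := ler_wpM2l (_ : 0 <= 3 * T ^+ 2) dn; rewrite mulr_ge0 ?sqr_ge0// => /(_ isT); lra.
  rewrite (tcube_neg T0 d0); have : 0 <= 3 * T ^+ 2 * n%:R by rewrite !mulr_ge0.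
  lra.
have : \sum_(i | i != i0) (tcube T (d i) - tcube T (- d i)) - \sum_(i | d i < - T) `|d i| ^+ 3
   <= \sum_(i | i != i0) d i ^+ 3.
  apply: (@le_trans _ _ (\sum_(i | i != i0) (tcube T (d i) - tcube T (- d i) -
      (if d i < - T then `|d i| ^+ 3 else 0)))).
    rewrite [leRHS]sumrB lerB// [leRHS]big_mkcond [leLHS]big_mkcond /=; apply: ler_sum => i _.
    by case: ifP => _ //; case: ifP.
  by apply: ler_sum => i _; exact: cube_ge_tcube.
lra.
Qed.

End LowTau.

(** * Tail estimates with explicit constants *)

Section UpperEstimates.
Variable R : realType.
Implicit Types (n m k : nat) (p T K S d Y : R).

(** With [r] about [S^2 / (K^2 n)], the entropy [n r (q + 3)] of the net is about
    [(q + 3) S^2 / K^2]. So [q] is fixed in terms of [d] first, then [K] is taken large; [C] makes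
    [sqrt r] small against [S] and the leftover [O(n)] small against [S^2]. *)
Lemma neg_mass_rate p d K0 : 0 < p -> p <= 2^-1 -> 0 < d -> d <= 1 -> 0 <= K0 ->
  exists K C, [/\ K0 <= K, 1 <= K, 1 <= C &
   forall n S, (0 < n)%N -> C <= n%:R -> 0 < S -> C * n%:R <= S ^+ 2 ->
     bernP p (all_edges n) (fun G => S ^+ 2 <= neg_mass (K * Num.sqrt n%:R) G) <=
     expR (- ((1 - d) * (kappa p / 2) * S ^+ 2))].
Proof.
move=> p0 p2 d0 d1 K00; have kp := kappa_gt0 p0 p2.
pose q := (Num.trunc (20 / d)).+1.
have qd : 20 / d < q%:R.
  by have /truncn_itv/andP[_] : 0 <= 20 / d by rewrite divr_ge0// ltW.
have q0 : 0 < q%:R :> R by rewrite ltr0n.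
have q1 : 1 <= q%:R :> R by rewrite ler1n.
have q5 : 5 / q%:R ^+ 2 <= d / 4.
  rewrite ler_pdivrMr ?exprn_gt0//; move: qd; rewrite ltr_pdivrMr// => qd.
  have : q%:R <= q%:R ^+ 2 :> R by rewrite expr2 ler_peMr// ltW.
  move=> /(ler_wpM2l (ltW d0)); lra.
have q50 : 0 <= 5 / q%:R ^+ 2 :> R by rewrite divr_ge0// sqr_ge0.
pose a := (q + 3)%:R : R; have a0 : 0 < a by rewrite ltr0n addnS.
have dk : 0 < d * kappa p by rewrite mulr_gt0.
pose b := a / (d * kappa p); have b0 : 0 < b by rewrite divr_gt0.
have bE : b * (d * kappa p) = a by rewrite /b divfK// gt_eqF.
pose K := K0 + 1 + 32 * b; pose C := 1 + 256 / d ^+ 2 + 64 * b.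
have d2 : 0 < d ^+ 2 by rewrite exprn_gt0.
pose e := d ^- 2; have e0 : 0 < e by rewrite invr_gt0.
have eE : e * d ^+ 2 = 1 by rewrite mulVf// gt_eqF.
have CE : C = 1 + 256 * e + 64 * b by [].
clearbody e C.
have K1 : 1 <= K by rewrite /K; lra.
have KK : K <= K ^+ 2 by rewrite expr2 ler_peMl//; lra.
exists K, C; split; [by rewrite /K; lra|by []|by rewrite CE; lra|].
move=> n S n0 Cn S0 CS.
have nR : 0 < n%:R :> R by rewrite ltr0n.
pose T := K * Num.sqrt n%:R; rewrite -/T.
have T2 : T ^+ 2 = K ^+ 2 * n%:R by rewrite exprMn sqr_sqrtr ?ltW.
have T0 : 0 < T by rewrite mulr_gt0 ?sqrtr_gt0//; lra.
pose x := S ^+ 2 / T ^+ 2.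
have x0 : 0 <= x by rewrite divr_ge0 ?sqr_ge0.
have xE : x * (K ^+ 2 * n%:R) = S ^+ 2 by rewrite /x -T2 divfK// gt_eqF ?exprn_gt0.
pose r := (Num.trunc (1 + x)).+1.
have /truncn_itv/andP[r1 r2] : 0 <= 1 + x by lra.
have rR : r%:R = (Num.trunc (1 + x))%:R + 1 :> R by rewrite -natr1.
have n1 : 1 <= n%:R :> R by rewrite ler1n.
have S2 : 256 * e <= S ^+ 2.
  have h1 : 256 * e <= C by rewrite CE; lra.
  have C0 : 0 <= C by rewrite CE; lra.
  apply: le_trans CS; apply: le_trans h1 _; by rewrite -[leLHS]mulr1 ler_wpM2l.
have r8 : r%:R <= (d / 8 * S) ^+ 2.
  have x2 : x * (128 * e) <= S ^+ 2.
    rewrite -xE ler_wpM2l//; apply: (@le_trans _ _ n%:R); first by rewrite CE in Cn; lra.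
    by rewrite -[leLHS]mul1r ler_wpM2r ?(ltW nR)//; lra.
  have h1 := ler_wpM2r (ltW d2) x2; have h2 := ler_wpM2r (ltW d2) S2.
  have e1 : x * (128 * e) * d ^+ 2 = 128 * x by rewrite -[RHS]mulr1 -eE; ring.
  have e2 : 256 * e * d ^+ 2 = 256 by rewrite -[RHS]mulr1 -eE; ring.
  rewrite e1 in h1; rewrite e2 in h2.
  have -> : (d / 8 * S) ^+ 2 = S ^+ 2 * d ^+ 2 / 64 by field.
  rewrite rR; move: (S ^+ 2 * d ^+ 2) h1 h2 r1 => u h1 h2 r1.
  by clear - h1 h2 r1; lra.
have sr : Num.sqrt r%:R <= d / 8 * S.
  have p8 : 0 <= d / 8 * S by rewrite mulr_ge0 ?ltW//; lra.
  by rewrite -[leRHS]ger0_norm// -sqrtr_sqr ler_wsqrtr.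
have rS : Num.sqrt r%:R <= S.
  have : d / 8 * S <= 1 * S by rewrite ler_wpM2r ?ltW//; lra.
  lra.
have q0' : (0 < q)%N by [].
apply: le_trans (@neg_mass_deviation R n r q p T S n0 _ q0' p0 p2 T0 S0 _ rS) _ => //.
  by rewrite -/x; lra.
rewrite ler_expR.
have E1 : (2 * (n * r * (q + 3)))%:R <= d * kappa p / 8 * S ^+ 2.
  rewrite !natrM -/a.
  have : n%:R * r%:R <= 2 * n%:R + n%:R * x.
    by rewrite rR; have := ler_wpM2l (ltW nR) r1; lra.
  move=> /(ler_wpM2r (ltW a0)).
  have i1 : 64 * (n%:R * a) <= d * kappa p * S ^+ 2.
    have : 64 * b * n%:R <= S ^+ 2.
      apply: le_trans CS; rewrite ler_wpM2r ?(ltW nR)// CE; lra.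
    by move=> /(ler_wpM2l (ltW dk)); rewrite -bE; lra.
  have i2 : 32 * (n%:R * x * a) <= d * kappa p * S ^+ 2.
    have : 32 * b <= K ^+ 2 by apply: le_trans KK; rewrite /K; lra.
    have nx : 0 <= n%:R * x by rewrite mulr_ge0// ltW.
    move=> /(ler_wpM2l nx); have -> : n%:R * x * K ^+ 2 = S ^+ 2 by rewrite -xE; ring.
    by move=> /(ler_wpM2l (ltW dk)); rewrite -bE; lra.
  lra.
have E2 : (1 - d / 2) * (kappa p / 2) * S ^+ 2 <=
    kappa p * (S - Num.sqrt r%:R) ^+ 2 / (2 * (1 + 5 / q%:R ^+ 2)).
  have D0 : 0 < 1 + 5 / q%:R ^+ 2 :> R by lra.
  rewrite ler_pdivlMr ?mulr_gt0//.
  have s1 : (1 - d / 4) * S ^+ 2 <= (S - Num.sqrt r%:R) ^+ 2.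
    have : (S * (1 - d / 8)) ^+ 2 <= (S - Num.sqrt r%:R) ^+ 2.
      rewrite lerXn2r ?nnegrE//; try lra.
      by rewrite mulr_ge0 ?ltW//; lra.
    have : 0 <= S ^+ 2 * d ^+ 2 by rewrite mulr_ge0// sqr_ge0.
    rewrite exprMn; lra.
  have s2 : (1 - d / 2) * (1 + 5 / q%:R ^+ 2) <= 1 - d / 4.
    have h2 : 0 <= 1 - d / 2 by lra.
    have := ler_wpM2l h2 q5; have := sqr_ge0 d; lra.
  have s3 := ler_wpM2r (sqr_ge0 S) s2.
  have := ler_wpM2l (ltW kp) (le_trans s3 s1); lra.
have : 0 <= d * kappa p * S ^+ 2 by rewrite mulr_ge0 ?sqr_ge0 ?ltW.
lra.
Qed.

(** In [cube_diff_two_copies] the second copy has probability at least [1 / (4 n)], by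
    [cube_diff_good_event], and is divided out. *)
Lemma cube_diff_rate n p K Y : (0 < n)%N -> 0 < p -> p <= 2^-1 -> 1 <= K ->
  108 <= kappa p * K ^+ 2 -> 16 * n%:R ^+ 2 <= Y ->
  bernP p (all_edges n) (fun G => cube_pos (K * Num.sqrt n%:R) G -
     cube_neg (K * Num.sqrt n%:R) G <= - Y) <=
  4 * n%:R * expR (- (Y ^+ 2 / (2304 * K ^+ 4 * n%:R ^+ 3))).
Proof.
move=> n0 p0 p2 K1 kK Yn; have p01 : 0 <= p <= 1 by lra.
have nR : 0 < n%:R :> R by rewrite ltr0n.
have n1 : 1 <= n%:R :> R by rewrite ler1n.
set T := K * Num.sqrt n%:R; have T0 : 0 <= T by rewrite mulr_ge0 ?sqrtr_ge0//; lra.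
have T2 : T ^+ 2 = K ^+ 2 * n%:R by rewrite exprMn sqr_sqrtr ?ltW.
have T4 : T ^+ 4 = K ^+ 4 * n%:R ^+ 2.
  have -> : T ^+ 4 = (T ^+ 2) ^+ 2 by ring.
  by rewrite T2; ring.
have n2 : 0 < n%:R ^+ 2 :> R by rewrite exprn_gt0.
have n3 : 0 < n%:R ^+ 3 :> R by rewrite exprn_gt0.
have K4 : 0 < K ^+ 4 by rewrite exprn_gt0//; lra.
pose s := Y / 2 - 4 * n%:R ^+ 2.
have s4 : 4 * n%:R ^+ 2 <= s by rewrite /s; lra.
have s0 : 0 < s by lra.
(* The minimizer of [144 eta^2 T^4 n - eta Y / 2], where [T^4 n = K^4 n^3]. *)
pose eta := Y / (576 * K ^+ 4 * n%:R ^+ 3).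
have D0 : 0 < 576 * K ^+ 4 * n%:R ^+ 3.
  have c0 : 0 < 576 :> R by lra.
  exact: mulr_gt0 (mulr_gt0 c0 K4) n3.
have Kn0 : K != 0 by rewrite gt_eqF//; lra.
have nn0 : n%:R != 0 :> R by rewrite gt_eqF.
have eta0 : 0 <= eta by rewrite divr_ge0 ?ltW//; lra.
have := cube_diff_two_copies n (Y / 2) p01 T0 eta0.
have -> : 2 * (Y / 2) = Y by field.
have -> : 144 * eta ^+ 2 * T ^+ 4 * n%:R - eta * (Y / 2) =
   - (Y ^+ 2 / (2304 * K ^+ 4 * n%:R ^+ 3)).
  by rewrite T4 /eta; field; rewrite Kn0 nn0.
have := cube_diff_good_event n0 p0 p2 T0 s0.
have -> : s + 4 * n%:R ^+ 2 = Y / 2 by rewrite /s; ring.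
set B1 := bernP _ _ _; set B2 := bernP _ _ _; set X := expR (- _) => good two.
have B10 : 0 <= B2 by apply: bern_ge0 => // G _; rewrite ler0n.
have low : (4 * n%:R)^-1 <= B1.
  apply: le_trans good.
  have e1 : expR (8 * n%:R - kappa p * T ^+ 2 / 12) <= (1 + n%:R)^-1.
    have h : kappa p * T ^+ 2 / 12 >= 9 * n%:R.
      have := ler_wpM2r (ltW nR) kK; rewrite T2; lra.
    apply: (@le_trans _ _ (expR (- n%:R))); first by rewrite ler_expR; lra.
    by rewrite expRN lef_pV2 ?posrE ?expR_gt0 ?expR_ge1Dx//; lra.
  have e2 : 4 / (n%:R + 4) <= s / (n%:R ^+ 3 + s).
    rewrite ler_pdivrMr; last by lra.
    rewrite mulrAC ler_pdivlMr; last by lra.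
    have := ler_wpM2l (ltW nR) s4; rewrite exprS; lra.
  have e3 : (4 * n%:R)^-1 <= 4 / (n%:R + 4) - (1 + n%:R)^-1 :> R.
    have P1 : 0 < n%:R + 4 :> R by lra.
    have P2 : 0 < 1 + n%:R :> R by lra.
    have -> : 4 / (n%:R + 4) - (1 + n%:R)^-1 = 3 * n%:R / ((n%:R + 4) * (1 + n%:R)) :> R.
      by field; rewrite !gt_eqF.
    rewrite ler_pdivlMr ?mulr_gt0// mulrC ler_pdivrMr ?mulr_gt0//.
    have : n%:R <= n%:R ^+ 2 :> R by rewrite expr2 ler_peMr// ltW.
    lra.
  lra.
have := ler_wpM2l B10 low; rewrite -/B2 => h.
have {h} : B2 / (4 * n%:R) <= X := le_trans h two.
by rewrite ler_pdivrMr ?mulr_gt0// mulrC.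
Qed.

Lemma Pr_Gnm_le_exp p n m (P : pred (graph n)) (C0 : R) : 0 < p -> p <= 2^-1 -> (2 <= n)%N ->
  `|m%:R - p * 'C(n, 2)%:R| <= C0 -> 2 * C0 <= 'C(n, 2)%:R ->
  Pr_Gnm R m P <= expR (2 * n%:R + C0 ^+ 2 / (p * (1 - p))) * bernP p (all_edges n) P.
Proof.
move=> p0 p2 n2 mC CN; set N := 'C(n, 2) in mC CN *.
have N0 : (0 < N)%N by rewrite bin_gt0.
have NR : 1 <= N%:R :> R by rewrite ler1n.
have mN : (m <= N)%N.
  rewrite -(ler_nat R); move: mC; rewrite ler_norml => /andP[_ h].
  have := ler_wpM2r (ler0n R N) p2; lra.
have p1 : p < 1 by lra.
have pp : 0 < p * (1 - p) by rewrite mulr_gt0; lra.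
apply: le_trans (Pr_Gnm_le_bernP P p0 p1 N0 mN) _.
apply: ler_wpM2r; first by apply: bern_ge0; [lra|move=> G _; rewrite ler0n].
rewrite expRD; apply: ler_pM; rewrite ?expR_ge0//.
  have : (N.+1 <= n ^ 2)%N.
    have E := bin_ffact n 2; rewrite ffactnS ffactn1 -/N in E.
    have {}E : (N * 2 = n * n.-1)%N := E.
    by move: (N) (n) E n2; clear => N n; case: n => // j /=; nia.
  rewrite -(ler_nat R) natrX => /le_trans; apply.
  have h : n%:R <= expR n%:R :> R by apply: le_trans (expR_ge1Dx _); lra.
  by rewrite expRM_natl; apply: lerXn2r => //; rewrite nnegrE ?expR_ge0 ?ler0n.
rewrite ler_expR ler_wpM2r ?invr_ge0 ?(ltW pp)//.
have N0R : 0 < N%:R :> R by lra.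
have -> : N%:R * (m%:R / N%:R - p) ^+ 2 = (m%:R - p * N%:R) ^+ 2 / N%:R.
  by field; rewrite gt_eqF.
have : (m%:R - p * N%:R) ^+ 2 <= C0 ^+ 2.
  rewrite -[X in X <= _]real_normK ?num_real//.
  by have := le_trans (normr_ge0 _) mC => ?; rewrite lerXn2r// nnegrE.
rewrite ler_pdivrMr// => h; apply: le_trans h _.
by rewrite ler_peMr// sqr_ge0.
Qed.

Lemma exprB_ge (x y X : R) k : 0 <= y -> y <= x -> x <= X ->
  x ^+ k - k%:R * y * X ^+ k.-1 <= (x - y) ^+ k.
Proof.
move=> y0 yx xX; have x0 := le_trans y0 yx; have X0 := le_trans x0 xX.
elim: k => [|k IH]; first by rewrite !expr0 !mul0r subr0.
have xy : 0 <= x - y by rewrite subr_ge0.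
rewrite [leRHS]exprS; apply: le_trans (ler_wpM2l xy IH).
have xk : x ^+ k <= X ^+ k by rewrite lerXn2r// nnegrE.
have Xk : x * (k%:R * X ^+ k.-1) <= k%:R * X ^+ k.
  case: k {IH xk} => [|k]; first by rewrite !mul0r mulr0.
  by rewrite mulrCA ler_wpM2l// [leRHS]exprS ler_wpM2r// exprn_ge0.
have P : 0 <= y ^+ 2 * (k%:R * X ^+ k.-1) by rewrite mulr_ge0 ?sqr_ge0// mulr_ge0// exprn_ge0.
have := ler_wpM2l y0 xk; have := ler_wpM2l y0 Xk.
rewrite exprS -natr1 /=; lra.
Qed.

(** Three errors of order [n^(k-1)] (non-injective walks, the error in the top eigenvalue, moderate
    eigenvalues) share one half of [eps t^k n^k]. For [k = 3] the other half is left to the cubic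
    statistic. *)
Lemma low_tau_neg_pow n m k p K (tn eps C0 : R) (G : graph n) :
  (3 <= k)%N -> odd k -> (k <= n)%N -> 0 < p -> p <= 2^-1 -> 1 <= K -> 0 < tn ->
  0 < eps -> `|m%:R - p * 'C(n, 2)%:R| <= C0 -> p + 2 * C0 <= p * n%:R ->
  k%:R ^+ 2 + k%:R * (p + 2 * C0) + 3 * K ^+ k <= eps / 2 * (tn ^+ k * n%:R) ->
  G \in Gnm_support n m -> tau R k G <= p ^+ k - tn ^+ k ->
  (k = 3%N -> - (eps / 2 * (tn ^+ 3 * n%:R ^+ 3)) <
     cube_pos (K * Num.sqrt n%:R) G - cube_neg (K * Num.sqrt n%:R) G) ->
  (1 - eps) * (tn ^+ k * n%:R ^+ k) <= neg_pow k (K * Num.sqrt n%:R) G.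
Proof.
move=> k3 ok kn p0 p2 K1 t0 e0 mC c1n big Gs low cub.
have k0 : (0 < k)%N by exact: leq_trans k3.
have n0 : (0 < n)%N := leq_trans k0 kn.
have nR : 0 < n%:R :> R by rewrite ltr0n.
have n1 : 1 <= n%:R :> R by rewrite ler1n.
have C00 : 0 <= C0 := le_trans (normr_ge0 _) mC.
set c1 := p + 2 * C0 in c1n big.
have c10 : 0 <= c1 by rewrite /c1; lra.
set T := K * Num.sqrt n%:R; have T0 : 0 <= T by rewrite mulr_ge0 ?sqrtr_ge0//; lra.
have T2 : T ^+ 2 = K ^+ 2 * n%:R by rewrite exprMn sqr_sqrtr ?ltW.
have [P [d D]] := spectral_decomp_exists (adjmx_sym R G).
have x0 : 0 <= p * n%:R - c1 by lra.
have x0m : p * n%:R - c1 <= 2 * m%:R / n%:R.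
  rewrite ler_pdivlMr//; move: mC; rewrite ler_norml => /andP[h _].
  have N2 : 2 * 'C(n, 2)%:R = n%:R * (n%:R - 1) :> R.
    have E := bin_ffact n 2; rewrite ffactnS ffactn1 in E.
    have {}E : ('C(n, 2) * 2 = n * n.-1)%N := E.
    by rewrite -natrM mulnC E natrM -subn1 natrB.
  have : 2 * C0 <= 2 * C0 * n%:R by rewrite ler_peMr//; lra.
  have := congr1 (fun x => p * x) N2; rewrite /c1; lra.
have [i0 hs] := low_tau_power_sum k0 kn Gs D x0 x0m low.
have nk : n%:R ^+ k = n%:R * n%:R ^+ k.-1 :> R by rewrite -exprS prednK.
have b := @exprB_ge (p * n%:R) c1 n%:R k c10 c1n _.
have {b} b := b ltac:(rewrite -[leRHS]mul1r ler_wpM2r ?ltW//; lra).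
rewrite exprMn in b.
set w := n%:R ^+ k.-1 in hs b nk; have w0 : 0 < w by rewrite exprn_gt0.
have hs' : tn ^+ k * n%:R ^+ k - (k%:R ^+ 2 + k%:R * c1) * w <= - \sum_(i | i != i0) d i ^+ k.
  lra.
have bw := ler_wpM2r (ltW w0) big.
have Kk : 0 < K ^+ k by rewrite exprn_gt0//; lra.
have Ew : eps / 2 * (tn ^+ k * n%:R) * w = eps / 2 * (tn ^+ k * n%:R ^+ k).
  by rewrite nk; ring.
rewrite Ew in bw; have tk0 : 0 < tn ^+ k * n%:R ^+ k by rewrite mulr_gt0 ?exprn_gt0.
have etk := mulr_gt0 e0 tk0.
have [k3'|k3'] := eqVneq k 3%N.
  have := neg_pow_lower_cubic i0 T0 D; have := cub k3'; rewrite -/T T2.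
  move: hs' bw etk; rewrite /w k3' /= => hs' bw etk c l.
  have : K ^+ 2 <= K ^+ 3 by rewrite exprS ler_peMl// sqr_ge0.
  have w20 : 0 <= n%:R ^+ 2 :> R by exact: sqr_ge0.
  move=> /(ler_wpM2r w20); lra.
have Kw : 0 <= K ^+ k * w by rewrite ltW// mulr_gt0.
have := neg_pow_lower_trivial i0 ok T0 D.
have : n%:R * T ^+ k <= K ^+ k * w.
  rewrite /T exprMn mulrCA ler_wpM2l ?(ltW Kk)//.
  (* This is where [k] different from 3 matters: [n * sqrt n ^+ k <= n ^+ k.-1] rests on
     [k >= 4]. *)
  have k4 : (k <= 2 * (k - 2))%N.
    have : (3 < k)%N by rewrite ltn_neqAle eq_sym k3'.
    by clear; lia.
  have s1 : 1 <= Num.sqrt n%:R :> R by rewrite -[leLHS]sqrtr1 ler_wsqrtr.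
  apply: (@le_trans _ _ (n%:R * Num.sqrt n%:R ^+ (2 * (k - 2)))).
    by rewrite ler_wpM2l ?(ltW nR)// ler_weXn2l.
  rewrite exprM sqr_sqrtr ?(ltW nR)// -exprS /w.
  by have -> : (k - 2).+1 = k.-1 by move: k3; clear; lia.
lra.
Qed.

End UpperEstimates.

Section LowDensityUpper.
Variable R : realType.
Implicit Types (n k : nat).

Lemma ler_Pr_Gnm n m (P Q : pred (graph n)) :
  (forall G, G \in Gnm_support n m -> P G -> Q G) -> Pr_Gnm R m P <= Pr_Gnm R m Q.
Proof.
move=> PQ; rewrite /Pr_Gnm ler_wpM2r ?invr_ge0// ler_nat.
apply/subset_leq_card/fintype.subsetP => G; rewrite !finset.in_set => /andP[h1 h2].
by apply/andP; split=> //; apply: PQ; rewrite ?finset.in_set.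
Qed.

Lemma Pr_Gnm_ge0 n m (P : pred (graph n)) : 0 <= Pr_Gnm R m P.
Proof. exact: divr_ge0. Qed.

(** [Q] is a side condition that improves the passage from [neg_pow] to [neg_mass] by a factor
    [lam]. The low event then lies in the union of a large [neg_mass] and, for [k = 3], an
    exceptional cubic statistic. *)
Lemma low_event_Pr n m k (p K C eps C0 tn lam : R) (Q : pred (graph n)) :
  (3 <= k)%N -> odd k -> (k <= n)%N -> 0 < p -> p <= 2^-1 -> 1 <= K ->
  108 <= kappa p * K ^+ 2 -> 0 < tn -> 0 < eps -> eps < 1 -> 0 < lam ->
  `|m%:R - p * 'C(n, 2)%:R| <= C0 -> p + 2 * C0 <= p * n%:R -> 2 * C0 <= 'C(n, 2)%:R ->
  k%:R ^+ 2 + k%:R * (p + 2 * C0) + 3 * K ^+ k <= eps / 2 * (tn ^+ k * n%:R) ->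
  C <= (1 - eps) ^+ 2 * lam * (tn ^+ 2 * n%:R) ->
  (k = 3%N -> 16 <= eps / 2 * (tn ^+ 3 * n%:R)) ->
  (k = 3%N -> kappa p / 2 * lam <= eps ^+ 2 / (9216 * K ^+ 4) * (tn ^+ 4 * n%:R)) ->
  (forall S : R, 0 < S -> C * n%:R <= S ^+ 2 ->
    bernP p (all_edges n) (fun G => S ^+ 2 <= neg_mass (K * Num.sqrt n%:R) G) <=
    expR (- ((1 - eps) * (kappa p / 2) * S ^+ 2))) ->
  (forall G T, 0 <= T -> G \in Gnm_support n m -> Q G ->
    (1 - eps) * (tn ^+ k * n%:R ^+ k) <= neg_pow k T G ->
    (1 - eps) ^+ 2 * lam * (tn ^+ 2 * n%:R ^+ 2) <= neg_mass T G) ->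
  Pr_Gnm R m [pred G | Q G && (tau R k G <= p ^+ k - tn ^+ k)] <=
  expR (2 * n%:R + C0 ^+ 2 / (p * (1 - p))) *
   (expR (- ((1 - eps) * (kappa p / 2) * ((1 - eps) ^+ 2 * lam * (tn ^+ 2 * n%:R ^+ 2)))) +
    4 * n%:R * expR (- (kappa p / 2 * lam * (tn ^+ 2 * n%:R ^+ 2)))).
Proof.
move=> k3 ok kn p0 p2 K1 hK tn0 e0 e1 l0 hm hC0 hC0' hyp hC h16 h4 rate hQ.
have n3 : (3 <= n)%N by exact: leq_trans kn.
have n2 : (2 <= n)%N by exact: leq_trans n3.
have n0 : (0 < n)%N by exact: leq_trans n3.
have nR : 0 < n%:R :> R by rewrite ltr0n.
set S2 := (1 - eps) ^+ 2 * lam * (tn ^+ 2 * n%:R ^+ 2).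
set Y := eps / 2 * (tn ^+ 3 * n%:R ^+ 3).
set T := K * Num.sqrt n%:R.
have T0 : 0 <= T by rewrite mulr_ge0 ?sqrtr_ge0//; lra.
pose A : pred (graph n) := fun G => S2 <= neg_mass T G.
(* Empty unless [k = 3], so that one union bound serves all [k]. *)
pose B : pred (graph n) := fun G => (k == 3%N) && (cube_pos T G - cube_neg T G <= - Y).
have p01 : 0 <= p <= 1 by apply/andP; split; lra.
apply: (@le_trans _ _ (Pr_Gnm R m (predU A B))).
  apply: ler_Pr_Gnm => G GS /andP[QG lowG]; apply/orP.
  have [BG|nB] := boolP (B G); [by right|left].
  apply: hQ => //; apply: (low_tau_neg_pow k3 ok kn p0 p2 K1 tn0 e0 hm hC0 hyp GS lowG) => k3'.
  by move: nB; rewrite /B k3' eqxx/= -ltNge.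
apply: le_trans (Pr_Gnm_le_exp _ p0 p2 n2 hm hC0') _.
apply: ler_wpM2l; first exact: expR_ge0.
apply: le_trans (bernPU _ _ _ p01) _; apply: lerD.
  have S20 : 0 < S2 by rewrite !mulr_gt0// ?exprn_gt0//; lra.
  have SE : Num.sqrt S2 ^+ 2 = S2 by rewrite sqr_sqrtr// ltW.
  have h := rate (Num.sqrt S2); rewrite SE sqrtr_gt0 in h; apply: h => //.
  have := ler_wpM2r (ltW nR) hC; rewrite /S2; move: (1 - eps) => w.
  have -> : w ^+ 2 * lam * (tn ^+ 2 * n%:R) * n%:R = w ^+ 2 * lam * (tn ^+ 2 * n%:R ^+ 2) by ring.
  by [].
have [k3'|k3'] := eqVneq k 3%N; last first.
  have -> : bernP p (all_edges n) B = 0.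
    have -> : B = pred0 by apply/funext => G; rewrite /B (negbTE k3').
    exact: bern_cst.
  by rewrite !mulr_ge0// expR_ge0.
have h16' : 16 * n%:R ^+ 2 <= Y.
  have := ler_wpM2r (ltW (exprn_gt0 2 nR)) (h16 k3'); rewrite /Y => /le_trans; apply.
  by apply: eq_ler; ring.
have -> : B = (fun G => cube_pos T G - cube_neg T G <= - Y).
  by apply/funext => G; rewrite /B k3' eqxx.
apply: le_trans (cube_diff_rate n0 p0 p2 K1 hK h16') _.
apply: ler_wpM2l; first by rewrite mulr_ge0.
have K0 : K != 0 by rewrite gt_eqF//; lra.
rewrite ler_expR lerN2; have u0 : 0 <= tn ^+ 2 * n%:R ^+ 2 by rewrite mulr_ge0 ?exprn_ge0// ltW.
apply: le_trans (ler_wpM2r u0 (h4 k3')) _; rewrite /Y.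
by apply: eq_ler; field; rewrite K0 gt_eqF.
Qed.

Lemma rate_combine (a1 a2 b c nu u d : R) : 1 <= nu -> b <= a1 -> b <= a2 -> 0 <= u ->
  6 * nu + c <= d * u ->
  expR (2 * nu + c) * (expR (- (a1 * u)) + 4 * nu * expR (- (a2 * u))) <=
  expR (- ((b - d) * u)).
Proof.
move=> nu1 ba1 ba2 u0 hd.
have e1 : expR (- (a1 * u)) <= expR (- (b * u)) by rewrite ler_expR lerN2 ler_wpM2r.
have e2 : expR (- (a2 * u)) <= expR (- (b * u)) by rewrite ler_expR lerN2 ler_wpM2r.
have e3 : 1 + 4 * nu <= expR (4 * nu) by exact: expR_ge1Dx.
apply: (@le_trans _ _ (expR (2 * nu + c) * (expR (4 * nu) * expR (- (b * u))))).
  apply: ler_wpM2l; first exact: expR_ge0.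
  have h : 4 * nu * expR (- (a2 * u)) <= 4 * nu * expR (- (b * u)) by apply: ler_wpM2l => //; lra.
  have := ler_wpM2r (expR_ge0 (- (b * u))) e3; lra.
rewrite -!expRD ler_expR; lra.
Qed.

Lemma cube_loss (eps a d : R) : 0 <= eps -> eps <= 1 -> 3 * eps * a <= d / 2 -> 0 <= a ->
  a - d / 2 <= (1 - eps) ^+ 3 * a /\ a - d / 2 <= a.
Proof.
move=> e0 e1 ea a0.
have -> : (1 - eps) ^+ 3 * a = a - 3 * eps * a + eps ^+ 2 * (3 - eps) * a by ring.
have : 0 <= eps ^+ 2 * (3 - eps) * a.
  by rewrite !mulr_ge0 ?sqr_ge0// subr_ge0; lra.
have : 0 <= 3 * eps * a by rewrite !mulr_ge0.
by move=> h1 h2; split; lra.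
Qed.

End LowDensityUpper.

(** * The planted lower bound *)

Section UniformSubsets.
Variable I : finType.
Implicit Types (E C G : {set I}).

(** A uniform [m]-subset contains [C] with probability at most [(m / |E|)^|C|], as without
    replacement each further element is less likely: [(m - c) / (N - c) <= m / N]. *)
Lemma card_supersets_le E C m : C \subset E -> (m <= #|E|)%N ->
  (#|[set G : {set I} | [&& G \subset E, #|G| == m & C \subset G]%SET]| * #|E| ^ #|C| <=
   'C(#|E|, m) * m ^ #|C|)%N.
Proof.
move=> CE mE; have [Cm|mC] := leqP #|C| m; last first.
  rewrite (_ : [set G : {set I} | _]%SET = finset.set0) ?cards0//.
  apply/setP => G; rewrite !inE; apply/negbTE/negP => /and3P[_ /eqP Gm /subset_leq_card].
  by rewrite Gm leqNgt mC.
have -> : #|[set G : {set I} | [&& G \subset E, #|G| == m & C \subset G]%SET]| =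
   'C(#|E| - #|C|, m - #|C|).
  have <- : #|E :\: C|%SET = (#|E| - #|C|)%N by rewrite cardsD (finset.setIidPr CE).
  rewrite -cards_draws.
  have inj : {in [set H : {set I} | (H \subset E :\: C)%SET && (#|H| == (m - #|C|)%N)]%SET &,
      injective (fun H => C :|: H)%SET}.
    move=> H H'; rewrite !inE => /andP[/fintype.subsetP sH _] /andP[/fintype.subsetP sH' _] /setP HH.
    apply/setP => x; have := HH x; rewrite !inE.
    have := sH x; have := sH' x; rewrite !inE.
    case: (x \in C) => [/= a b _|//].
    by case: (x \in H) b => [/(_ isT)|_] //; case: (x \in H') a => [/(_ isT)|].
  rewrite -(card_in_imset inj); apply: eq_card => G; rewrite !inE; apply/and3P/imsetP.
    move=> [GE /eqP Gm CG]; exists (G :\: C)%SET; last first.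
      apply/setP => x; rewrite !inE; have /fintype.subsetP/(_ x) := CG.
      by case: (x \in C) => //= ->.
    by rewrite inE finset.setSD//= cardsD (finset.setIidPr CG) Gm.
  move=> [H]; rewrite inE => /andP[HE /eqP Hm] ->; split.
  - by rewrite finset.subUset CE (fintype.subset_trans HE)// finset.subsetDl.
  - rewrite cardsU (_ : (C :&: H)%SET = finset.set0) ?cards0 ?subn0 ?Hm ?subnKC//.
    apply/setP => x; rewrite !inE; have /fintype.subsetP/(_ x) := HE; rewrite !inE.
    by case: (x \in C); case: (x \in H) => //= /(_ isT).
  - exact: finset.subsetUl.
elim: #|C| Cm => [|c IH] cm; first by rewrite !subn0 !expn0.
have {}IH := IH (ltnW cm); set N := #|E| in mE IH *.
have Ec : (0 < N - c)%N by rewrite subn_gt0 (leq_trans cm).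
have mc : (0 < m - c)%N by rewrite subn_gt0.
have D : ((N - c) * 'C(N - c.+1, m - c.+1) = (m - c) * 'C(N - c, m - c))%N.
  by rewrite -(subnSK (leq_trans cm mE)) -(subnSK cm) mul_bin_diag.
rewrite -(leq_pmul2l Ec) !expnSr.
have -> : ((N - c) * ('C(N - c.+1, m - c.+1) * (N ^ c * N)) =
   ('C(N - c, m - c) * N ^ c) * ((m - c) * N))%N.
  by rewrite mulnA D; ring.
apply: leq_trans (leq_mul IH (_ : (m - c) * N <= m * (N - c))%N) _.
  by move: mE (ltnW cm); clear; nia.
by rewrite leq_eqVlt; apply/orP; left; apply/eqP; ring.
Qed.

Section TwoClasses.
Variables (E1 E2 : {set I}) (m1 m2 : nat).
Hypothesis dis : [disjoint E1 & E2].

Definition two_class : {set {set I}} :=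
  [set G : {set I} | [&& G \subset E1 :|: E2, #|G :&: E1| == m1 & #|G :&: E2| == m2]%SET].

Lemma card_two_class_superset C : C \subset (E1 :|: E2)%SET ->
  (#|[set G in two_class | C \subset G]%SET| <=
   #|[set G : {set I} | [&& G \subset E1, #|G| == m1 & C :&: E1 \subset G]%SET]| *
   #|[set G : {set I} | [&& G \subset E2, #|G| == m2 & C :&: E2 \subset G]%SET]|)%N.
Proof.
move=> CE; rewrite -cardsX.
have inj : {in [set G in two_class | C \subset G]%SET &,
    injective (fun G => (G :&: E1, G :&: E2)%SET)}.
  move=> G G'; rewrite !inE => /andP[/and3P[GE _ _] _] /andP[/and3P[GE' _ _] _] [e1 e2].
  by rewrite -(finset.setIidPl GE) -(finset.setIidPl GE') !finset.setIUr e1 e2.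
rewrite -(card_in_imset inj); apply/subset_leq_card/fintype.subsetP => _ /imsetP[G + ->].
rewrite !inE /= => /andP[/and3P[GE -> ->] CG].
by rewrite !finset.subsetIr !finset.setSI.
Qed.

Lemma card_two_class : ('C(#|E1|, m1) * 'C(#|E2|, m2) <= #|two_class|)%N.
Proof.
rewrite -!cards_draws -cardsX.
have dE x : x \in E1 -> x \in E2 -> False.
  by move=> x1 x2; move/pred0P : dis => /(_ x) /=; rewrite x1 x2.
have r (H1 H2 : {set I}) : H1 \subset E1 -> H2 \subset E2 ->
   ((H1 :|: H2) :&: E1 = H1)%SET /\ ((H1 :|: H2) :&: E2 = H2)%SET.
  move=> /fintype.subsetP h1 /fintype.subsetP h2; split; apply/setP => x; rewrite !inE;
    have := h1 x; have := h2 x; have := dE x;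
    case: (x \in H1); case: (x \in H2); case: (x \in E1); case: (x \in E2) => //= a b c;
    by [case: (a isT isT)|have := b isT|have := c isT].
pose f (u : {set I} * {set I}) := (u.1 :|: u.2)%SET.
have inj : {in finset.setX [set B : {set I} | (B \subset E1) && (#|B| == m1)]%SET
   [set B : {set I} | (B \subset E2) && (#|B| == m2)]%SET &, injective f}.
  move=> [a b] [a' b']; rewrite !inE /= => /andP[/andP[a1 _] /andP[b1 _]] /andP[/andP[a1' _] /andP[b1' _]].
  rewrite /f /= => E; have [e1 e2] := r _ _ a1 b1; have [e1' e2'] := r _ _ a1' b1'.
  by congr (_, _); [rewrite -e1 -e1' E|rewrite -e2 -e2' E].
rewrite -(card_in_imset inj); apply/subset_leq_card/fintype.subsetP => _ /imsetP[[a b] + ->].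
rewrite !inE /f /= => /andP[/andP[a1 /eqP am] /andP[b1 /eqP bm]].
by have [-> ->] := r _ _ a1 b1; rewrite finset.setUSS// am bm !eqxx.
Qed.

End TwoClasses.
End UniformSubsets.

(** * The partition of the edges by parity and the planted first moment *)

Section ParityClasses.
Variable n : nat.

Definition odd_vertices : {set 'I_n} := [set i : 'I_n | odd i].

Definition same_edges : {set {set 'I_n}} :=
  [set e : {set 'I_n} in all_edges n | (e \subset odd_vertices) || (e \subset ~: odd_vertices)%SET].

Definition cross_edges : {set {set 'I_n}} := (all_edges n :\: same_edges)%SET.

Lemma card_odd_vertices : #|odd_vertices| = n./2.
Proof.
rewrite -sum1_card (eq_bigl (fun i : 'I_n => odd i)); last by move=> i; rewrite inE.
rewrite big_mkcond /=; elim: (n) => [|k IH]; first by rewrite big_ord0.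
by rewrite big_ord_recr /= IH -[RHS]/(uphalf k) uphalf_half addnC; case: (odd k).
Qed.

(** Equivalently, the cross edges outnumber the others by exactly [n./2], so the two classes are
    nearly balanced. *)
Lemma card_same_edges : (2 * #|same_edges| + n./2 = 'C(n, 2))%N.
Proof.
have two j : (2 * 'C(j, 2) = j * j.-1)%N.
  by have := bin_ffact j 2; rewrite ffactnS ffactn1 mulnC => <-.
have -> : #|same_edges| = ('C(n./2, 2) + 'C(n - n./2, 2))%N.
  have -> : same_edges = ([set e : {set 'I_n} | (e \subset odd_vertices) && (#|e| == 2)] :|:
     [set e : {set 'I_n} | (e \subset ~: odd_vertices) && (#|e| == 2)])%SET.
    by apply/setP => e; rewrite !inE andb_orr ![(#|e| == 2%N) && _]andbC.
  rewrite cardsU !cards_draws card_odd_vertices cardsCs finset.setCK card_odd_vertices card_ord.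
  rewrite (_ : (_ :&: _)%SET = finset.set0) ?cards0 ?subn0//.
  apply/setP => e; rewrite !inE; apply/negbTE/negP => /andP[/andP[e1 /eqP e2] /andP[e3 _]].
  have : (e \subset odd_vertices :&: ~: odd_vertices)%SET by rewrite finset.subsetI e1 e3.
  by rewrite finset.setICr finset.subset0 => /eqP e0; rewrite e0 cards0 in e2.
have := two n; have := two n./2; have := two (n - n./2)%N.
have nE := odd_double_half n; have : (odd n <= 1)%N by case: (odd n).
move: (n./2) (odd n : nat) nE => h o; rewrite -mul2n; move: 'C(h, 2) 'C(n - h, 2) 'C(n, 2).
clear; move=> x y z nE o1; have -> : (n - h = o + h)%N by lia.
have pr j : (j * j.-1 + j = j * j)%N by case: j => //= j; rewrite mulSn; lia.
move=> hy hx hz; have := pr (o + h)%N; have := pr h; have := pr n.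
rewrite -hy -hx -hz; clear pr hy hx hz; rewrite -nE.
by case: o o1 {nE} => [|[|//]] _; nia.
Qed.

Lemma same_sub : same_edges \subset all_edges n.
Proof. by apply/fintype.subsetP => e; rewrite inE => /andP[]. Qed.

Lemma same_cross_union : (same_edges :|: cross_edges = all_edges n)%SET.
Proof. apply/setP => e; rewrite finset.in_setU finset.in_setD.
have /fintype.subsetP/(_ e) := same_sub.
by case: (e \in same_edges) => //= ->. Qed.

Lemma same_cross_disjoint : [disjoint same_edges & cross_edges].
Proof. by rewrite finset.disjoints_subset finset.setCD finset.subsetUr. Qed.

Lemma card_cross_edges : #|cross_edges| = ('C(n, 2) - #|same_edges|)%N.
Proof. by rewrite cardsD (finset.setIidPr same_sub) card_all_edges. Qed.

Lemma mem_same a b : a != b -> ([set a; b] \in same_edges) = (odd a == odd b).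
Proof.
move=> ab; rewrite inE; have -> /= : [set a; b] \in all_edges n by apply/edgeP; exists a, b.
rewrite !finset.subUset !finset.sub1set !inE.
by case: (odd a); case: (odd b).
Qed.

End ParityClasses.

Section PlantedMatrix.
Variable R : realType.
Implicit Types (n k : nat) (q : R).

Definition planted_mx n q1 q2 : 'M[R]_n := \matrix_(i, j) (if odd i == odd j then q1 else q2).

Lemma sum_sign_even M : \sum_(j < M.*2) (-1) ^+ j = 0 :> R.
Proof.
elim: M => [|M IH]; first by rewrite big_ord0.
by rewrite doubleS !big_ord_recr /= IH add0r exprS mulN1r subrr.
Qed.

(* [planted_mx] is a combination of the orthogonal rank-one matrices [1 1^T] and [x x^T], *)
(* where [x] is the vector of the signs [(-1) ^+ i]. *)
Lemma trace_planted_even M k q1 q2 : (0 < k)%N ->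
  \tr (planted_mx M.*2 q1 q2 ^+ k) =
  (M.*2)%:R ^+ k * (((q1 + q2) / 2) ^+ k + ((q1 - q2) / 2) ^+ k).
Proof.
case: k => // k _; set N := M.*2; pose J : 'M[R]_N := const_mx 1.
pose X : 'M[R]_N := \matrix_(i, j) ((-1) ^+ i * (-1) ^+ j).
set a := (q1 + q2) / 2; set c := (q1 - q2) / 2.
have QE : planted_mx N q1 q2 = a *: J + c *: X.
  apply/matrixP => i j; rewrite !mxE -[(-1) ^+ i]signr_odd -[(-1) ^+ j]signr_odd /a /c.
  by case: (odd i); case: (odd j) => /=; rewrite ?expr1 ?expr0; field.
have JJ : J *m J = N%:R *: J.
  apply/matrixP => i j; rewrite !mxE; under eq_bigr do rewrite !mxE mulr1.
  by rewrite sumr_const card_ord mulr1.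
have XX : X *m X = N%:R *: X.
  apply/matrixP => i j; rewrite !mxE.
  transitivity (\sum_(l < N) (-1) ^+ i * (-1) ^+ j : R).
    apply: eq_bigr => l _; rewrite !mxE.
    by rewrite -mulrA (mulrA ((-1) ^+ l)) -expr2 sqrr_sign mul1r.
  by rewrite sumr_const card_ord mulr_natl.
have JX : J *m X = 0.
  apply/matrixP => i j; rewrite !mxE.
  under eq_bigr do rewrite !mxE mul1r.
  by rewrite -mulr_suml sum_sign_even mul0r.
have XJ : X *m J = 0.
  apply/matrixP => i j; rewrite !mxE.
  under eq_bigr do rewrite !mxE mulr1.
  by rewrite -mulr_sumr sum_sign_even mulr0.
have pw : planted_mx N q1 q2 ^+ k.+1 = (N%:R ^+ k * a ^+ k.+1) *: J + (N%:R ^+ k * c ^+ k.+1) *: X.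
  elim: k => [|k IH]; first by rewrite !expr0 !expr1 !mul1r.
  rewrite exprS IH QE -[_ * _]/(_ *m _) mulmxDl !mulmxDr -!scalemxAl -!scalemxAr JJ XX JX XJ.
  rewrite !scaler0 addr0 add0r !scalerA; congr (_ *: _ + _ *: _); rewrite !exprS; ring.
have trJ : \tr J = N%:R.
  by rewrite /mxtrace; under eq_bigr do rewrite mxE; rewrite sumr_const card_ord.
have trX : \tr X = N%:R.
  rewrite /mxtrace; under eq_bigr => i _ do rewrite mxE -expr2 sqrr_sign.
  by rewrite sumr_const card_ord.
rewrite pw mxtraceD !mxtraceZ trJ trX -/a -/c; rewrite !exprS; ring.
Qed.

(* Reduces odd [n] to [trace_planted_even]. *)
Lemma trace_planted_mono n n' k q1 q2 : (0 < k)%N -> (n <= n')%N -> 0 <= q1 -> 0 <= q2 ->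
  \tr (planted_mx n q1 q2 ^+ k) <= \tr (planted_mx n' q1 q2 ^+ k).
Proof.
move=> k0 nn q10 q20; rewrite !trace_walk//.
pose w (phi : {ffun 'I_k -> 'I_n}) : {ffun 'I_k -> 'I_n'} := [ffun i => widen_ord nn (phi i)].
have winj : injective w.
  move=> phi psi /ffunP E; apply/ffunP => i; have := E i; rewrite !ffunE => /(congr1 val) /= h.
  exact/val_inj.
have pos n0 (psi : {ffun 'I_k -> 'I_n0}) : 0 <= \prod_i planted_mx n0 q1 q2 (psi i) (psi (ordS i)).
  by apply: prodr_ge0 => i _; rewrite mxE; case: ifP.
apply: (@le_trans _ _ (\sum_(psi in [set w phi | phi in finset.setT]%SET)
    \prod_i planted_mx n' q1 q2 (psi i) (psi (ordS i)))); last first.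
  by rewrite [leRHS](bigID (mem [set w phi | phi in finset.setT]%SET)) /= lerDl sumr_ge0.
rewrite big_imset /=; last by move=> ? ? _ _; exact: winj.
apply: eq_ler; apply: eq_big => [phi|phi _]; first by rewrite finset.in_setT.
by apply: eq_bigr => i _; rewrite !mxE !ffunE.
Qed.

Lemma ordS_neq k (i : 'I_k) : (1 < k)%N -> i != ordS i.
Proof.
move=> k1; apply/negP => /eqP /(congr1 val) /=.
have [h|h] := ltnP i.+1 k; first by rewrite modn_small// => /eqP; rewrite -[X in X == _]addn0 -addn1 eqn_add2l.
have -> : i.+1 = k by apply/eqP; rewrite eqn_leq ltn_ord h.
by rewrite modnn => i0; move: h; rewrite i0 leqNgt k1.
Qed.

Lemma ordS2_neq k (i : 'I_k) : (2 < k)%N -> i != ordS (ordS i).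
Proof.
move=> k2; apply/negP => /eqP /(congr1 val) /=; have := ltn_ord i.
move: (nat_of_ord i) => j jk; have [h|h] := ltnP j.+1 k.
  rewrite (modn_small h); have [h'|h'] := ltnP j.+2 k.
    by rewrite modn_small// => /eqP; rewrite -[X in X == _]addn0 -addn2 eqn_add2l.
  have -> : j.+2 = k by apply/eqP; rewrite eqn_leq h.
  by rewrite modnn => j0; move: h'; rewrite j0 leqNgt k2.
have -> : j.+1 = k by apply/eqP; rewrite eqn_leq jk.
rewrite modnn modn_small; last by apply: leq_trans k2.
by move=> j1; move: h; rewrite j1 leqNgt k2.
Qed.

Definition cycle_edges n k (phi : {ffun 'I_k -> 'I_n}) : {set {set 'I_n}} :=
  [set [set phi i; phi (ordS i)] | i : 'I_k].

Lemma cycle_edge_inj n k (phi : {ffun 'I_k -> 'I_n}) : (2 < k)%N -> injective phi ->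
  injective (fun i => [set phi i; phi (ordS i)]).
Proof.
move=> k2 ip i j E.
have hi : phi i \in [set phi j; phi (ordS j)] by rewrite -E !inE eqxx.
have hs : phi (ordS i) \in [set phi j; phi (ordS j)] by rewrite -E !inE eqxx orbT.
move: hi; rewrite !inE => /orP[/eqP /ip //|/eqP /ip ij].
move: hs; rewrite !inE => /orP[/eqP /ip sij|/eqP /ip sij].
  by have := ordS2_neq j k2; rewrite -ij sij eqxx.
by have := ordS_neq i (ltnW k2); rewrite sij -ij eqxx.
Qed.

(** An injective [phi] has [k] distinct edges, as [k > 2], split between two independent uniform
    subsets. [card_supersets_le] for each class bounds the probability that all are present by the
    weight of the closed walk [phi] in [planted_mx]. *)
Lemma planted_expectation n k m1 m2 : (2 < k)%N ->
  (m1 <= #|same_edges n|)%N -> (m2 <= #|cross_edges n|)%N ->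
  (0 < #|same_edges n|)%N -> (0 < #|cross_edges n|)%N ->
  \sum_(G in two_class (same_edges n) (cross_edges n) m1 m2) (T_ k G)%:R <=
  ('C(#|same_edges n|, m1) * 'C(#|cross_edges n|, m2))%:R *
  \tr (planted_mx n (m1%:R / #|same_edges n|%:R) (m2%:R / #|cross_edges n|%:R) ^+ k).
Proof.
move=> k2 m1N m2N N10 N20; have k0 : (0 < k)%N by exact: leq_trans k2.
set E1 := same_edges n in m1N N10 *; set E2 := cross_edges n in m2N N20 *.
set N1 := #|E1| in m1N N10 *; set N2 := #|E2| in m2N N20 *.
set q1 := m1%:R / N1%:R; set q2 := m2%:R / N2%:R.
have q10 : 0 <= q1 by rewrite divr_ge0.
have q20 : 0 <= q2 by rewrite divr_ge0.
set TC := two_class E1 E2 m1 m2.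
have -> : \sum_(G in TC) (T_ k G)%:R =
   \sum_(phi : {ffun 'I_k -> 'I_n}) \sum_(G in TC)
     (injectiveb phi && [forall i, [set phi i; phi (ordS i)] \in G])%:R :> R.
  rewrite exchange_big /=; apply: eq_bigr => G _.
  rewrite /T_ -sum1_card natr_sum big_mkcond /=; apply: eq_bigr => phi _.
  by rewrite inE; case: ifP.
rewrite trace_walk// mulr_sumr; apply: ler_sum => phi _.
have [/injectiveP ip|ni] := boolP (injectiveb phi); last first.
  rewrite big1; last by move=> G _.
  rewrite mulr_ge0//; apply: prodr_ge0 => i _; rewrite mxE; by case: ifP.
pose C := cycle_edges phi.
have CE : C \subset (E1 :|: E2)%SET.
  rewrite same_cross_union; apply/fintype.subsetP => _ /imsetP[i _ ->].
  by apply/edgeP; exists (phi i), (phi (ordS i)); rewrite (inj_eq ip) ordS_neq// ltnW.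
have -> : \sum_(G in TC) (true && [forall i, [set phi i; phi (ordS i)] \in G])%:R =
    #|[set G in TC | C \subset G]%SET|%:R :> R.
  rewrite -sum1_card natr_sum big_mkcond [RHS]big_mkcond /=; apply: eq_bigr => G _.
  have -> : (G \in [set G in TC | C \subset G]%SET) = (G \in TC) && (C \subset G) by rewrite finset.in_set.
  case: (G \in TC) => //=.
  have -> : [forall i, [set phi i; phi (ordS i)] \in G] = (C \subset G).
    apply/forallP/fintype.subsetP => [h _ /imsetP[i _ ->]//|h i].
    by apply: h; apply/imsetP; exists i.
  by case: ifP.
apply: (@le_trans _ _ (('C(N1, m1)%:R * q1 ^+ #|C :&: E1|%SET) * ('C(N2, m2)%:R * q2 ^+ #|C :&: E2|%SET))).
  apply: (@le_trans _ _ (#|[set G : {set _} | [&& G \subset E1, #|G| == m1 & C :&: E1 \subset G]%SET]|%:R *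
   #|[set G : {set _} | [&& G \subset E2, #|G| == m2 & C :&: E2 \subset G]%SET]|%:R)).
    rewrite -natrM ler_nat; exact: card_two_class_superset.
  have one (E : {set {set 'I_n}}) m : (0 < #|E|)%N -> (m <= #|E|)%N ->
    #|[set G : {set _} | [&& G \subset E, #|G| == m & C :&: E \subset G]%SET]|%:R <=
     'C(#|E|, m)%:R * (m%:R / #|E|%:R) ^+ #|C :&: E|%SET :> R.
    move=> E0 mE; have := card_supersets_le (finset.subsetIr C E) mE.
    rewrite -(ler_nat R) !natrM !natrX expr_div_n mulrA ler_pdivlMr//.
    by rewrite exprn_gt0// ltr0n.
  by apply: ler_pM; rewrite ?ler0n//; exact: one.
rewrite mulrACA natrM ler_wpM2l//; apply: eq_ler.
transitivity (\prod_(e in C) (if e \in E1 then q1 else q2)).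
  rewrite (bigID (mem E1)) /= -!prodr_const; congr (_ * _).
    by apply: eq_big => e; rewrite finset.in_setI => // /andP[_ ->].
  have EE e : (e \in C :&: E2)%SET = (e \in C) && (e \notin E1).
    rewrite finset.in_setI; case eC : (e \in C) => //=.
    have := fintype.subsetP CE e eC; rewrite finset.in_setU /E2 finset.in_setD -/E1.
    by case: (e \in E1) => //= ->.
  by apply: eq_big => e; rewrite EE => // /andP[_ /negbTE ->].
rewrite /C /cycle_edges big_imset /=; last by move=> i j _ _; exact: (cycle_edge_inj k2 ip).
by apply: eq_bigr => i _; rewrite mem_same ?mxE// (inj_eq ip) ordS_neq// ltnW.
Qed.

(** Markov's inequality with slack [1 - 1/n] leaves at least a fraction [1/n] of good graphs. The
    [n.+1] comes from rounding [n] up to an even number. *)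
Lemma planted_low_count n k m1 m2 (x : R) : (2 < k)%N -> odd k -> (k <= n)%N ->
  (m1 <= #|same_edges n|)%N -> (m2 <= #|cross_edges n|)%N ->
  (0 < #|same_edges n|)%N -> (0 < #|cross_edges n|)%N ->
  let q1 := m1%:R / #|same_edges n|%:R in let q2 := m2%:R / #|cross_edges n|%:R in
  0 < x -> q1 <= q2 ->
  n.+1%:R ^+ k * (((q1 + q2) / 2) ^+ k - ((q2 - q1) / 2) ^+ k) <=
    (n ^_ k)%:R * x * (1 - n%:R^-1) ->
  ('C(#|same_edges n|, m1) * 'C(#|cross_edges n|, m2))%:R / n%:R <=
  #|[set G in Gnm_support n (m1 + m2) | tau R k G <= x]%SET|%:R :> R.
Proof.
move=> k2 ok kn m1N m2N N10 N20 q1 q2 x0 q12 hx.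
have k0 : (0 < k)%N by exact: leq_trans k2.
have n0 : (0 < n)%N := leq_trans k0 kn.
have nR : 0 < n%:R :> R by rewrite ltr0n.
have f0 : 0 < (n ^_ k)%:R :> R by rewrite ltr0n ffact_gt0.
set TC := two_class (same_edges n) (cross_edges n) m1 m2.
pose Z := ('C(#|same_edges n|, m1) * 'C(#|cross_edges n|, m2))%N.
have ZT : Z%:R <= #|TC|%:R :> R by rewrite ler_nat card_two_class// same_cross_disjoint.
have q10 : 0 <= q1 by rewrite divr_ge0.
have q20 : 0 <= q2 by rewrite divr_ge0.
have E : \sum_(G in TC) (T_ k G)%:R <= Z%:R * ((n ^_ k)%:R * x * (1 - n%:R^-1)).
  apply: le_trans (planted_expectation k2 m1N m2N N10 N20) _.
  rewrite -/q1 -/q2 -/Z ler_wpM2l//; apply: le_trans hx.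
  have nM : (n <= (uphalf n).*2)%N by rewrite uphalf_half doubleD; have := odd_double_half n; case: (odd n) => /= <-; clear; lia.
  have Mn : ((uphalf n).*2 <= n.+1)%N by rewrite uphalf_half doubleD; have := odd_double_half n; case: (odd n) => /= <-; clear; lia.
  apply: le_trans (trace_planted_mono k0 nM q10 q20) _.
  rewrite trace_planted_even//.
  have -> : (q1 - q2) / 2 = - ((q2 - q1) / 2) by ring.
  rewrite exprNn -signr_odd ok expr1 mulN1r.
  have d0 : 0 <= (q2 - q1) / 2 by rewrite divr_ge0// subr_ge0.
  apply: ler_wpM2r; first by rewrite subr_ge0 lerXn2r// ?nnegrE//; lra.
  by rewrite lerXn2r// ?nnegrE// ler_nat.
set good := [set G in TC | tau R k G <= x]%SET.
have gS : #|good|%:R <= #|[set G in Gnm_support n (m1 + m2) | tau R k G <= x]%SET|%:R :> R.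
  rewrite ler_nat; apply/subset_leq_card/fintype.subsetP => G; rewrite !inE => /andP[/and3P[GE /eqP G1 /eqP G2] ->].
  rewrite same_cross_union in GE; rewrite GE andbT /=; apply/eqP.
  rewrite -(finset.setIidPl GE) -same_cross_union finset.setIUr cardsU G1 G2.
  rewrite (_ : (_ :&: _)%SET = finset.set0) ?cards0 ?subn0//.
  apply/setP => e; rewrite !inE; apply/negbTE/negP => /andP[/andP[_ /andP[e1 e1']] /andP[_ /andP[e2 _]]].
  by rewrite e1 e1' in e2.
apply: le_trans gS.
have bad : (#|TC|%:R - #|good|%:R) * ((n ^_ k)%:R * x) <= \sum_(G in TC) (T_ k G)%:R.
  have -> : #|TC|%:R - #|good|%:R = \sum_(G in TC) (~~ (tau R k G <= x))%:R :> R.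
    rewrite -!sum1_card !natr_sum.
    rewrite [X in _ - X](_ : _ = \sum_(G in TC) (tau R k G <= x)%R%:R); last first.
      rewrite big_mkcond [RHS]big_mkcond /=; apply: eq_bigr => G _; rewrite inE.
      by case: (G \in TC) => //=; case: ifP.
    by rewrite -sumrB; apply: eq_bigr => G _; case: (_ <= _); rewrite /= ?subrr ?subr0.
  rewrite mulr_suml; apply: ler_sum => G _; case: (boolP (tau R k G <= x)) => /= [_|].
    by rewrite mul0r ler0n.
  by rewrite mul1r -ltNge /tau ltr_pdivlMr// mulrC => /ltW.
have fx : 0 < (n ^_ k)%:R * x by rewrite mulr_gt0.
have h := le_trans bad E.
have {h} : #|TC|%:R - #|good|%:R <= Z%:R * (1 - n%:R^-1) :> R.
  by rewrite -(ler_pM2r fx); apply: le_trans h _; apply: eq_ler; ring.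
rewrite -/Z; lra.
Qed.

End PlantedMatrix.

(** * Densities and probability of the planted graphs *)

Section PlantedProbability.
Variable R : realType.
Implicit Types (n k : nat).

(** [a] is the mean and [b] the half-difference of the two densities, with rounding errors [D / n].
    Taking [s >= (1 + eps) t] gains [eps t^k n^k], which pays for all errors of order [n^(k-1)]. *)
Lemma planted_density n k (p a b s tn eps D : R) : (0 < k)%N -> (0 < n)%N ->
  0 < p -> 0 <= D -> p + D / n%:R <= 1 -> a <= p + D / n%:R -> 0 <= b -> b <= a ->
  s - D / n%:R <= b -> D / n%:R <= s -> s <= 1 ->
  0 <= tn -> tn <= p -> 0 <= eps -> (1 + eps) * tn <= s ->
  2 * k%:R * D + k%:R * 2 ^+ k + k%:R ^+ 2 + 1 <= eps * (tn ^+ k * n%:R) ->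
  n.+1%:R ^+ k * (a ^+ k - b ^+ k) <= (n ^_ k)%:R * (p ^+ k - tn ^+ k) * (1 - n%:R^-1).
Proof.
move=> k0 n0 p0 D0 pD aD b0 ba sb Ds s1 tn0 tnp e0 es hyp.
have v0 : 0 < n%:R :> R by rewrite ltr0n.
have v1 : 1 <= n%:R :> R by rewrite ler1n.
have Dn0 : 0 <= D / n%:R by rewrite divr_ge0// ltW.
have ak : a ^+ k <= p ^+ k + k%:R * (D / n%:R).
  have h := @exprB_ge R (p + D / n%:R) (D / n%:R) 1 k Dn0.
  have {}h := h ltac:(lra) pD; rewrite expr1n mulr1 addrK in h.
  have : a ^+ k <= (p + D / n%:R) ^+ k by rewrite lerXn2r// nnegrE; lra.
  lra.
have bk : s ^+ k - k%:R * (D / n%:R) <= b ^+ k.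
  have h := @exprB_ge R s (D / n%:R) 1 k Dn0 Ds s1; rewrite expr1n mulr1 in h.
  have : (s - D / n%:R) ^+ k <= b ^+ k by rewrite lerXn2r// nnegrE; lra.
  lra.
have sk : (1 + eps) * tn ^+ k <= s ^+ k.
  apply: (@le_trans _ _ (((1 + eps) * tn) ^+ k)); last first.
    have ht : 0 <= (1 + eps) * tn by rewrite mulr_ge0//; lra.
    by rewrite lerXn2r// nnegrE; lra.
  rewrite exprMn; apply: ler_wpM2r; first exact: exprn_ge0.
  by rewrite -[leLHS]expr1; apply: ler_weXn2l => //; lra.
set x := p ^+ k - tn ^+ k.
have x0 : 0 <= x by rewrite subr_ge0 lerXn2r// nnegrE; lra.
have p1 : p <= 1 by lra.
have x1 : x <= 1.
  have := exprn_ile1 k (ltW p0) p1; have := exprn_ge0 k tn0; rewrite /x; lra.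
set X := a ^+ k - b ^+ k.
have X0 : 0 <= X by rewrite subr_ge0 lerXn2r// nnegrE; lra.
have X1 : X <= 1.
  have a1 : a <= 1 by lra.
  have a0 : 0 <= a by lra.
  have := exprn_ile1 k a0 a1; have := exprn_ge0 k b0; rewrite /X; lra.
have Xx : X <= x - eps * tn ^+ k + 2 * (k%:R * (D / n%:R)) by rewrite /X /x; lra.
set w := n%:R ^+ k.-1 : R.
have w0 : 0 < w by rewrite exprn_gt0.
have nk : n%:R ^+ k = n%:R * w by rewrite -exprS prednK.
have S1 : n.+1%:R ^+ k <= n%:R * w + k%:R * 2 ^+ k * w.
  have h := @exprB_ge R n.+1%:R 1 n.+1%:R k ler01 _ (lexx _).
  have {}h := h ltac:(by rewrite ler1n); rewrite -[X in X - 1]natr1 addrK nk mulr1 in h.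
  have h2 : n.+1%:R ^+ k.-1 <= 2 ^+ k * w :> R.
    apply: (@le_trans _ _ ((2 * n%:R) ^+ k.-1)); first by rewrite lerXn2r// ?nnegrE -?natrM ?ler_nat// mul2n -addnn -addn1 leq_add2l.
    rewrite exprMn; apply: ler_wpM2r; [exact: ltW|apply: ler_weXn2l; [lra|exact: leq_pred]].
  have := ler_wpM2l (ler0n R k) h2; lra.
have S2 : n%:R * w - k%:R ^+ 2 * w <= (n ^_ k)%:R.
  have := expn_le_ffact n k; rewrite -(ler_nat R) natrD natrM !natrX nk -/w; lra.
have S3 : (n ^_ k)%:R / n%:R <= w.
  rewrite ler_pdivrMr// mulrC -nk -natrX ler_nat; exact: ffact_le_expn.
have L1 : n.+1%:R ^+ k * X <= n%:R * w * X + k%:R * 2 ^+ k * w.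
  have := ler_wpM2r X0 S1; rewrite mulrDl.
  have : k%:R * 2 ^+ k * w * X <= k%:R * 2 ^+ k * w.
    by apply: ler_piMr => //; rewrite !mulr_ge0// ?exprn_ge0// ltW.
  lra.
have L2 : n%:R * w * x - k%:R ^+ 2 * w - w <= (n ^_ k)%:R * x * (1 - n%:R^-1).
  have := ler_wpM2r x0 S2; rewrite mulrBl.
  have : k%:R ^+ 2 * w * x <= k%:R ^+ 2 * w by apply: ler_piMr => //; rewrite !mulr_ge0// ltW.
  have : (n ^_ k)%:R / n%:R * x <= w.
    by apply: le_trans S3; apply: ler_piMr => //; rewrite divr_ge0// ltW.
  have -> : (n ^_ k)%:R * x * (1 - n%:R^-1) = (n ^_ k)%:R * x - (n ^_ k)%:R / n%:R * x by ring.
  lra.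
have L3 : n%:R * w * X <= n%:R * w * x - (eps * (tn ^+ k * n%:R)) * w + 2 * k%:R * D * w.
  have nw : 0 <= n%:R * w by rewrite mulr_ge0// ltW.
  apply: le_trans (ler_wpM2l nw Xx) _.
  have nn : n%:R != 0 :> R by rewrite gt_eqF.
  by apply: eq_ler; field.
have L4 := ler_wpM2r (ltW w0) hyp.
rewrite !mulrDl mul1r in L4; lra.
Qed.

Lemma planted_chi2 (N1 N2 p s th c C1 : R) : 1 <= N1 -> N1 <= N2 ->
  0 <= s -> s <= 1 -> 0 <= th -> th <= 1 -> `|c| <= C1 ->
  N1 * (p - s - th / N1 - p) ^+ 2 + N2 * (p + (s * N1 + c) / N2 - p) ^+ 2 <=
  s ^+ 2 * (N1 + N2) + (3 + 2 * C1 + C1 ^+ 2).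
Proof.
move=> N11 N12 s0 s1 th0 th1 /ler_normlP[cl cu].
have N10 : N1 != 0 by apply: lt0r_neq0; lra.
have N20 : N2 != 0 by apply: lt0r_neq0; lra.
have C10 : 0 <= C1 by lra.
have -> : N1 * (p - s - th / N1 - p) ^+ 2 = s ^+ 2 * N1 + 2 * (s * th) + th ^+ 2 / N1 by field.
have -> : N2 * (p + (s * N1 + c) / N2 - p) ^+ 2 = (s * N1 + c) ^+ 2 / N2 by field.
have a1 : s * th <= 1 by apply: mulr_ile1.
have a2 : th ^+ 2 / N1 <= 1.
  rewrite ler_pdivrMr ?mul1r; last lra.
  by apply: le_trans N11; apply: exprn_ile1.
have a3 : (s * N1 + c) ^+ 2 / N2 <= s ^+ 2 * N2 + 2 * C1 + C1 ^+ 2.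
  rewrite ler_pdivrMr; last lra.
  have sN : s * N1 <= s * N2 by rewrite ler_wpM2l.
  have sN0 : 0 <= s * N1 by rewrite mulr_ge0//; lra.
  apply: (@le_trans _ _ ((s * N2 + C1) ^+ 2)).
    by rewrite -subr_ge0 subr_sqr mulr_ge0; lra.
  have h : s * N2 * C1 <= N2 * C1 by apply: ler_wpM2r => //; apply: ler_piMl; lra.
  have h' : C1 ^+ 2 <= C1 ^+ 2 * N2 by apply: ler_peMr; [exact: sqr_ge0|lra].
  nra.
lra.
Qed.

(** The rounding [th], the correction [c] and the imbalance [N2 - N1] each move the two averages by
    [O(1 / nu)]. *)
Lemma planted_means (nu N1 N2 p s th c C1 : R) : 1 <= nu -> 1 <= N1 -> N2 - N1 <= nu / 2 ->
  N1 <= N2 -> nu ^+ 2 <= 8 * N2 ->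
  0 <= s -> s <= 1 -> 0 <= th -> `|c| <= C1 ->
  ((p - s - th / N1) + (p + (s * N1 + c) / N2)) / 2 <= p + (2 + 4 * C1) / nu /\
  s - (2 + 4 * C1) / nu <= ((p + (s * N1 + c) / N2) - (p - s - th / N1)) / 2.
Proof.
move=> nu1 N11 hN N12 nuN s0 s1 th0 /ler_normlP[cl cu].
have N2p : 0 < N2 by lra.
have N1p : 0 < N1 by lra.
have nup : 0 < nu by lra.
have C10 : 0 <= C1 by lra.
have t0 : 0 <= th / N1 by rewrite divr_ge0// ltW.
have c1 : C1 / N2 <= 8 * C1 / nu.
  rewrite ler_pdivrMr// mulrAC ler_pdivlMr//.
  have : nu <= 8 * N2 by apply: le_trans nuN; rewrite expr2 ler_peMl// ltW.
  by move=> h; have := ler_wpM2l C10 h; lra.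
have c2 : c / N2 <= C1 / N2 by rewrite ler_pM2r ?invr_gt0//; lra.
have c3 : - (C1 / N2) <= c / N2 by rewrite -mulNr ler_pM2r ?invr_gt0//; lra.
have h1 : (N2 - N1) / N2 <= 4 / nu.
  rewrite ler_pdivrMr// mulrAC ler_pdivlMr//.
  have : (N2 - N1) * nu <= nu / 2 * nu by rewrite ler_pM2r.
  lra.
have -> : (s * N1 + c) / N2 = s - s * ((N2 - N1) / N2) + c / N2.
  by field; rewrite gt_eqF.
have N120 : 0 <= (N2 - N1) / N2 by apply: divr_ge0; lra.
have h2 : 0 <= s * ((N2 - N1) / N2) by exact: mulr_ge0.
have h3 : s * ((N2 - N1) / N2) <= 4 / nu.
  by apply: le_trans h1; exact: ler_piMl.
have i0 : 0 <= nu^-1 by rewrite invr_ge0 ltW.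
have e1 : 8 * C1 / nu = 8 * (C1 / nu) by ring.
have e2 : (2 + 4 * C1) / nu = 2 * nu^-1 + 4 * (C1 / nu) by ring.
rewrite e1 in c1; rewrite e2.
split; lra.
Qed.

Lemma Pr_Gnm_ge_count n m (p : R) (P : pred (graph n)) : 0 < p -> p < 1 -> (m <= 'C(n, 2))%N ->
  #|[set G in Gnm_support n m | P G]%SET|%:R * (p ^+ m * (1 - p) ^+ ('C(n, 2) - m)) <=
  Pr_Gnm R m P.
Proof.
move=> p0 p1 mN; rewrite /Pr_Gnm ler_wpM2l// card_Gnm_support.
have C0 : 0 < 'C('C(n, 2), m)%:R :> R by rewrite ltr0n bin_gt0.
rewrite -(ler_pM2l C0) divff ?gt_eqF//.
have p01 : 0 <= p <= 1 by rewrite !ltW.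
have := card_Gnm_le_bernP m (predT : pred (graph n)) p01.
have -> : bernP p (all_edges n) predT = 1 by exact: bern_cst.
have -> : [set G in Gnm_support n m | predT G]%SET = Gnm_support n m.
  by apply/setP => G; rewrite finset.in_set andbT.
by rewrite card_Gnm_support.
Qed.

End PlantedProbability.

Section PlantedLower.
Variable R : realType.
Implicit Types (n k : nat).

Lemma class_sizes n (M1 := #|same_edges n|%:R : R) (M2 := #|cross_edges n|%:R : R) :
  (4 <= n)%N ->
  [/\ M1 + M2 = 'C(n, 2)%:R, M1 <= M2, M2 - M1 <= n%:R / 2, n%:R ^+ 2 <= 8 * M1 &
      'C(n, 2)%:R <= n%:R ^+ 2 / 2 :> R].
Proof.
move=> n4; have N12 : (#|same_edges n| + #|cross_edges n| = 'C(n, 2))%N.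
  by rewrite card_cross_edges subnKC// -card_same_edges mul2n -addnn -addnA leq_addr.
have hR : 2 * M1 + (n./2)%:R = 'C(n, 2)%:R by rewrite -natrM -natrD card_same_edges.
have hR2 : 2 * (n./2)%:R <= n%:R :> R.
  by rewrite -natrM ler_nat mul2n -{2}(odd_double_half n) leq_addl.
have hR0 : 0 <= (n./2)%:R :> R by [].
have M12 : M1 + M2 = 'C(n, 2)%:R by rewrite -natrD N12.
have : (2 * 'C(n, 2) = n * n.-1)%N by rewrite -mul_bin_diag bin1.
move=> /(congr1 (fun j => j%:R : R)); rewrite !natrM -subn1 natrB ?(leq_trans _ n4)// => NE.
have nu4 : 4 <= n%:R :> R by rewrite ler_nat.
have nunu : 4 * n%:R <= n%:R * n%:R :> R by apply: ler_wpM2r => //; lra.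
move: hR hR2 hR0 M12 NE nu4 nunu; clearbody M1 M2; clear; rewrite expr2.
move: ('C(n, 2)%:R) (n%:R) ((n./2)%:R) => N nu h; split; lra.
Qed.

(** [m1] is the integer part of [(p - s) N1], with fractional part [th]; [m2] takes the remaining
    edges, so [c] collects [th] and the deviation of [m] from its target. *)
Lemma planted_edge_counts (N1 N2 m : nat) (p s C0 : R) : (0 < N1)%N -> (0 < N2)%N ->
  (N1 <= N2)%N -> 0 < p -> p <= 2^-1 -> 0 <= s -> s <= 4^-1 -> s <= p ->
  `|m%:R - p * (N1%:R + N2%:R)| <= C0 -> C0 <= p * N2%:R -> 4 * (C0 + 1) <= N2%:R ->
  exists m1 m2 th c,
    [/\ (m1 + m2 = m)%N, (m1 <= N1)%N & (m2 <= N2)%N] /\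
    [/\ 0 <= th, th <= 1, `|c| <= C0 + 1, m1%:R / N1%:R = p - s - th / N1%:R &
        m2%:R / N2%:R = p + (s * N1%:R + c) / N2%:R].
Proof.
move=> N10 N20 N12; have M1p : 0 < N1%:R :> R by rewrite ltr0n.
have M2p : 0 < N2%:R :> R by rewrite ltr0n.
have M12 : N1%:R <= N2%:R :> R by rewrite ler_nat.
set M1 : R := N1%:R in M1p M12 *; set M2 : R := N2%:R in M2p M12 *.
move=> p0 p2 s0 s4 sp /ler_normlP[cl cu] pM2 CM2.
pose y := (p - s) * M1.
have y0 : 0 <= y by rewrite mulr_ge0// ?subr_ge0// ltW.
have /andP[m1l m1u] := trunc_itv y0; move: (Num.Def.trunc y) m1l m1u => m1 m1l.
rewrite -natr1 => m1u.
have sM0 : 0 <= s * M1 by rewrite mulr_ge0// ltW.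
have m1m : m1%:R <= m%:R :> R by rewrite /y in m1l m1u; lra.
have m1N : m1%:R <= M1.
  by apply: le_trans m1l _; apply: ler_piMl; lra.
have mE : (m1 + (m - m1) = m)%N by rewrite subnKC// -(ler_nat R).
have m2E : (m - m1)%:R = m%:R - m1%:R :> R by rewrite natrB// -(ler_nat R).
exists m1, (m - m1)%N, (y - m1%:R), (m%:R - p * (M1 + M2) + (y - m1%:R)).
have a1 : p * M2 <= 2^-1 * M2 by rewrite ler_pM2r.
have a2 : s * M1 <= 4^-1 * M2 by apply: ler_pM => //; lra.
do 2?split => //.
- by rewrite -(ler_nat R).
- by rewrite -(ler_nat R) m2E -/M2; rewrite /y in m1l m1u; lra.
- lra.
- lra.
- by rewrite ler_norml; apply/andP; split; lra.
- by rewrite /y; field; rewrite gt_eqF.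
- by rewrite m2E /y; field; rewrite gt_eqF.
Qed.

(** The [5 nu] is [2 nu] for the polynomial factor of each binomial coefficient and [nu] for the
    fraction lost to Markov's inequality. *)
Lemma binomial_pair_ge (N1 N2 m1 m2 : nat) (p nu s c3 : R) : 0 < p -> p < 1 ->
  (0 < N1)%N -> (0 < N2)%N -> (m1 <= N1)%N -> (m2 <= N2)%N ->
  2 <= nu -> N1%:R <= nu ^+ 2 / 2 -> N2%:R <= nu ^+ 2 / 2 ->
  N1%:R * (m1%:R / N1%:R - p) ^+ 2 + N2%:R * (m2%:R / N2%:R - p) ^+ 2 <=
    s ^+ 2 * (nu ^+ 2 / 2) + c3 ->
  expR (- (s ^+ 2 * nu ^+ 2 / (2 * p * (1 - p)) + c3 / (p * (1 - p)) + 5 * nu)) <=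
  ('C(N1, m1) * 'C(N2, m2))%:R / nu * (p ^+ (m1 + m2) * (1 - p) ^+ (N1 + N2 - (m1 + m2))).
Proof.
move=> p0 p1 N10 N20 m1N m2N nu2 N1nu N2nu chi.
have Z0 : 0 < p * (1 - p) by rewrite mulr_gt0// subr_gt0.
have nup : 0 < nu by lra.
have nuE : nu <= expR nu by apply: le_trans (expR_ge1Dx nu); lra.
have small (N : nat) : N%:R <= nu ^+ 2 / 2 -> expR (- (2 * nu)) <= N.+1%:R^-1 :> R.
  move=> hN; rewrite expRN lef_pV2 ?posrE ?expR_gt0 ?ltr0n//.
  apply: (@le_trans _ _ (nu ^+ 2)).
    have : 2 * 2 <= nu ^+ 2 by rewrite expr2; apply: ler_pM.
    by rewrite -natr1; lra.
  by rewrite expRM_natl lerXn2r// nnegrE; [exact: ltW|exact: expR_ge0].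
have sm1 := small N1 N1nu; have sm2 := small N2 N2nu.
have sm3 : expR (- nu) <= nu^-1 by rewrite expRN lef_pV2 ?posrE ?expR_gt0.
have B1 := binomial_ge p0 p1 N10 m1N; have B2 := binomial_ge p0 p1 N20 m2N.
set e1 := N1%:R * _ / _ in B1; set e2 := N2%:R * _ / _ in B2.
have expo : e1 + e2 <= s ^+ 2 * nu ^+ 2 / (2 * p * (1 - p)) + c3 / (p * (1 - p)).
  have -> : s ^+ 2 * nu ^+ 2 / (2 * p * (1 - p)) = s ^+ 2 * (nu ^+ 2 / 2) / (p * (1 - p)).
    by field; rewrite !gt_eqF// subr_gt0.
  by rewrite -!mulrDl ler_pM2r ?invr_gt0.
apply: (@le_trans _ _ ((expR (- (2 * nu)) * expR (- e1)) * (expR (- (2 * nu)) * expR (- e2)) * expR (- nu))).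
  by rewrite -!expRD ler_expR; move: expo; clear; lra.
set b1 := 'C(N1, m1)%:R * p ^+ m1 * _ in B1; set b2 := 'C(N2, m2)%:R * p ^+ m2 * _ in B2.
have -> : ('C(N1, m1) * 'C(N2, m2))%:R / nu *
  (p ^+ (m1 + m2) * (1 - p) ^+ (N1 + N2 - (m1 + m2))) = b1 * b2 * nu^-1.
  have subnD2 (a b c d : nat) : (c <= a)%N -> (d <= b)%N -> (a + b - (c + d) = (a - c) + (b - d))%N.
    by clear; lia.
  by rewrite subnD2// !exprD natrM /b1 /b2; ring.
have pos a1 a2 : 0 <= expR a1 * expR a2 :> R by rewrite mulr_ge0// expR_ge0.
apply: ler_pM => //.
apply: ler_pM => //.
  by apply: le_trans B1; apply: ler_wpM2r => //; exact: expR_ge0.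
by apply: le_trans B2; apply: ler_wpM2r => //; exact: expR_ge0.
Qed.

Lemma planted_lower n k m (p tn eps C0 : R) :
  (3 <= k)%N -> odd k -> (k <= n)%N -> (4 <= n)%N -> 0 < p -> p <= 2^-1 ->
  0 < tn -> 0 < eps -> (1 + eps) * tn <= p / 2 ->
  `|m%:R - p * 'C(n, 2)%:R| <= C0 ->
  2 + 4 * (C0 + 1) <= (1 + eps) * tn * n%:R ->
  2 * (2 + 4 * (C0 + 1)) <= n%:R -> 2 * C0 <= p * n%:R ->
  2 * k%:R * (2 + 4 * (C0 + 1)) + k%:R * 2 ^+ k + k%:R ^+ 2 + 1 <= eps * (tn ^+ k * n%:R) ->
  expR (- ((1 + eps) ^+ 2 * (tn ^+ 2 * n%:R ^+ 2) / (2 * p * (1 - p)) +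
           (3 + 2 * (C0 + 1) + (C0 + 1) ^+ 2) / (p * (1 - p)) + 5 * n%:R)) <=
  Pr_Gnm R m (fun G : graph n => tau R k G <= p ^+ k - tn ^+ k).
Proof.
move=> k3 ok kn n4 p0 p2 tn0 e0 hs hm hD hD2 hC0 hyp.
have k0 : (0 < k)%N by exact: leq_trans k3.
have n0 : (0 < n)%N by exact: leq_trans n4.
have nu4 : 4 <= n%:R :> R by rewrite ler_nat.
have C00 : 0 <= C0 by apply: le_trans hm.
have tns : tn <= (1 + eps) * tn by apply: ler_peMl; [exact: ltW|lra].
have [s sE] : exists s, s = (1 + eps) * tn by exists ((1 + eps) * tn).
have -> : (1 + eps) ^+ 2 * (tn ^+ 2 * n%:R ^+ 2) = s ^+ 2 * n%:R ^+ 2.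
  by rewrite sE exprMn mulrA.
have es : (1 + eps) * tn <= s by rewrite sE.
rewrite -sE in hs hD tns; clear sE.
have s0 : 0 <= s by lra.
have [s4 s1 sp p1 tnp] : [/\ s <= 4^-1, s <= 1, s <= p, p < 1 & tn < p].
  by move: p0 p2 hs tns; clear; split; lra.
have D0 : 0 <= 2 + 4 * (C0 + 1) by lra.
have nup : 0 < n%:R :> R by rewrite ltr0n.
have nu1 : 1 <= n%:R :> R by rewrite ler1n.
have nu2 : 2 <= n%:R :> R by lra.
have Ds : (2 + 4 * (C0 + 1)) / n%:R <= s by rewrite ler_pdivrMr.
have pD : p + (2 + 4 * (C0 + 1)) / n%:R <= 1.
  have : (2 + 4 * (C0 + 1)) / n%:R <= 2^-1 by rewrite ler_pdivrMr//; lra.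
  by move: p2; clear; lra.
have [] := class_sizes n4.
set N1 := #|same_edges n|; set N2 := #|cross_edges n|.
move=> M12 MM hM M1lo MN.
have nn : 4 * n%:R <= n%:R ^+ 2 :> R by rewrite expr2 ler_pM2r.
have M1l : n%:R <= 2 * N1%:R :> R by move: nn M1lo; clear; lra.
have M11 : 1 <= N1%:R :> R by move: nu4 M1l; clear; lra.
have N10 : (0 < N1)%N by rewrite -(ltr_nat R); apply: lt_le_trans M11.
have N12 : (N1 <= N2)%N by rewrite -(ler_nat R).
have N20 : (0 < N2)%N by exact: leq_trans N12.
have NE : (N1 + N2 = 'C(n, 2))%N by apply/eqP; rewrite -(eqr_nat R) natrD M12.
rewrite -M12 in hm MN.
have pM2 : C0 <= p * N2%:R.
  have : p * n%:R <= p * (2 * N2%:R) by apply: ler_wpM2l; [exact: ltW|move: M1l MM; clear; lra].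
  by move: hC0; clear; lra.
have CM2 : 4 * (C0 + 1) <= N2%:R by move: hD2 M1l MM C00; clear; lra.
have [m1 [m2 [th [c [[mE m1N m2N] [th0 th1 cC1 q1E q2E]]]]]] :=
  planted_edge_counts N10 N20 N12 p0 p2 s0 s4 sp hm pM2 CM2.
have M2lo : n%:R ^+ 2 <= 8 * N2%:R :> R by move: M1lo MM; clear; lra.
have [ha hb] := planted_means p nu1 M11 hM MM M2lo s0 s1 th0 cC1.
rewrite -q1E -q2E in ha hb.
have b0 := le_trans (etrans (subr_ge0 _ _) Ds : 0 <= _) hb.
have [q12 bq] : m1%:R / N1%:R <= m2%:R / N2%:R :> R /\
    (m2%:R / N2%:R - m1%:R / N1%:R) / 2 <= (m1%:R / N1%:R + m2%:R / N2%:R) / 2 :> R.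
  have : 0 <= m1%:R / N1%:R :> R by rewrite divr_ge0.
  by move: b0; move: (m1%:R / _) (m2%:R / _) => a b; clear; split; lra.
have x0 : 0 < p ^+ k - tn ^+ k by rewrite subr_gt0 ltrXn2r// ?nnegrE ?ltW// -lt0n.
have dens := planted_density k0 n0 p0 D0 pD ha b0 bq hb Ds s1 (ltW tn0) (ltW tnp) (ltW e0) es hyp.
have cnt := planted_low_count k3 ok kn m1N m2N N10 N20 x0 q12 dens.
rewrite mE in cnt.
have mN : (m <= 'C(n, 2))%N by rewrite -mE -NE leq_add.
apply: le_trans (Pr_Gnm_ge_count _ p0 p1 mN).
have w0 : 0 <= p ^+ m * (1 - p) ^+ ('C(n, 2) - m).
  by apply: mulr_ge0; apply: exprn_ge0; rewrite ?subr_ge0 ltW.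
apply: le_trans (ler_wpM2r w0 cnt).
rewrite -mE -NE; apply: binomial_pair_ge => //.
- by move: MN; apply: le_trans; rewrite lerDl.
- by move: MN; apply: le_trans; rewrite lerDr.
have chi := planted_chi2 p M11 MM s0 s1 th0 th1 cC1.
rewrite -q1E -q2E in chi; apply: le_trans chi _.
by rewrite lerD2r; apply: ler_wpM2l => //; exact: sqr_ge0.
Qed.

End PlantedLower.

(** * Asymptotics *)

Local Open Scope classical_set_scope.
Local Open Scope ring_scope.

Section AsymptoticTools.
Variable R : realType.

Lemma near_ge_natr (C : R) : \forall n \near \oo, C <= n%:R.
Proof.
near=> n; apply: (@le_trans _ _ ((Num.bound `|C|)%:R)).
  by apply: le_trans (ler_norm _) _; apply/ltW; apply: archi_boundP.
by rewrite ler_nat; near: n; exact: nbhs_infty_ge.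
Unshelve. all: by end_near. Qed.

Lemma limn_esup_le_near (u : (\bar R)^nat) (l : \bar R) :
  (\forall n \near \oo, (u n <= l)%E) -> (limn_esup u <= l)%E.
Proof.
move=> [N _ hN]; rewrite limn_esup_lim; apply: lime_le; first exact: is_cvg_esups.
exists N => // n /= Nn; apply: ge_ereal_sup => _ [j /= nj <-].
by apply: hN; exact: leq_trans nj.
Qed.

(** The error is the positive part of the excess of [ln f] over [- a u]; it is set to [0] where [f]
    vanishes and [ln] carries no information. *)
Lemma upper_rate_littleo (a : R) (u f : nat -> R) : (forall n, 0 <= u n) -> (forall n, 0 <= f n) ->
  (forall d, 0 < d -> \forall n \near \oo, f n <= expR (- ((a - d) * u n))) ->
  exists2 err : nat -> R^o, err =o_\oo (u : nat -> R^o) &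
    \forall n \near \oo, f n <= expR (- a * u n + err n).
Proof.
move=> u0 f0 hf.
exists (fun n => if 0 < f n then Num.max 0 (ln (f n) + a * u n) else 0).
  apply/eqoP => e e0; have := hf e e0; apply: filterS => n hn.
  case: ifP => [fp|_]; last by rewrite normr0 mulr_ge0// ltW.
  rewrite ger0_norm ?le_max ?lexx// ger0_norm// ge_max (mulr_ge0 (ltW e0) (u0 n))/=.
  have : ln (f n) <= ln (expR (- ((a - e) * u n))) by rewrite ler_ln ?posrE ?expR_gt0.
  by rewrite expRK; lra.
near=> n; case: ifP => [fp|/negbT]; last by rewrite -leNgt => /le_trans; apply; exact: expR_ge0.
rewrite -[leLHS]lnK ?posrE// ler_expR.
by have : ln (f n) + a * u n <= Num.max 0 (ln (f n) + a * u n) by [rewrite le_max lexx orbT]; lra.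
Unshelve. all: by end_near. Qed.

Lemma lower_rate_littleo (a : R) (u f : nat -> R) : (forall n, 0 <= u n) ->
  (forall d, 0 < d -> \forall n \near \oo, expR (- ((a + d) * u n)) <= f n) ->
  exists2 err : nat -> R^o, err =o_\oo (u : nat -> R^o) &
    \forall n \near \oo, expR (- a * u n + err n) <= f n.
Proof.
move=> u0 hf; exists (fun n => Num.min 0 (ln (f n) + a * u n)).
  apply/eqoP => e e0; have := hf e e0; apply: filterS => n hn.
  have fp : 0 < f n by apply: lt_le_trans hn; exact: expR_gt0.
  rewrite ler0_norm ?ge_min ?lexx// ger0_norm// lerNl le_min oppr_le0 (mulr_ge0 (ltW e0) (u0 n))/=.
  have : ln (expR (- ((a + e) * u n))) <= ln (f n) by rewrite ler_ln ?posrE ?expR_gt0.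
  by rewrite expRK; lra.
have := hf 1 ltr01; apply: filterS => n hn.
have fp : 0 < f n by apply: lt_le_trans hn; exact: expR_gt0.
rewrite -[leRHS]lnK ?posrE// ler_expR.
by have : Num.min 0 (ln (f n) + a * u n) <= ln (f n) + a * u n by [rewrite ge_min lexx orbT]; lra.
Qed.

Lemma c_star_le1 k : c_star R k <= 1.
Proof. by rewrite /c_star ge_min lexx. Qed.

Lemma c_star3 : c_star R 3 = 3 / 4.
Proof.
rewrite /c_star; have -> : 3%:R * (3%:R - 2) / (2 * 3%:R - 2) = 3 / 4 :> R by field.
by apply/min_idPr; lra.
Qed.

Lemma density_scale_small k (t : nat -> R) : (0 < k)%N -> (forall n, 0 < t n) ->
  (fun n : nat => t n ^+ k : R^o) =o_\oo (fun _ : nat => 1 : R^o) ->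
  forall e, 0 < e -> \forall n \near \oo, t n <= e.
Proof.
move=> k0 t0 /eqoP h e e0; have := h (e ^+ k) (exprn_gt0 _ e0); apply: filterS => n.
rewrite normr1 mulr1 ger0_norm ?exprn_ge0 ?(ltW (t0 n))// => hn.
by rewrite -(@ler_pXn2r _ k) ?nnegrE ?(ltW (t0 n)) ?(ltW e0).
Qed.

Lemma density_scale_large k (t : nat -> R) : (forall n, 0 < t n) ->
  (fun n : nat => n%:R `^ (- c_star R k) : R^o) =o_\oo (fun n : nat => t n ^+ k : R^o) ->
  forall C, \forall n \near \oo, C <= t n ^+ k * n%:R.
Proof.
move=> t0 /eqoP h C; have d0 : 0 < (`|C| + 1)^-1 by rewrite invr_gt0; have := normr_ge0 C; lra.
near=> n; have n0 : (0 < n)%N by near: n; exact: nbhs_infty_gt.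
have n1 : 1 <= n%:R :> R by rewrite ler1n.
have tk : 0 < t n ^+ k by exact: exprn_gt0.
have : `|n%:R `^ (- c_star R k)| <= (`|C| + 1)^-1 * `|t n ^+ k| by near: n; exact: h.
rewrite (ger0_norm (powR_ge0 _ _)) (ger0_norm (ltW tk)) => hn.
have : n%:R `^ (-1) <= n%:R `^ (- c_star R k).
  by apply: ler_powR => //; rewrite lerN2 c_star_le1.
rewrite powR_inv1 ?ler0n// => hn'.
have := le_trans hn' hn; rewrite mulrC ler_pdivlMr; last by have := normr_ge0 C; lra.
rewrite -ler_pdivlMl ?invr_gt0 ?ltr0n// invrK mulrC => h3.
by have := ler_norm C; rewrite mulrC; lra.
Unshelve. all: by end_near. Qed.

(** The fourth power of [n^(-3/4) << t^3] is [n^-3 << t^12], that is, [(t^4 n)^3] tends to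
    infinity. *)
Lemma density_scale_large3 (t : nat -> R) : (forall n, 0 < t n) ->
  (fun n : nat => n%:R `^ (- c_star R 3) : R^o) =o_\oo (fun n : nat => t n ^+ 3 : R^o) ->
  forall C, \forall n \near \oo, C <= t n ^+ 4 * n%:R.
Proof.
move=> t0 /eqoP h C; set D := `|C| + 1.
have D0 : 0 < D by have := normr_ge0 C; rewrite /D; lra.
have D1 : 1 <= D by have := normr_ge0 C; rewrite /D; lra.
have Di : 0 < D^-1 by rewrite invr_gt0.
near=> n; have n0 : (0 < n)%N by near: n; exact: nbhs_infty_gt.
have nR : 0 < n%:R :> R by rewrite ltr0n.
have tk : 0 < t n ^+ 3 by exact: exprn_gt0.
have : `|n%:R `^ (- c_star R 3)| <= D^-1 * `|t n ^+ 3| by near: n; exact: h.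
rewrite (ger0_norm (powR_ge0 _ _)) (ger0_norm (ltW tk)) c_star3 => hn.
have E : (n%:R `^ (- (3 / 4))) ^+ 4 * n%:R ^+ 3 = 1 :> R.
  rewrite -powR_mulrn ?powR_ge0// -powRrM (_ : - (3 / 4) * 4%:R = - 3%:R); last by field.
  by rewrite powRN powR_mulrn// mulVf// expf_neq0// gt_eqF.
have h4 : (n%:R `^ (- (3 / 4))) ^+ 4 <= (D^-1 * t n ^+ 3) ^+ 4.
  by rewrite lerXn2r// nnegrE ?powR_ge0// mulr_ge0// ltW.
have n3 : 0 < n%:R ^+ 3 :> R by exact: exprn_gt0.
have h5 := ler_wpM2r (ltW n3) h4; rewrite E in h5.
have x0 : 0 < t n ^+ 4 * n%:R by rewrite mulr_gt0// exprn_gt0.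
have h6 : D ^+ 4 <= (t n ^+ 4 * n%:R) ^+ 3.
  have -> : (t n ^+ 4 * n%:R) ^+ 3 = D ^+ 4 * ((D^-1 * t n ^+ 3) ^+ 4 * n%:R ^+ 3).
    by field; rewrite gt_eqF.
  by apply: ler_peMr => //; rewrite exprn_ge0// ltW.
apply: (@le_trans _ _ D); first by have := ler_norm C; rewrite /D; lra.
rewrite -(@ler_pXn2r _ 3) ?nnegrE ?(ltW D0) ?(ltW x0)//; apply: le_trans h6.
by apply: ler_weXn2l.
Unshelve. all: by end_near. Qed.

Lemma edge_count_close (p : R) (m : nat -> nat) :
  (fun n : nat => (m n)%:R - p * 'C(n, 2)%:R : R^o) =O_\oo (fun _ : nat => 1 : R^o) ->
  exists C0 : R, \forall n \near \oo, `|(m n)%:R - p * 'C(n, 2)%:R| <= C0.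
Proof.
move=> /eqOP [M [_ hM]]; exists (`|M| + 1).
have : M < `|M| + 1 by have := ler_norm M; lra.
by move/hM; apply: filterS => n /=; rewrite normr1 mulr1.
Qed.

End AsymptoticTools.

(** * Exponential rates in the range of the theorem *)

Section Rates.
Variables (R : realType) (k : nat) (p : R) (m : nat -> nat) (t : nat -> R).
Hypotheses (k_ge3 : (3 <= k)%N) (k_odd : odd k) (p_gt0 : 0 < p) (p_le_half : p <= 2^-1)
  (t_gt0 : forall n, 0 < t n)
  (t_small : forall e, 0 < e -> \forall n \near \oo, t n <= e)
  (t_large : forall C, \forall n \near \oo, C <= t n ^+ k * n%:R)
  (t_large3 : k = 3%N -> forall C, \forall n \near \oo, C <= t n ^+ 4 * n%:R).
Variable C0 : R.
Hypothesis (m_close : \forall n \near \oo, `|(m n)%:R - p * 'C(n, 2)%:R| <= C0).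

Let q_gt0 : 0 < 1 - p.
Proof. by move: p_le_half; lra. Qed.

Lemma t_pow_large j C : (j <= k)%N -> \forall n \near \oo, C <= t n ^+ j * n%:R.
Proof.
move=> jk; have := t_large C; have := t_small ltr01; apply: filterS2 => n t1 h.
apply: le_trans h _; apply: ler_wpM2r => //.
by apply: ler_wiXn2l => //; exact: ltW.
Qed.

Lemma t2n2_large a C : 0 < a -> \forall n \near \oo, C * n%:R <= a * (t n ^+ 2 * n%:R ^+ 2).
Proof.
move=> a0; have := @t_pow_large 2 (C / a) (ltnW k_ge3); apply: filterS => n.
rewrite ler_pdivrMr// => h; have := ler_wpM2r (ler0n R n) h => /le_trans; apply.
by apply: eq_ler; ring.
Qed.

Lemma t4_large C : \forall n \near \oo, k = 3%N -> C <= t n ^+ 4 * n%:R.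
Proof.
have [k3|/eqP k3] := eqVneq k 3%N; last by apply: nearW => n /k3.
by have := t_large3 k3 C; apply: filterS.
Qed.

Lemma low_event_rate (Q : forall n, pred (graph n)) (lam : R) : 0 < lam ->
  (forall eps n T (G : graph n), 0 < eps -> eps < 1 -> 0 <= T -> Q n G ->
    (1 - eps) * (t n ^+ k * n%:R ^+ k) <= neg_pow k T G ->
    (1 - eps) ^+ 2 * lam * (t n ^+ 2 * n%:R ^+ 2) <= neg_mass T G) ->
  forall d, 0 < d -> \forall n \near \oo,
    Pr_Gnm R (m n) [pred G : graph n | Q n G && (tau R k G <= p ^+ k - t n ^+ k)] <=
    expR (- ((kappa p / 2 * lam - d) * (t n ^+ 2 * n%:R ^+ 2))).
Proof.
move=> l0 hQ d d0; have kap := kappa_gt0 p_gt0 p_le_half.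
pose a := kappa p / 2 * lam; have a0 : 0 < a by rewrite !mulr_gt0.
(* The three factors [1 - eps] in the exponent cost at most [3 eps a <= d / 2]; the other half of
   [d] absorbs the terms of order [n]. *)
pose eps := Num.min 2^-1 (d / (6 * a)).
have e0 : 0 < eps by rewrite lt_min invr_gt0 ltr0n divr_gt0// mulr_gt0.
have e2 : eps <= 2^-1 by rewrite ge_min lexx.
have e1 : eps < 1 by lra.
have ea : 3 * eps * a <= d / 2.
  have : eps <= d / (6 * a) by rewrite ge_min lexx orbT.
  by rewrite ler_pdivlMr ?mulr_gt0//; lra.
have [K [C [K0 K1 C1 rate]]] := @neg_mass_rate R p eps (1 + 108 / kappa p) p_gt0 p_le_half e0 (ltW e1)
   ltac:(by rewrite addr_ge0// divr_ge0// ltW).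
have hK : 108 <= kappa p * K ^+ 2.
  have h : 108 <= kappa p * K by rewrite mulrC -ler_pdivrMr//; lra.
  apply: le_trans h _; apply: ler_wpM2l; [exact: ltW|].
  by rewrite expr2; apply: ler_peMl => //; lra.
pose c := C0 ^+ 2 / (p * (1 - p)).
have e2l : 0 < (1 - eps) ^+ 2 * lam by rewrite mulr_gt0// exprn_gt0//; lra.
have Kp : 0 < K by exact: lt_le_trans ltr01 K1.
have w4 : 0 < eps ^+ 2 / (9216 * K ^+ 4).
  apply: divr_gt0; first exact: exprn_gt0.
  by apply: mulr_gt0; [rewrite ltr0n|exact: exprn_gt0].
near=> n.
have kn : (k <= n)%N by near: n; exact: nbhs_infty_ge.
have n0 : (0 < n)%N by apply: leq_trans kn; exact: leq_trans k_ge3.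
have nR : 0 < n%:R :> R by rewrite ltr0n.
have n1 : 1 <= n%:R :> R by rewrite ler1n.
have u0 : 0 <= t n ^+ 2 * n%:R ^+ 2 by rewrite mulr_ge0 ?exprn_ge0// ltW.
apply: (le_trans (@low_event_Pr R n (m n) k p K C eps C0 (t n) lam (Q n) k_ge3 k_odd kn p_gt0 p_le_half
   K1 hK (t_gt0 n) e0 e1 l0 _ _ _ _ _ _ _ _ _)).
- by near: n; exact: m_close.
- rewrite [leRHS]mulrC -ler_pdivrMr//; near: n; exact: near_ge_natr.
- apply: (@le_trans _ _ n%:R); first by near: n; exact: near_ge_natr.
  rewrite ler_nat -(leq_pmul2l (ltn0Sn 1)) -mul_bin_diag bin1 mulnC leq_mul2l -ltnS prednK//.
  by apply/orP; right; exact: leq_trans kn.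
- rewrite -ler_pdivrMl ?divr_gt0//; near: n; exact: t_large.
- rewrite -ler_pdivrMl//; near: n; apply: t_pow_large; exact: ltnW.
- move=> k3; rewrite -ler_pdivrMl ?divr_gt0//; near: n; exact: t_pow_large.
- move=> k3; rewrite -ler_pdivrMl; first by move: k3; near: n; exact: t4_large.
  exact: w4.
- move=> S S0 CS; apply: rate => //; near: n; exact: near_ge_natr.
- by move=> G T T0 _ QG; apply: hQ.
set u := t n ^+ 2 * n%:R ^+ 2 in u0 *.
have -> : (1 - eps) * (kappa p / 2) * ((1 - eps) ^+ 2 * lam * u) = (1 - eps) ^+ 3 * a * u.
  by rewrite /a; ring.
rewrite -/a -/c; have -> : a - d = a - d / 2 - d / 2 by field.
have [b1 b2] := cube_loss (ltW e0) (ltW e1) ea (ltW a0).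
apply: rate_combine => //.
- apply: (@le_trans _ _ (7 * n%:R)); last by rewrite /u; near: n; apply: t2n2_large; rewrite divr_gt0.
  have -> : 7 * n%:R = 6 * n%:R + n%:R :> R by ring.
  rewrite lerD2l.
  by near: n; exact: near_ge_natr.
Unshelve. all: by end_near. Qed.

Lemma low_event_lower d : 0 < d -> \forall n \near \oo,
  expR (- ((1 / (2 * p * (1 - p)) + d) * (t n ^+ 2 * n%:R ^+ 2))) <=
  Pr_Gnm R (m n) (fun G : graph n => tau R k G <= p ^+ k - t n ^+ k).
Proof.
move=> d0; have [a aE] : exists a, a = 1 / (2 * p * (1 - p)) by exists (1 / (2 * p * (1 - p))).
have a0 : 0 < a by rewrite aE divr_gt0// !mulr_gt0.
pose eps := Num.min 1 (d / (6 * a)).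
have e0 : 0 < eps by rewrite lt_min ltr01 divr_gt0// mulr_gt0.
have e1 : eps <= 1 by rewrite ge_min lexx.
have ea : 3 * eps * a <= d / 2.
  have : eps <= d / (6 * a) by rewrite ge_min lexx orbT.
  by rewrite ler_pdivlMr ?mulr_gt0//; lra.
pose c := (3 + 2 * (C0 + 1) + (C0 + 1) ^+ 2) / (p * (1 - p)).
near=> n.
have kn : (k <= n)%N by near: n; exact: nbhs_infty_ge.
have n4 : (4 <= n)%N by near: n; exact: nbhs_infty_ge.
have n0 : (0 < n)%N by exact: leq_trans n4.
have nR : 0 < n%:R :> R by rewrite ltr0n.
have u0 : 0 <= t n ^+ 2 * n%:R ^+ 2 by rewrite mulr_ge0 ?exprn_ge0// ltW.
apply: le_trans (@planted_lower R n k (m n) p (t n) eps C0 k_ge3 k_odd kn n4 p_gt0 p_le_half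
  (t_gt0 n) e0 _ _ _ _ _ _).
- rewrite -/c; set u := t n ^+ 2 * n%:R ^+ 2 in u0 *.
  have -> : (1 + eps) ^+ 2 * u / (2 * p * (1 - p)) = (1 + eps) ^+ 2 * a * u by rewrite aE; ring.
  rewrite ler_expR lerN2 -aE.
  have h1 : (1 + eps) ^+ 2 * a <= a + d / 2.
    have : (1 + eps) ^+ 2 <= 1 + 3 * eps.
      have : eps * eps <= eps * 1 by apply: ler_wpM2l => //; exact: ltW.
      by rewrite expr2; lra.
    by move/(ler_wpM2r (ltW a0)); lra.
  have h2 : c <= n%:R by near: n; exact: near_ge_natr.
  have h3 : 6 * n%:R <= d / 2 * u by rewrite /u; near: n; apply: t2n2_large; rewrite divr_gt0.
  have := ler_wpM2r u0 h1; lra.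
- have : t n <= p / 4 by near: n; apply: t_small; rewrite divr_gt0.
  have := ler_wpM2r (ltW (t_gt0 n)) e1; lra.
- by near: n; exact: m_close.
- apply: (@le_trans _ _ (t n * n%:R)).
    by near: n; apply: (@t_pow_large 1); exact: ltnW (ltnW k_ge3).
  rewrite ler_wpM2r// ler_peMl ?(ltW (t_gt0 n))//; lra.
- by near: n; exact: near_ge_natr.
- rewrite [leRHS]mulrC -ler_pdivrMr//; near: n; exact: near_ge_natr.
- rewrite -ler_pdivrMl//; near: n; exact: t_large.
Unshelve. all: by end_near. Qed.

Lemma low_tau_rate d : 0 < d -> \forall n \near \oo,
  Pr_Gnm R (m n) (fun G : graph n => tau R k G <= p ^+ k - t n ^+ k) <=
  expR (- ((kappa p / 2 - d) * (t n ^+ 2 * n%:R ^+ 2))).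
Proof.
move=> d0; have h := @low_event_rate (fun n => predT) 1 ltr01 _ d d0; rewrite mulr1 in h.
apply: h => eps n T G e0 e1 T0 _ hG; rewrite mulr1 -!exprMn.
have w0 : 0 <= 1 - eps by lra.
have y0 : 0 <= t n * n%:R by rewrite mulr_ge0// ltW.
apply: (neg_mass_ge (k := k)); [exact: ltnW|by rewrite mulr_ge0|].
apply: le_trans hG; rewrite -[t n ^+ k * _]exprMn [leLHS]exprMn ler_wpM2r ?exprn_ge0//.
by rewrite -[leRHS]expr1; apply: ler_wiXn2l; [|lra|exact: leq_trans k_ge3].
Qed.

(** When no eigenvalue is below [- c t n], each [|x|^k] in [neg_pow] is at most [(c t n)^(k-2) x^2],
    so the sum of squares grows by [lam = c^(2-k)]. *)
Lemma low_tau_eigval_rate c d : 0 < c -> 0 < d -> \forall n \near \oo,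
  Pr_Gnm R (m n) [pred G : graph n | (- (c * t n * n%:R) < eigval (adjmx R G) n) &&
                                     (tau R k G <= p ^+ k - t n ^+ k)] <=
  expR (- ((kappa p / 2 * (c ^+ (k - 2))^-1 - d) * (t n ^+ 2 * n%:R ^+ 2))).
Proof.
move=> c0 d0; have l0 : 0 < (c ^+ (k - 2))^-1 by rewrite invr_gt0 exprn_gt0.
apply: (@low_event_rate (fun n G => - (c * t n * n%:R) < eigval (adjmx R G) n) _ l0 _ d d0).
move=> eps n T G e0 e1 T0 hE hG.
have B0 : 0 <= c * t n * n%:R by rewrite !mulr_ge0// ltW.
have sp x : x \in spectrum (adjmx R G) -> - (c * t n * n%:R) <= x.
  by move=> xs; apply: le_trans (ltW hE) _; apply: eigval_last_le => //; exact: adjmx_sym.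
have h := le_trans hG (neg_pow_le (ltnW k_ge3) B0 sp T0).
have [n0|n0] := eqVneq n 0%N.
  have -> : n%:R = 0 :> R by rewrite n0.
  by rewrite expr0n !mulr0; apply: sumr_ge0 => x _; exact: sqr_ge0.
have nR : 0 < n%:R :> R by rewrite ltr0n lt0n.
have y0 : 0 < t n * n%:R by rewrite mulr_gt0.
have w0 : 0 <= 1 - eps by lra.
rewrite -exprMn; rewrite -[t n ^+ k * _]exprMn -[c * t n * _]mulrA [(c * _) ^+ _]exprMn in h.
set y := t n * n%:R in y0 h *; set M := neg_mass T G in h *.
have cy : 0 < c ^+ (k - 2) * y ^+ (k - 2) by rewrite mulr_gt0// exprn_gt0.
apply: (@le_trans _ _ ((1 - eps) * (c ^+ (k - 2))^-1 * y ^+ 2)).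
  rewrite ler_wpM2r ?sqr_ge0// ler_wpM2r// ?(ltW l0)// expr2 ler_piMl//; lra.
rewrite -(ler_pM2l cy); apply: le_trans h; apply: eq_ler.
have -> : y ^+ k = y ^+ (k - 2) * y ^+ 2 by rewrite -exprD subnK// ltnW.
by field; rewrite gt_eqF// exprn_gt0.
Qed.

Lemma low_tau_eigval eps : 0 < eps -> exists2 c : R, 0 < c & \forall n \near \oo,
  cPr_Gnm R (m n) (fun G : graph n => - (c * t n * n%:R) < eigval (adjmx R G) n)
    (fun G => tau R k G <= p ^+ k - t n ^+ k) <= eps.
Proof.
move=> e0; have kap := kappa_gt0 p_gt0 p_le_half.
have [a aE] : exists a, a = 1 / (2 * p * (1 - p)) by exists (1 / (2 * p * (1 - p))).
have a0 : 0 < a by rewrite aE divr_gt0// !mulr_gt0.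
(* Chosen so that the rate with the eigenvalue condition is at least [a + 3]: after losing [1] in
   each of the two estimates, the conditional probability is at most [exp (- u)]. *)
pose b := kappa p / (2 * (a + 3)).
have b0 : 0 < b by rewrite divr_gt0// mulr_gt0//; lra.
have c0 : 0 < Num.min 1 b by rewrite lt_min ltr01.
exists (Num.min 1 b) => //; set c := Num.min 1 b in c0 *.
have ck : c ^+ (k - 2) <= b.
  apply: (@le_trans _ _ c); last by rewrite ge_min lexx orbT.
  rewrite -[leRHS]expr1; apply: ler_wiXn2l; [exact: ltW|by rewrite ge_min lexx|by rewrite subn_gt0].
have rate : a + 3 <= kappa p / 2 * (c ^+ (k - 2))^-1.
  rewrite ler_pdivlMr ?exprn_gt0//.
  apply: le_trans (ler_wpM2l (_ : 0 <= a + 3) ck) _; first lra.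
  apply: eq_ler; rewrite /b; field.
  by rewrite gt_eqF//; lra.
near=> n; rewrite /cPr_Gnm; set u := t n ^+ 2 * n%:R ^+ 2.
have u0 : 0 <= u by rewrite mulr_ge0 ?exprn_ge0// ltW.
have ue : eps^-1 <= u.
  have h : eps^-1 * n%:R <= 1 * (t n ^+ 2 * n%:R ^+ 2) by near: n; exact: t2n2_large.
  rewrite mul1r -/u in h; apply: le_trans h; apply: ler_peMr; first by rewrite invr_ge0 ltW.
  by rewrite ler1n; near: n; exact: nbhs_infty_gt.
have low : expR (- ((a + 1) * u)) <= Pr_Gnm R (m n) (fun G : graph n => tau R k G <= p ^+ k - t n ^+ k).
  by rewrite aE /u; near: n; exact: low_event_lower.
have up : Pr_Gnm R (m n) [pred G : graph n | (- (c * t n * n%:R) < eigval (adjmx R G) n) &&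
                                     (tau R k G <= p ^+ k - t n ^+ k)] <=
    expR (- ((kappa p / 2 * (c ^+ (k - 2))^-1 - 1) * u)).
  by rewrite /u; near: n; exact: low_tau_eigval_rate.
have P0 := lt_le_trans (expR_gt0 _) low.
rewrite ler_pdivrMr//; apply: le_trans up _.
apply: le_trans (ler_wpM2l (ltW e0) low).
rewrite -ler_pdivrMr ?expR_gt0// -expRN -expRD.
apply: (@le_trans _ _ (expR (- u))).
  by rewrite ler_expR; have := ler_wpM2r u0 rate; lra.
rewrite expRN -[leRHS]invrK lef_pV2 ?posrE ?expR_gt0 ?invr_gt0//.
by apply: le_trans ue _; apply: le_trans (expR_ge1Dx u); lra.
Unshelve. all: by end_near. Qed.

End Rates.

Unset Implicit Arguments.

Theorem theorem2 (R : realType) (k : nat) (p : R) (m : nat -> nat) (t : nat -> R)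
  (k_ge3 : (3 <= k)%N) (k_odd : odd k)
  (p_gt0 : 0 < p) (p_le_half : p <= 2^-1)
  (m_asymp : (fun n : nat => (m n)%:R - p * 'C(n, 2)%:R : R^o)
               =O_\oo (fun _ : nat => 1 : R^o))
  (t_gt0 : forall n : nat, 0 < t n)
  (t_lower : (fun n : nat => n%:R `^ (- c_star R k) : R^o)
               =o_\oo (fun n : nat => t n ^+ k : R^o))
  (t_upper : (fun n : nat => t n ^+ k : R^o)
               =o_\oo (fun _ : nat => 1 : R^o)) :
  let low_tau (n : nat) : pred (graph n) :=
    fun G => tau R k G <= p ^+ k - t n ^+ k in
  let t2n2 (n : nat) : R^o := t n ^+ 2 * n%:R ^+ 2 in
  [/\ exists2 err : nat -> R^o, err =o_\oo t2n2 &
        \forall n \near \oo,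
          Pr_Gnm R (m n) (low_tau n) <= expR (- (kappa p / 2) * t2n2 n + err n),
      exists2 err : nat -> R^o, err =o_\oo t2n2 &
        \forall n \near \oo,
          expR (- (1 / (2 * p * (1 - p))) * t2n2 n + err n)
            <= Pr_Gnm R (m n) (low_tau n)
    & forall eps : R, 0 < eps -> exists2 c : R, 0 < c &
        (limn_esup (fun n : nat =>
           (cPr_Gnm R (m n)
              (fun G => (- (c * t n * n%:R) < eigval (adjmx R G) n)%R)
              (low_tau n))%:E) <= eps%:E)%E].
Proof.
move=> low_tau t2n2.
have k_gt0 : (0 < k)%N by exact: leq_trans k_ge3.
have small := density_scale_small k_gt0 t_gt0 t_upper.
have large := density_scale_large t_gt0 t_lower.
have large3 : k = 3%N -> forall C, \forall n \near \oo, C <= t n ^+ 4 * n%:R.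
  by move=> k3; move: t_lower; rewrite k3; exact: density_scale_large3.
have [C0 close] := edge_count_close m_asymp.
have u0 n : 0 <= t2n2 n by rewrite mulr_ge0 ?exprn_ge0// ltW.
split.
- apply: upper_rate_littleo => // [n|d d0]; first exact: Pr_Gnm_ge0.
  exact: (low_tau_rate k_ge3 k_odd p_gt0 p_le_half t_gt0 small large large3 close d0).
- apply: lower_rate_littleo => // d d0.
  exact: (low_event_lower k_ge3 k_odd p_gt0 p_le_half t_gt0 small large close d0).
move=> eps e0; have [c c0 hc] :=
  low_tau_eigval k_ge3 k_odd p_gt0 p_le_half t_gt0 small large large3 close e0.
exists c => //; apply: limn_esup_le_near; move: hc; apply: filterS => n hn.
by rewrite lee_fin.
Qed.
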